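(* Let $V(x)=x^2/2$ and $\varepsilon\ge0$. Let $\gamma_N$ be either $\gamma^{\mathbf r}_{N,\varepsilon}$ (with $H=H^2_{\mathbf r}$, $\Sigma=\Sigma^\varepsilon$) or $\gamma^{\mathbf a}_{N,\varepsilon}$ (with $H=H^2_{\mathbf a}$, $\Sigma=\Sigma^\varepsilon_f$). Define $I(h)=\Sigma(h)-\inf_{g\in H}\Sigma(g)$ for $h\in H$ and $I(h)=+\infty$ otherwise. Then $I$ is a good rate function and for every open $\mathscr O$ and closed $\mathscr K$ in $C([0,1];\mathbb R)$ with the uniform topology, $$\liminf_{N\to\infty}\frac1N\log\gamma_N(h_N\in\mathscr O)\ge-\inf_{h\in\mathscr O}I(h),\qquad \limsup_{N\to\infty}\frac1N\log\gamma_N(h_N\in\mathscr K)\le-\inf_{h\in\mathscr K}I(h).$$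
   Context: For integers $\ell<r$, $r-\ell\ge2$, $\mathcal H_{[\ell,r]}(\phi)=\sum_{k=\ell+1}^{r-1}\frac12(\Delta\phi_k)^2$, $\Delta\phi_k=\phi_{k+1}+\phi_{k-1}-2\phi_k$. Fix $\mathbf r=(a,\alpha,b,\beta)\in\mathbb R^4$, $\mathbf a=(a,\alpha)$, boundary values $\psi^{(N)}(-1)=aN^2-\alpha N$, $\psi^{(N)}(0)=aN^2$, $\psi^{(N)}(N)=bN^2$, $\psi^{(N)}(N+1)=bN^2+\beta N$. Pinning measures on $\phi:\{-1,\dots,N+1\}\to\mathbb R$: $\gamma^{\mathbf r}_{N,\varepsilon}(d\phi)=Z_{N,\varepsilon}(\mathbf r)^{-1}e^{-\mathcal H_{[-1,N+1]}(\phi)}\prod_{k=1}^{N-1}(\varepsilon\delta_0(d\phi_k)+d\phi_k)\prod_{k\in\{-1,0,N,N+1\}}\delta_{\psi^{(N)}(k)}(d\phi_k)$ and $\gamma^{\mathbf a}_{N,\varepsilon}(d\phi)=Z_{N,\varepsilon}(\mathbf a)^{-1}e^{-\mathcal H_{[-1,N+1]}(\phi)}\prod_{k=1}^{N+1}(\varepsilon\delta_0(d\phi_k)+d\phi_k)\prod_{k\in\{-1,0\}}\delta_{\psi^{(N)}(k)}(d\phi_k)$, where $d\phi_k$ is Lebesgue measure and the $Z$'s normalise. $Z_N(\mathbf 0)$ denotes the normalisation with $\varepsilon=0$ and $\mathbf r=0$. The profile $h_N$ is the linear interpolation on $[0,1]$ of $h_N(k/N)=\phi_k/N^2$. $H^2_{\mathbf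 r}=\{h\in H^2([0,1]):h(0)=a,h(1)=b,\dot h(0)=\alpha,\dot h(1)=\beta\}$, $H^2_{\mathbf a}=\{h\in H^2([0,1]):h(0)=a,\dot h(0)=\alpha\}$. The free energy $\tau(\varepsilon)=\lim_{N\to\infty}\frac1N\log\frac{Z_{N,\varepsilon}(\mathbf 0)}{Z_N(\mathbf 0)}$ exists for all $\varepsilon\ge0$ (known result). For $h$ in $H^2_{\mathbf r}$ resp. $H^2_{\mathbf a}$, $\Sigma^\varepsilon(h)$ resp. $\Sigma^\varepsilon_f(h)$ equals $\frac12\int_0^1\ddot h(t)^2dt-\tau(\varepsilon)\,|\{t\in[0,1]:h(t)=0\}|$, with $|\cdot|$ Lebesgue measure. *)

(* Defs.v *)
From HB Require Import structures.
From mathcomp Require Import all_boot all_order all_algebra.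
From mathcomp Require Import all_classical all_reals all_analysis.
Set Implicit Arguments. Unset Strict Implicit. Unset Printing Implicit Defensive.
Import Order.TTheory GRing.Theory Num.Theory.
Import numFieldNormedType.Exports.
Local Open Scope classical_set_scope.
Local Open Scope ring_scope.

Section Defs.
Variable R : realType.

(* Fields.  A field phi : {-1,...,N+1} -> R is represented by          *)
(*   fld : nat -> R   with   fld i = phi_(i-1),   i = 0,...,N+2.       *)

(* H_[-1,N+1](phi) = sum_(k=0)^(N) 1/2 (phi_(k+1)+phi_(k-1)-2 phi_k)^2,
   written with i = k+1. *)
Definition Ham (N : nat) (fld : nat -> R) : R :=
  \sum_(1 <= i < N.+2) (fld i.+1 + fld i.-1 - 2 * fld i) ^+ 2 / 2.

Definition mref (eps : {nonneg R}) :=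
  @measure_add _ (measurableTypeR R) R
    (mscale eps (@dirac _ (measurableTypeR R) 0 R)) (@lebesgue_measure R).

(* iterated integral of F over n free variables v 0, ..., v (n-1),
   each against the measure m (equal, by Tonelli, to the integral of F
   against the n-fold product measure m^{(x) n} for nonnegative F) *)
Fixpoint iint (m : set R -> \bar R) (n : nat)
    (F : (nat -> R) -> \bar R) : \bar R :=
  match n with
  | 0 => F (fun _ => 0)
  | n'.+1 => (\int[m]_x iint m n'
                (fun v => F (fun i => if i == n' then x else v i)))%E
  end.

(* pinned model gamma^r_(N,eps): phi_(-1),phi_0,phi_N,phi_(N+1) fixed
   by psi^(N); free variables v 0..v (N-2) are phi_1..phi_(N-1). *)
Definition fld_r (a al b be : R) (N : nat) (v : nat -> R) : nat -> R :=
  fun i =>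
    if i == 0%N then a * N%:R ^+ 2 - al * N%:R
    else if i == 1%N then a * N%:R ^+ 2
    else if i == N.+1 then b * N%:R ^+ 2
    else if i == N.+2 then b * N%:R ^+ 2 + be * N%:R
    else v (i - 2)%N.

(* free-end model gamma^a_(N,eps): phi_(-1),phi_0 fixed; free
   variables v 0..v N are phi_1..phi_(N+1). *)
Definition fld_a (a al : R) (N : nat) (v : nat -> R) : nat -> R :=
  fun i =>
    if i == 0%N then a * N%:R ^+ 2 - al * N%:R
    else if i == 1%N then a * N%:R ^+ 2
    else v (i - 2)%N.

Definition weight (eps : {nonneg R}) (nfree : nat)
    (fld : (nat -> R) -> nat -> R) (N : nat) (E : set (nat -> R)) : \bar R :=
  iint (mref eps) nfree
    (fun v => ((expR (- Ham N (fld v))) * (\1_E (fld v) : R))%:E).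

Definition prob (eps : {nonneg R}) (nfree : nat)
    (fld : (nat -> R) -> nat -> R) (N : nat) (E : set (nat -> R)) : \bar R :=
  (fine (weight eps nfree fld N E) / fine (weight eps nfree fld N setT))%:E.

Definition gamma_r (a al b be : R) (eps : {nonneg R}) (N : nat) :=
  prob eps (N.-1) (fld_r a al b be N) N.
Definition gamma_a (a al : R) (eps : {nonneg R}) (N : nat) :=
  prob eps (N.+1) (fld_a a al N) N.

Definition Z_r0 (eps : {nonneg R}) (N : nat) : \bar R :=
  weight eps (N.-1) (fld_r 0 0 0 0 N) N setT.

Definition tau (eps : {nonneg R}) : R :=
  lim ((fun N : nat => N%:R^-1 *
          ln (fine (Z_r0 eps N) / fine (Z_r0 0%:nng N))) @ \oo).

(* profile h_N: linear interpolation of h_N(k/N) = phi_k / N^2 on [0,1]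
   (extended by the same formula outside [0,1]; irrelevant below) *)
Definition profile (N : nat) (fld : nat -> R) (t : R) : R :=
  let s := N%:R * t in
  let k := minn (Num.truncn s) N.-1 in
  ((k.+1%:R - s) * fld k.+1 + (s - k%:R) * fld k.+2) / N%:R ^+ 2.

(* C([0,1];R) with the uniform topology.  Elements are represented by *)
(* functions R -> R continuous on [0,1]; only values on [0,1] matter.  *)
Definition I01 : set R := `[0, 1]%classic.

Definition C01 : set (R -> R) :=
  [set f : R -> R | {within I01, continuous f}].

Definition uball (f : R -> R) (d : R) : set (R -> R) :=
  [set g | C01 g /\ forall t, t \in I01 -> `|f t - g t| < d].

Definition openC (O : set (R -> R)) : Prop :=
  O `<=` C01 /\ forall f, O f -> exists2 d : R, 0 < d & uball f d `<=` O.

Definition closedC (K : set (R -> R)) : Prop :=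
  K `<=` C01 /\ openC (C01 `\` K).

Definition compactC (K : set (R -> R)) : Prop :=
  K `<=` C01 /\
  forall (I : Type) (U : I -> set (R -> R)), (forall i, openC (U i)) ->
    K `<=` \bigcup_i U i ->
    exists2 J : set I, finite_set J & K `<=` \bigcup_(i in J) U i.

Definition good_rate_function (I : (R -> R) -> \bar R) : Prop :=
  (forall f, C01 f -> (0 <= I f)%E) /\
  (forall c : R, closedC [set f | C01 f /\ (I f <= c%:E)%E]) /\
  (forall c : R, compactC [set f | C01 f /\ (I f <= c%:E)%E]).

(* H^2([0,1]):  h in H^2 with first derivative h1 (continuous) and     *)
(* second (weak) derivative g in L^2([0,1]):                            *)
(*   h1 t = h1 0 + int_0^t g,   h t = h 0 + int_0^t h1,  t in [0,1].    *)
Definition H2rep (h h1 g : R -> R) : Prop :=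
  measurable_fun I01 g /\
  (\int[lebesgue_measure]_(x in I01) ((g x) ^+ 2)%:E < +oo)%E /\
  forall t, t \in I01 ->
    h1 t = h1 0 + Rintegral lebesgue_measure `[0, t] g /\
    h t = h 0 + Rintegral lebesgue_measure `[0, t] h1.

Definition H2r (a al b be : R) (h g : R -> R) : Prop :=
  exists h1, [/\ H2rep h h1 g, h 0 = a, h 1 = b, h1 0 = al & h1 1 = be].
Definition H2a (a al : R) (h g : R -> R) : Prop :=
  exists h1, [/\ H2rep h h1 g, h 0 = a & h1 0 = al].

Definition Sigma (eps : {nonneg R}) (h g : R -> R) : \bar R :=
  ((2^-1)%:E * \int[lebesgue_measure]_(x in I01) ((g x) ^+ 2)%:E
   - (tau eps)%:E * lebesgue_measure [set t | t \in I01 /\ h t = 0%R])%E.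

(* I(h) = Sigma(h) - inf_H Sigma  if h in H,  +oo otherwise
   (ereal_inf of the empty set is +oo; the value Sigma h g does not
    depend on the choice of g, which is unique a.e.) *)
Definition rate (eps : {nonneg R}) (Hsp : (R -> R) -> (R -> R) -> Prop)
    (h : R -> R) : \bar R :=
  ereal_inf [set (Sigma eps h g -
      ereal_inf [set x | exists h' g', Hsp h' g' /\ x = Sigma eps h' g'])%E
    | g in Hsp h].

Definition LDP (P : nat -> set (R -> R) -> \bar R) (I : (R -> R) -> \bar R) :=
  good_rate_function I /\
  (forall O, openC O ->
     (- ereal_inf (I @` O) <= limn_einf (fun N => (N%:R^-1)%:E * lne (P N O)))%E) /\
  (forall K, closedC K ->
     (limn_esup (fun N => (N%:R^-1)%:E * lne (P N K)) <= - ereal_inf (I @` K))%E).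

End Defs.

(* Main.v *)
(* For V(x) = x^2/2 the Hamiltonian is half the squared norm of the discrete
   second derivative of the field, and every integrand that occurs is dominated
   by, or equal to, a finite sum of Gaussians exp(-q) with q a nonnegative
   quadratic form.  Integrating one coordinate against [epsilon delta_0 + dx]
   preserves this class, and a member of it is maximal at the origin; this
   replaces every correlation or concentration inequality.

   Free energy.  Cutting a chain with a free end at a site is submultiplicative,
   so Fekete's lemma gives a rate [rate_inf]; changing boundary conditions costs
   a polynomial factor, hence tau = rate_inf epsilon - rate_inf 0.

   Upper bound.  The profile is exactly a + alpha t + (1/N) sum_j (t - j/N)^+ om_j
   with om the discrete second derivative.  Tilting by a kernel k, a finite
   combination of ramps, bounds the weight of a ball around f by
   exp(-N (Lam k f - |k|_2^2 / 2)) times the partition function of a chain pinned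
   only where f is small, i.e. by exp(N tau |{f = 0}|) at exponential scale.
   Optimising over k yields half the squared L^2 norm of f'', with f in H^2 if
   the supremum is finite.  The energy controls the Lipschitz constant of the
   profile, which gives exponential tightness and, with Tychonoff's theorem,
   finite covers.

   Lower bound.  Almost everywhere on {h = 0} also h' = 0.  In each of M cells h
   is set to zero between the first and the last point where h = h' = 0; this
   does not increase the energy and the field can be translated by N^2 h
   without moving the pinned sites.  A Chernoff bound for linear functionals
   shows that under the centered measure, conditioned to be pinned only there,
   the fluctuations and the cross term are negligible.

   Both bounds on small balls also give the closedness and the compactness of
   the level sets, so no semicontinuity of the functional has to be proved. *)
Require Import Defs.
From HB Require Import structures.
From mathcomp Require Import all_boot all_order all_algebra.
From mathcomp Require Import all_classical all_reals all_analysis measurable_realfun.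
From mathcomp Require Import ring lra zify.
Set Implicit Arguments.
Unset Strict Implicit.
Unset Printing Implicit Defensive.
Import Order.TTheory GRing.Theory Num.Theory.
Import numFieldNormedType.Exports.
Local Open Scope classical_set_scope.
Local Open Scope ring_scope.

(** * Lower integrals *)

(** Boundary data and tilts are affine in the field, whereas the comparison with the origin concerns
    quadratic forms. An additional coordinate, held at 1 and never integrated, makes them linear; at
    the origin it is 0, which removes the boundary data and the tilt in one stroke, so every model
    is compared with a chain with zero boundary values. Pinning is handled by choosing the sites
    that keep their atom. In a small ball around f, a site where f is away from 0 cannot vanish, so
    its atom is dropped in the upper bound. In the lower bound only the sites where the target
    profile is 0 keep their atom, since only the others can be translated. The obstacle is
    measurability: events are arbitrary open or closed sets, and the iterated integrals are lower
    integrals, which are not additive. Upper bounds are therefore carried as certificates, namely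
    pointwise dominations by measurable Gaussian sums, and these do add under finite unions. *)

Section Integrals.
Context {R : realType}.
Notation leb := (@lebesgue_measure R).
Local Open Scope ereal_scope.

Lemma gauss_integral_shift (A m : R) : (0 < A)%R ->
  \int[leb]_x (expR (- (A * (x + m) ^+ 2)))%:E = (Num.sqrt (pi / A))%:E.
Proof.
move=> A0; pose s : R := Num.sqrt (2 * A)^-1.
have A20 : (0 < (2 * A)^-1)%R by rewrite invr_gt0 mulr_gt0.
have s0 : s != 0%R by rewrite gt_eqF// sqrtr_gt0.
have sE : (s ^+ 2 = (2 * A)^-1)%R by rewrite sqr_sqrtr// ltW.
have pk : ((normal_peak s)^-1 = Num.sqrt (pi / A) :> R)%R.
  rewrite /normal_peak invrK sE; congr Num.sqrt.
  by rewrite -mulr_natr; field; rewrite gt_eqF.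
have -> : \int[leb]_x (expR (- (A * (x + m) ^+ 2)))%:E =
   \int[leb]_x ((Num.sqrt (pi / A))%:E * (normal_pdf (- m)%R s x)%:E).
  apply: eq_integral => x _; rewrite normal_pdfE// -pk -EFinM mulKf.
    congr (expR _)%:E; rewrite sE opprK -mulr_natr.
    by field; rewrite gt_eqF.
  by rewrite gt_eqF// normal_peak_gt0.
rewrite ge0_integralZl//=; last 2 first.
- by apply: measurableT_comp => //; exact: measurable_normal_pdf.
- by move=> x _; rewrite lee_fin normal_pdf_ge0.
by rewrite integral_normal_pdf mule1.
Qed.

Import HBNNSimple.

(** The integral of a nonnegative function is a supremum over the simple functions below it, hence
    monotone even for densities restricted to arbitrary events. *)
Lemma nonmeasurable_le_integral d (T : measurableType d)
    (mu : {measure set T -> \bar R}) (f g : T -> \bar R) :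
  (forall x, 0 <= f x) -> (forall x, f x <= g x) ->
  \int[mu]_x f x <= \int[mu]_x g x.
Proof.
move=> f0 fg; have g0 x : 0 <= g x by exact: le_trans (fg x).
rewrite !ge0_integralTE//; apply: ge_ereal_sup => _ [h hf <-].
by apply: ereal_sup_ubound; exists h => // x; exact: le_trans (fg x).
Qed.

Lemma integral_le_simple d (T : measurableType d)
    (mu : {measure set T -> \bar R}) (f : T -> \bar R) (M : \bar R) :
  (forall x, 0 <= f x) ->
  (forall h : {nnsfun T >-> R}, (forall x, (h x)%:E <= f x) ->
     \int[mu]_x (h x)%:E <= M) ->
  \int[mu]_x f x <= M.
Proof.
move=> f0 H; rewrite ge0_integralTE//; apply: ge_ereal_sup => _ [h hf <-].
by rewrite -integralT_nnsfun; exact: H.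
Qed.

(* The integral of a nonnegative function that is not measurable is a lower
   integral: it is superadditive in general, and subadditive only when one of
   the two summands is measurable. *)
Lemma lower_integralD_le d (T : measurableType d)
    (mu : {measure set T -> \bar R}) (f g : T -> \bar R) :
  (forall x, 0 <= f x) -> (forall x, 0 <= g x) -> measurable_fun [set: T] g ->
  \int[mu]_x (f x + g x) <= \int[mu]_x f x + \int[mu]_x g x.
Proof.
move=> f0 g0 mg; apply: integral_le_simple => [x|h hfg]; first exact: adde_ge0.
(* The truncated difference is measurable, lies below [f] because [h <= f + g], and together with
   [g] dominates [h]. *)
pose k x := maxe ((h x)%:E - g x) 0.
have mk : measurable_fun [set: T] k.
  apply: measurable_maxe => //; apply: emeasurable_funB => //.
  by apply/measurable_EFinP.
have k0 x : 0 <= k x by rewrite /k le_max lexx orbT.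
have kf x : k x <= f x.
  rewrite /k ge_max f0 andbT; have := hfg x; have := g0 x; have := f0 x.
  case: (f x) (g x) => [a||] [b||]//=; rewrite ?leey ?leNye//.
  by rewrite -EFinD -EFinB !lee_fin lerBlDr.
have hk x : (h x)%:E <= k x + g x.
  have := k0 x; rewrite /k; have := g0 x; case: (g x) => [b||]//= b0 kx.
    rewrite -EFinB -EFin_max -EFinD lee_fin.
    by rewrite -lerBlDr le_max lexx.
  by rewrite addey ?leey// -ltNye (lt_le_trans _ kx) ?ltNyr.
apply: (@le_trans _ _ (\int[mu]_x (k x + g x))).
  by apply: nonmeasurable_le_integral => // x; rewrite lee_fin.
rewrite ge0_integralD//; apply: leeD => //.
exact: nonmeasurable_le_integral.
Qed.

End Integrals.

(** * Gaussian sums and one-site integration *)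

Section QuadraticForms.
Context {R : realType}.
Notation V := (nat -> R).

Definition upd (w : V) (i : nat) x : V := fun k => if k == i then x else w k.
Definition dl (i : nat) : V := fun k => (k == i)%:R.

Lemma fE c (u v : V) k : (c *: u + v) k = c * u k + v k. Proof. by []. Qed.

Lemma updE w i x : upd w i x = x *: dl i + upd w i 0.
Proof.
apply/funext => k; rewrite fE /upd /dl.
by case: (k == i); rewrite ?(mulr1, addr0, mulr0, add0r).
Qed.

Lemma upd_linear c u v i : upd (c *: u + v) i 0 = c *: upd u i 0 + upd v i 0.
Proof.
apply/funext => k; rewrite fE /upd fE.
by case: eqP; rewrite // mulr0 addr0.
Qed.

Lemma updC w i j x y : i != j -> upd (upd w i x) j y = upd (upd w j y) i x.
Proof.
move=> ij; apply/funext => k; rewrite /upd.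
by case: (eqVneq k j) => // ->; rewrite eq_sym (negbTE ij).
Qed.

Lemma upd0 i : upd 0 i 0 = 0 :> V.
Proof. by apply/funext => k; rewrite /upd; case: eqP. Qed.

Definition lin (l : V -> R) := forall c u v, l (c *: u + v) = c * l u + l v.

Definition bilsym (b : V -> V -> R) :=
  (forall u v, b u v = b v u) /\ forall v, lin (b v).

Definition qform (q : V -> R) := exists2 b, bilsym b & forall u, q u = b u u.

Definition nnq q := qform q /\ forall u, 0 <= q u.

Lemma lin0 l : lin l -> l 0 = 0.
Proof. by move=> L; have := L (-1) 0 0; rewrite scaler0 addr0; lra. Qed.

Lemma lin_upd l w i x : lin l -> l (upd w i x) = x * l (dl i) + l (upd w i 0).
Proof. by move=> L; rewrite updE L. Qed.

Lemma bil_upd b w i x : bilsym b -> b (upd w i x) (upd w i x) =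
  x ^+ 2 * b (dl i) (dl i) + 2 * x * b (upd w i 0) (dl i)
   + b (upd w i 0) (upd w i 0).
Proof.
move=> [bs bl]; rewrite (updE w i x) bl ![b (_ + _) _]bs !bl.
by rewrite (bs (dl i) (upd w i 0)); ring.
Qed.

Lemma nnq0 q : nnq q -> q 0 = 0.
Proof. by move=> [[b [bs bl] qb] _]; rewrite qb (lin0 (bl 0)). Qed.

Lemma nnq_upd0 q i : nnq q -> nnq (fun w => q (upd w i 0)).
Proof.
move=> [[b [bs bl] qb] q0]; split; last by move=> u; exact: q0.
exists (fun u v => b (upd u i 0) (upd v i 0)) => [|u]; last exact: qb.
by split=> [u v|v c u u']; [exact: bs|rewrite upd_linear; exact: bl].
Qed.

(** The coefficient of the squared coordinate is nonnegative. If it is 0, nonnegativity of [q] kills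
    the linear term as well and the coordinate drops out; otherwise [q'] is the minimum of [q] over
    that coordinate, hence again a nonnegative form. *)
Lemma complete_square q i : nnq q ->
  (forall w x, q (upd w i x) = q (upd w i 0)) \/
  exists A m q', [/\ 0 < A, nnq q', (forall w, q' w <= q (upd w i 0)) &
     forall w x, q (upd w i x) = A * (x + m w) ^+ 2 + q' w].
Proof.
move=> nq; have [[b [bs bl] qb] q0] := nq; pose A := b (dl i) (dl i).
have : 0 <= A by rewrite /A -qb.
rewrite le_eqVlt => /orP[/eqP A0|A0].
  left=> w x; have B0 : b (upd w i 0) (dl i) = 0.
    apply/eqP; apply: contraT => B0.
    (* At this value of the coordinate the linear term would make [q] equal to -1. *)
    have := q0 (upd w i (- (1 + q (upd w i 0)) / (2 * b (upd w i 0) (dl i)))).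
    rewrite [X in 0 <= X]qb bil_upd// -/A -A0 mulr0 add0r -qb => H.
    exfalso; move: H; set y := q _; set B := b _ _ in B0 *.
    rewrite (_ : 2 * (- (1 + y) / (2 * B)) * B + y = -1); last by field.
    by rewrite ler0N1.
  by rewrite !qb bil_upd// -/A -A0 B0 !mulr0 !add0r.
right; exists A, (fun w => b (dl i) (upd w i 0) / A).
pose b' u v := b (upd u i 0) (upd v i 0)
   - b (dl i) (upd u i 0) * b (dl i) (upd v i 0) / A.
have E w x : q (upd w i x) = A * (x + b (dl i) (upd w i 0) / A) ^+ 2 + b' w w.
  rewrite qb bil_upd// -/A (bs (upd w i 0) (dl i)) /b'.
  by field; rewrite gt_eqF.
have b'0 u : 0 <= b' u u.
  have := q0 (upd u i (- (b (dl i) (upd u i 0) / A))).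
  by rewrite E addNr expr0n/= mulr0 add0r.
exists (fun w => b' w w); split => //.
- split=> //; exists b' => //; split=> [u v|v c u u'].
    by rewrite /b' bs; congr (_ - _); ring.
  by rewrite /b' upd_linear !bl; field; rewrite gt_eqF.
- by move=> w; rewrite E; rewrite lerDr mulr_ge0 ?sqr_ge0// ltW.
Qed.

(* The envelope [Q] bounds the decay of [F] from below, uniformly in the
   quadratic forms that make up [F]: see [GS_env]. *)
Inductive GS (Q : V -> R) : (V -> \bar R) -> Prop :=
| GS1 c q : (0 <= c)%E -> nnq q -> (forall w, q w <= Q w) ->
    GS Q (fun w => c * (expR (- q w))%:E)%E
| GSD F G : GS Q F -> GS Q G -> GS Q (fun w => F w + G w)%E.

Lemma GS_ge0 Q F w : GS Q F -> (0 <= F w)%E.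
Proof.
elim=> [c q c0 _ _|{}F G _ ? _ ?]; last exact: adde_ge0.
by rewrite mule_ge0// lee_fin expR_ge0.
Qed.

Lemma GS_le0 Q F w : GS Q F -> (F w <= F 0%R)%E.
Proof.
elim=> [c q c0 nq _|{}F G _ ? _ ?]; last exact: leeD.
rewrite lee_wpmul2l// lee_fin ler_expR (nnq0 nq) oppr0 oppr_le0.
by case: nq.
Qed.

Lemma GS_env Q F w : GS Q F -> ((expR (- Q w))%:E * F 0%R <= F w)%E.
Proof.
elim=> [c q c0 nq qQ|{}F G GF ? GG ?]; last first.
  by rewrite ge0_muleDr ?(GS_ge0 _ GF) ?(GS_ge0 _ GG)// leeD.
rewrite (nnq0 nq) oppr0 expR0 mule1 muleC lee_wpmul2l// lee_fin ler_expR.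
by rewrite lerN2.
Qed.

Lemma GS_le Q Q' F : (forall w, Q w <= Q' w) -> GS Q F -> GS Q' F.
Proof.
move=> QQ; elim=> [c q c0 nq qQ|{}F G _ ? _ ?]; last exact: GSD.
by apply: GS1 => // w; exact: le_trans (QQ w).
Qed.

Lemma GS_scale Q F (k : \bar R) : (0 <= k)%E -> GS Q F ->
  GS Q (fun w => k * F w)%E.
Proof.
move=> k0; elim=> [c q c0 nq qQ|{}F G GF IF GG IG].
  under eq_fun do rewrite muleA.
  by apply: GS1 => //; exact: mule_ge0.
rewrite (_ : (fun w => _) = (fun w => k * F w + k * G w)%E); first exact: GSD.
apply/funext => w.
by rewrite ge0_muleDr// ?(GS_ge0 _ GF)// (GS_ge0 _ GG).
Qed.

Lemma GS_expR q : nnq q -> GS q (fun w => (expR (- q w))%:E).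
Proof.
move=> nq; under eq_fun do rewrite -[_%:E]mul1e.
by apply: GS1.
Qed.

Notation mR := (measurableTypeR R).

Lemma nnq_measurable_upd q i w : nnq q ->
  measurable_fun [set: mR] (fun x : mR => q (upd w i x)).
Proof.
move=> [[b bb qb] _].
under eq_fun do rewrite qb bil_upd//.
by repeat first [exact: measurable_cst | exact: measurable_id |
  apply: measurable_funD | apply: measurable_funM | apply: measurable_funX].
Qed.

Lemma nnq_measurable_upd2 q i j w : nnq q -> i != j ->
  measurable_fun [set: (mR * mR)%type]
    (fun p : mR * mR => q (upd (upd w i p.1) j p.2)).
Proof.
move=> [[b bb qb] _] ij; have [bs bl] := bb.
under eq_fun => p.
  rewrite qb bil_upd// (updC _ _ _ ij) bil_upd//
    (bs (upd (upd w j 0) i p.1) (dl j)).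
  rewrite (lin_upd (upd w j 0) i p.1 (bl _)).
  over.
by repeat first [exact: measurable_cst | exact: measurable_fst |
  exact: measurable_snd |
  apply: measurable_funD | apply: measurable_funM | apply: measurable_funX].
Qed.

Lemma GS_measurable Q F i w : GS Q F ->
  measurable_fun [set: mR] (fun x : mR => F (upd w i x)).
Proof.
elim=> [c q c0 nq _|{}F G _ ? _ ?]; last exact: emeasurable_funD.
apply: measurable_funeM; apply/measurable_EFinP.
apply: measurableT_comp => //; apply: measurableT_comp => //.
exact: nnq_measurable_upd.
Qed.

Lemma GS_measurable2 Q F i j w : GS Q F -> i != j ->
  measurable_fun [set: (mR * mR)%type]
    (fun p : mR * mR => F (upd (upd w i p.1) j p.2)).
Proof.
move=> + ij; elim=> [c q c0 nq _|{}F G _ ? _ ?]; last exact: emeasurable_funD.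
apply: measurable_funeM; apply/measurable_EFinP.
apply: measurableT_comp => //; apply: measurableT_comp => //.
exact: nnq_measurable_upd2.
Qed.

Notation leb := (@lebesgue_measure R).

(** A nondegenerate coordinate contributes a constant and leaves the minimised form, which is at
    most the form with that coordinate set to 0; so the envelope is evaluated there. *)
Lemma GS_integral Q F i : GS Q F ->
  GS (fun w => Q (upd w i 0)) (fun w => \int[leb]_x F (upd w i x))%E.
Proof.
elim=> [c q c0 nq qQ|{}F G GF IF GG IG]; last first.
  rewrite (_ : (fun w => _) = (fun w =>
    \int[leb]_x F (upd w i x) + \int[leb]_x G (upd w i x))%E); first exact: GSD.
  apply/funext => w; rewrite ge0_integralD//.
  - by move=> *; exact: (GS_ge0 _ GF).
  - exact: (GS_measurable i w GF).
  - by move=> *; exact: (GS_ge0 _ GG).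
  - exact: (GS_measurable i w GG).
have [E|[A [m [q' [A0 nq' q'q E]]]]] := complete_square i nq.
  (* Flat direction: the constant may become [+oo], which is why the coefficients of a Gaussian sum
     are extended reals. *)
  rewrite (_ : (fun w => _) = (fun w =>
      (c * leb setT) * (expR (- q (upd w i 0%R)))%:E)%E); last first.
    apply/funext => w; under eq_integral do rewrite E.
    by rewrite integral_cst// muleAC.
  apply: GS1; first by rewrite mule_ge0.
    exact: nnq_upd0.
  by move=> w; exact: qQ.
have -> : (fun w => \int[leb]_x (c * (expR (- q (upd w i x)))%:E))%E =
    (fun w => (c * (Num.sqrt (pi / A))%:E) * (expR (- q' w))%:E)%E.
  apply/funext => w; under eq_integral.
    move=> x _; rewrite E opprD expRD EFinM muleC -muleA [(_ * c)%E]muleC.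
    over.
  rewrite (ge0_integralZr leb measurableT); last 3 first.
  - apply/measurable_EFinP; apply: measurableT_comp => //.
    by repeat first [exact: measurable_cst | exact: measurable_id |
      apply: measurable_funD | apply: measurable_funM | apply: measurable_funX |
      apply: measurable_funN].
  - by move=> x _; rewrite lee_fin expR_ge0.
  - by rewrite mule_ge0// lee_fin expR_ge0.
  by rewrite gauss_integral_shift// muleA [(_ * c)%E]muleC.
apply: GS1 => //; first by rewrite mule_ge0// lee_fin sqrtr_ge0.
by move=> w; exact: le_trans (q'q w) (qQ _).
Qed.

(** Translation invariance is read off from the completed square: the value of a Gaussian integral
    does not depend on its centre. *)
Lemma GS_integral_shift Q F i w y : GS Q F ->
  (\int[leb]_x F (upd w i (x + y)%R) = \int[leb]_x F (upd w i x))%E.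
Proof.
have ms : measurable_fun [set: mR] (fun x : mR => x + y : mR).
  by apply: measurable_funD => //; exact: measurable_cst.
elim=> [c q c0 nq qQ|{}F G GF IF GG IG]; last first.
  rewrite !ge0_integralD//; first by rewrite IF IG.
  - by move=> *; exact: (GS_ge0 _ GF).
  - exact: (GS_measurable _ _ GF).
  - by move=> *; exact: (GS_ge0 _ GG).
  - exact: (GS_measurable _ _ GG).
  - by move=> *; exact: (GS_ge0 _ GF).
  - exact: (measurableT_comp (GS_measurable i w GF) ms).
  - by move=> *; exact: (GS_ge0 _ GG).
  - exact: (measurableT_comp (GS_measurable i w GG) ms).
have mq : measurable_fun [set: mR] (fun x : mR => (expR (- q (upd w i x)))%:E).
  apply/measurable_EFinP; apply: measurableT_comp => //.
  by apply: measurableT_comp => //; exact: nnq_measurable_upd.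
have e0 x : (setT x -> 0 <= (expR (- q (upd w i x)))%:E)%E.
  by rewrite lee_fin expR_ge0.
rewrite (ge0_integralZl leb measurableT mq e0 c0).
rewrite (ge0_integralZl leb measurableT (measurableT_comp mq ms)
  (fun x _ => e0 (x + y) I) c0).
have [E|[A [m [q' [A0 nq' q'q E]]]]] := complete_square i nq.
  by congr (_ * _)%E; apply: eq_integral => x _ /=; rewrite !E.
have H z : (\int[leb]_x (expR (- q (upd w i (x + z)%R)))%:E =
    (expR (- q' w))%:E * (Num.sqrt (pi / A))%:E)%E.
  under eq_integral do rewrite E opprD expRD mulrC EFinM -addrA.
  rewrite ge0_integralZl//; first by rewrite gauss_integral_shift.
  apply/measurable_EFinP; apply: measurableT_comp => //.
  by repeat first [exact: measurable_cst | exact: measurable_id |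
    apply: measurable_funD | apply: measurable_funM | apply: measurable_funX |
    apply: measurable_funN].
congr (_ * _)%E; have := H y; rewrite -(H 0) /= => ->.
by apply: eq_integral => x _; rewrite addr0.
Qed.

(** Integration of one coordinate against [m.1 * delta_0 + m.2 * dx]. The two parts are kept apart,
    and both weights are free, so that a single site can be pinned, unpinned or frozen at 0. *)
Definition Iop (m : {nonneg R} * {nonneg R}) (i : nat) (F : V -> \bar R) w : \bar R :=
  ((m.1%:num)%:E * F (upd w i 0%R) +
   (m.2%:num)%:E * \int[leb]_x F (upd w i x))%E.

Lemma Iop_ge0 m i F w : (forall v, 0 <= F v)%E -> (0 <= Iop m i F w)%E.
Proof.
move=> F0; apply: adde_ge0; rewrite mule_ge0 ?lee_fin//.
by apply: integral_ge0 => x _.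
Qed.

Lemma GS_upd0 Q F i : GS Q F -> GS (fun w => Q (upd w i 0)) (fun w => F (upd w i 0%R)).
Proof.
elim=> [c q c0 nq qQ|{}F G GF IF GG IG]; last exact: GSD.
by apply: (GS1 c0 (nnq_upd0 i nq)) => w; exact: qQ.
Qed.

Lemma GS_Iop Q F m i : GS Q F -> GS (fun w => Q (upd w i 0)) (Iop m i F).
Proof.
move=> GF; apply: GSD; apply: GS_scale; rewrite ?lee_fin//.
  exact: GS_upd0.
exact: GS_integral.
Qed.

Lemma le_Iop m i F G : (forall v, 0 <= F v)%E -> (forall v, F v <= G v)%E ->
  forall w, (Iop m i F w <= Iop m i G w)%E.
Proof.
move=> F0 FG w; apply: leeD; rewrite lee_wpmul2l ?lee_fin//.
exact: nonmeasurable_le_integral.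
Qed.

Lemma Iop_mono m m' i F w : (forall v, 0 <= F v)%E ->
  m.1%:num <= m'.1%:num -> m.2%:num <= m'.2%:num ->
  (Iop m i F w <= Iop m' i F w)%E.
Proof.
move=> F0 m1 m2; apply: leeD; rewrite lee_wpmul2r ?lee_fin//.
exact: integral_ge0.
Qed.

Lemma IopD_le Q m i F G w : (forall v, 0 <= F v)%E -> GS Q G ->
  (Iop m i (fun v => F v + G v) w <= Iop m i F w + Iop m i G w)%E.
Proof.
move=> F0 GG; rewrite /Iop ge0_muleDr// ?(GS_ge0 _ GG)//.
rewrite [leRHS]addeACA leeD2l// -ge0_muleDr ?integral_ge0//; last first.
  by move=> *; exact: (GS_ge0 _ GG).
rewrite lee_wpmul2l ?lee_fin//; apply: lower_integralD_le => //.
  by move=> *; exact: (GS_ge0 _ GG).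
exact: (GS_measurable _ _ GG).
Qed.

Lemma IopZ Q m i F (h : V -> R) w : GS Q F ->
  (forall v, 0 <= h v) -> (forall v x, h (upd v i x) = h v) ->
  Iop m i (fun v => F v * (h v)%:E)%E w = (Iop m i F w * (h w)%:E)%E.
Proof.
move=> GF h0 hi; have F0 v := GS_ge0 v GF.
rewrite /Iop hi; under eq_integral do rewrite hi.
rewrite ge0_integralZr// ?lee_fin//; last exact: (GS_measurable i w GF).
have I0 : (0 <= \int[leb]_x F (upd w i x))%E by exact: integral_ge0.
have p1 : (0 <= (m.1%:num)%:E * F (upd w i 0%R))%E by rewrite mule_ge0.
have p2 : (0 <= (m.2%:num)%:E * \int[leb]_x F (upd w i x))%E by rewrite mule_ge0.
by rewrite [RHS]ge0_muleDl; [rewrite !muleA|exact: p1|exact: p2].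
Qed.

Lemma mule_addC (n1 n2 m1 m2 a b c d : \bar R) :
  (0 <= n1 -> 0 <= n2 -> 0 <= m1 -> 0 <= m2 ->
   0 <= a -> 0 <= b -> 0 <= c -> 0 <= d ->
   n1 * (m1 * a + m2 * b) + n2 * (m1 * c + m2 * d) =
   m1 * (n1 * a + n2 * c) + m2 * (n1 * b + n2 * d))%E.
Proof.
move=> *; rewrite !ge0_muleDr ?mule_ge0// addeACA.
by congr (_ + _ + (_ + _))%E; rewrite muleCA.
Qed.

Lemma IopC Q m m' i j F w : i != j -> GS Q F ->
  Iop m i (Iop m' j F) w = Iop m' j (Iop m i F) w.
Proof.
move=> ij GF; have F0 v := GS_ge0 v GF.
have ji : j != i by rewrite eq_sym.
have X k l n a : k != l -> (\int[leb]_x Iop n l F (upd a k x) =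
   (n.1%:num)%:E * \int[leb]_x F (upd (upd a l 0%R) k x) +
   (n.2%:num)%:E * \int[leb]_x \int[leb]_y F (upd (upd a k x) l y))%E.
  move=> kl; rewrite /Iop ge0_integralD//; last 4 first.
  - by move=> x _; rewrite mule_ge0.
  - apply: measurable_funeM.
    have := GS_measurable k a (GS_upd0 l GF); exact.
  - by move=> x _; rewrite mule_ge0// integral_ge0.
  - apply: measurable_funeM.
    have := GS_measurable k a (GS_integral l GF); exact.
  rewrite ge0_integralZl//; last exact: (GS_measurable k a (GS_upd0 l GF)).
  rewrite ge0_integralZl//; last 2 first.
    exact: (GS_measurable k a (GS_integral l GF)).
    by move=> x _; rewrite integral_ge0.
  by congr (_ * _ + _)%E; apply: eq_integral => x _; rewrite updC.
have Y k l n n' : k != l -> (Iop n k (Iop n' l F) w =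
  (n.1%:num)%:E * ((n'.1%:num)%:E * F (upd (upd w k 0%R) l 0%R) +
     (n'.2%:num)%:E * \int[leb]_y F (upd (upd w k 0%R) l y)) +
  (n.2%:num)%:E * ((n'.1%:num)%:E * \int[leb]_x F (upd (upd w l 0%R) k x) +
   (n'.2%:num)%:E * \int[leb]_x \int[leb]_y F (upd (upd w k x) l y)))%E.
  by move=> kl; rewrite -X.
have I0 k a : (0 <= \int[leb]_x F (upd a k x))%E by exact: integral_ge0.
have II0 k l : (0 <= \int[leb]_x \int[leb]_y F (upd (upd w k x) l y))%E.
  by apply: integral_ge0 => x _.
have FT : (\int[leb]_x \int[leb]_y F (upd (upd w i x) j y) =
    \int[leb]_y \int[leb]_x F (upd (upd w j y) i x))%E.
  rewrite (fubini_tonelli (fun p : mR * mR => F (upd (upd w i p.1) j p.2)) _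
    (fun _ => F0 _)).
    by apply: eq_integral => y _; apply: eq_integral => x _; rewrite updC.
  exact: (GS_measurable2 w GF ij).
rewrite (Y i j _ _ ij) (Y j i _ _ ji) -FT (updC w 0 0 ij).
by apply: mule_addC; rewrite ?lee_fin.
Qed.

End QuadraticForms.

(** * Integration over blocks of sites *)

Section BlockIntegrals.
Context {R : realType}.
Notation V := (nat -> R).
Notation M := ({nonneg R} * {nonneg R})%type.
Implicit Types (mu : nat -> M) (F G : V -> \bar R) (w v : V).

Fixpoint Jop mu s n F : V -> \bar R :=
  if n is n'.+1 then Iop (mu (s + n')%N) (s + n') (Jop mu s n' F) else F.

Definition cut s n w : V := fun k => if (s <= k < s + n)%N then 0 else w k.

Lemma Jop_ge0 mu s n F w : (forall v, 0 <= F v)%E -> (0 <= Jop mu s n F w)%E.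
Proof.
by move=> F0; elim: n w => //= n IH w; exact: Iop_ge0.
Qed.

Lemma in_block_S s n k : (s <= k < s + n.+1)%N = (s <= k < s + n)%N || (k == s + n)%N.
Proof. by apply/idP/idP; rewrite addnS; lia. Qed.

(** The integrands are compared only at configurations that agree on the block and equal [w] and
    [w'] outside it; this is how boundary values are exchanged. *)
Lemma le_Jop2 mu s n F G w w' : (forall v, 0 <= F v)%E ->
  (forall v v', (forall k, (s <= k < s + n)%N -> v k = v' k) ->
     (forall k, ~~ (s <= k < s + n)%N -> v k = w k /\ v' k = w' k) ->
     (F v <= G v')%E) ->
  (Jop mu s n F w <= Jop mu s n G w')%E.
Proof.
move=> F0; elim: n w w' => [|n IH] w w' FG /=.
  by apply: FG => k; rewrite ?addn0 ltnNge; case: leqP.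
have H x : (Jop mu s n F (upd w (s + n) x) <= Jop mu s n G (upd w' (s + n) x))%E.
  apply: IH => v v' vv' vw; apply: FG => k.
    rewrite in_block_S => /orP[/vv'//|/eqP ->].
    have [] := vw (s + n)%N; first by rewrite ltnn andbF.
    by rewrite /upd eqxx => -> ->.
  rewrite in_block_S negb_or => /andP[/vw]; rewrite /upd.
  by case: eqP.
by apply: leeD; rewrite lee_wpmul2l ?lee_fin//;
  apply: nonmeasurable_le_integral => // x; exact: Jop_ge0.
Qed.

Lemma eq_Jop2 mu s n F G w w' : (forall v, 0 <= F v)%E -> (forall v, 0 <= G v)%E ->
  (forall v v', (forall k, (s <= k < s + n)%N -> v k = v' k) ->
     (forall k, ~~ (s <= k < s + n)%N -> v k = w k /\ v' k = w' k) ->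
     F v = G v') ->
  Jop mu s n F w = Jop mu s n G w'.
Proof.
move=> F0 G0 FG; apply/eqP; rewrite eq_le; apply/andP; split; apply: le_Jop2 => //.
  by move=> v v' h1 h2; rewrite (FG v v').
move=> v v' h1 h2; rewrite (FG v' v)// => k hk; first by rewrite h1.
by have [-> ->] := h2 _ hk.
Qed.

Lemma le_Jop mu s n F G w : (forall v, 0 <= F v)%E -> (forall v, F v <= G v)%E ->
  (Jop mu s n F w <= Jop mu s n G w)%E.
Proof.
move=> F0 FG; apply: le_Jop2 => // v v' h1 h2.
suff -> : v = v' by exact: FG.
apply/funext => k; have [/h1//|/h2[-> ->]//] := boolP (s <= k < s + n)%N.
Qed.

Lemma Jop_mono mu mu' s n F w : (forall v, 0 <= F v)%E ->
  (forall k, (s <= k < s + n)%N -> (mu k).1%:num <= (mu' k).1%:num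
     /\ (mu k).2%:num <= (mu' k).2%:num) ->
  (Jop mu s n F w <= Jop mu' s n F w)%E.
Proof.
move=> F0; elim: n w => //= n IH w mm.
apply: (@le_trans _ _ (Iop (mu (s + n)%N) (s + n) (Jop mu' s n F) w)).
  apply: le_Iop => [v|v]; first exact: Jop_ge0.
  by apply: IH => k hk; apply: mm; rewrite in_block_S hk.
have [] := mm (s + n)%N; first by rewrite in_block_S eqxx orbT.
by apply: Iop_mono => v; exact: Jop_ge0.
Qed.

Lemma eq_mu_Jop mu mu' s n F w : (forall v, 0 <= F v)%E ->
  (forall k, (s <= k < s + n)%N -> mu k = mu' k) ->
  Jop mu s n F w = Jop mu' s n F w.
Proof.
move=> F0 mm; apply/eqP; rewrite eq_le; apply/andP; split;
  by apply: Jop_mono => // k hk; rewrite mm.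
Qed.

Lemma GS_Jop Q mu s n F : GS Q F -> GS (fun w => Q (cut s n w)) (Jop mu s n F).
Proof.
move=> GF; elim: n => /= [|n IH].
  apply: GS_le GF => w; suff -> : cut s 0 w = w by [].
  by apply/funext => k; rewrite /cut addn0 ltnNge; case: leqP.
apply: GS_le (GS_Iop (mu (s + n)%N) (s + n) IH) => w.
suff -> : cut s n (upd w (s + n) 0) = cut s n.+1 w by [].
apply/funext => k; rewrite /cut /upd in_block_S.
by case: ifP => //= _; case: eqP.
Qed.

Lemma JopD_le Q mu s n F G w : (forall v, 0 <= F v)%E -> GS Q G ->
  (Jop mu s n (fun v => F v + G v) w <= Jop mu s n F w + Jop mu s n G w)%E.
Proof.
move=> F0 GG; have G0 v := GS_ge0 v GG.
elim: n w => //= n IH w.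
apply: (le_trans _ (IopD_le _ _ _ (fun v => Jop_ge0 _ _ _ _ F0) (GS_Jop mu s n GG))).
by apply: le_Iop => // v; apply: Jop_ge0 => u; exact: adde_ge0.
Qed.

Lemma JopZ Q mu s n F (h : V -> R) w : GS Q F -> (forall v, 0 <= h v) ->
  (forall v i x, (s <= i < s + n)%N -> h (upd v i x) = h v) ->
  (Jop mu s n (fun v => F v * (h v)%:E) w = Jop mu s n F w * (h w)%:E)%E.
Proof.
move=> GF h0; elim: n w => //= n IH w hi.
rewrite -(IopZ _ _ (GS_Jop mu s n GF))//.
  congr (Iop _ _ _ _); apply/funext => v; apply: IH => u i x ii.
  by apply: hi; rewrite in_block_S ii.
by move=> v x; apply: hi; rewrite in_block_S eqxx orbT.
Qed.

Lemma IopZl Q m i F (c : \bar R) w : GS Q F -> (0 <= c)%E ->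
  Iop m i (fun v => c * F v)%E w = (c * Iop m i F w)%E.
Proof.
move=> GF c0; have F0 v := GS_ge0 v GF.
have I0 : (0 <= \int[@lebesgue_measure R]_x F (upd w i x))%E by exact: integral_ge0.
rewrite /Iop (ge0_muleDr c) ?mule_ge0//.
have F0' x : ([set: R] x -> 0 <= F (upd w i x))%E by [].
have E := ge0_integralZl (@lebesgue_measure R) measurableT (GS_measurable i w GF) F0' c0.
rewrite E.
by congr (_ + _)%E; rewrite muleCA.
Qed.

Lemma JopZl Q mu s n F (c : \bar R) w : GS Q F -> (0 <= c)%E ->
  (Jop mu s n (fun v => c * F v) w = c * Jop mu s n F w)%E.
Proof.
move=> GF c0; elim: n w => //= n IH w.
rewrite -(IopZl _ _ _ (GS_Jop mu s n GF))//.
by congr (Iop _ _ _ _); exact/funext.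
Qed.

Lemma Jop_IopC Q mu s n m i F w : ~~ (s <= i < s + n)%N -> GS Q F ->
  Jop mu s n (Iop m i F) w = Iop m i (Jop mu s n F) w.
Proof.
move=> + GF; elim: n w => //= n IH w.
rewrite in_block_S negb_or => /andP[hi isn].
rewrite (IopC _ _ _ isn (GS_Jop mu s n GF)).
by congr (Iop _ _ _ _); apply/funext => v; exact: IH.
Qed.

Lemma Jop_cat mu s n m F : Jop mu s (n + m) F = Jop mu (s + n) m (Jop mu s n F).
Proof.
elim: m => [|m IH]; first by rewrite addn0.
by rewrite addnS /= IH [(s + (n + m))%N]addnA.
Qed.

Lemma Jop_relabel mu j s n F w :
  Jop mu (j + s) n (fun v => F (fun k => v (j + k)%N)) w =
  Jop (fun k => mu (j + k)%N) s n F (fun k => w (j + k)%N).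
Proof.
elim: n w => //= n IH w; rewrite /Iop addnA.
have E x : (fun k => upd w (j + s + n) x (j + k)%N) =
    upd (fun k => w (j + k)%N) (s + n) x.
  by apply/funext => k; rewrite /upd -addnA eqn_add2l.
congr (_ * _ + _ * _)%E; first by rewrite IH E.
by apply: eq_integral => x _; rewrite IH E.
Qed.

Lemma Jop_expR_le0 mu s n q w : nnq q ->
  (Jop mu s n (fun v => (expR (- q v))%:E) w <=
   Jop mu s n (fun v => (expR (- q v))%:E) 0%R)%E.
Proof. by move=> nq; exact: GS_le0 (GS_Jop mu s n (GS_expR nq)). Qed.

(** A part [p] of the energy that the integrated sites do not see factors out, and the rest is
    maximal at the origin. The result is Gaussian decay in the boundary values, which can then be
    integrated in turn. *)
Lemma Jop_expR_sub mu s n q (p : V -> R) w : nnq (fun v => q v - p v) ->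
  p 0 = 0 -> (forall v i x, (s <= i < s + n)%N -> p (upd v i x) = p v) ->
  (Jop mu s n (fun v => (expR (- q v))%:E) w <=
   Jop mu s n (fun v => (expR (- q v))%:E) 0%R * (expR (- p w))%:E)%E.
Proof.
move=> nq p0 pi.
have E u : (Jop mu s n (fun v => (expR (- q v))%:E) u =
    Jop mu s n (fun v => (expR (- (q v - p v)))%:E) u * (expR (- p u))%:E)%E.
  rewrite -(JopZ (Q := fun v => q v - p v) _ (h := fun v => expR (- p v)))//.
  - by congr (Jop _ _ _ _ _); apply/funext => v; rewrite -EFinM -expRD;
    congr (expR _)%:E; ring.
  - exact: GS_expR nq.
  - by move=> v i x ii; rewrite pi.
rewrite !E p0 oppr0 expR0 mule1 lee_wpmul2r ?lee_fin ?expR_ge0//.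
exact: Jop_expR_le0 nq.
Qed.

(* Translating the integration variables by [psi], scaled by the coordinate [t]
   that is not integrated.  Only coordinates without an atom can be moved. *)
Lemma Jop_translate Q mu s n F (psi : V) t w : GS Q F -> ~~ (s <= t < s + n)%N ->
  psi t = 0 -> (forall k, (s <= k < s + n)%N -> psi k = 0 \/ (mu k).1%:num = 0) ->
  Jop mu s n (fun v => F (v t *: psi + v)) w = Jop mu s n F (w t *: psi + w).
Proof.
move=> GF + psit; elim: n w => // n IH w tn hpsi; rewrite [LHS]/= [RHS]/=.
move: (tn); rewrite in_block_S negb_or => /andP[tn' tsn].
have {}IH v : Jop mu s n (fun v => F (v t *: psi + v)) v = Jop mu s n F (v t *: psi + v).
  by apply: IH => // k hk; apply: hpsi; rewrite in_block_S hk.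
set i := (s + n)%N in tsn *.
have E x : (upd w i x) t *: psi + upd w i x =
    upd (w t *: psi + w) i (x + w t * psi i).
  apply/funext => k; rewrite fE {1}/upd (negbTE tsn) /upd.
  by case: eqP => [->|_]; rewrite ?fE// addrC.
rewrite /Iop; congr (_ + _ * _)%E.
  rewrite IH E add0r.
  have [->|->] := hpsi i ltac:(by rewrite in_block_S eqxx orbT).
    by rewrite mulr0.
  by rewrite !mul0e.
rewrite -(GS_integral_shift i _ (w t * psi i) (GS_Jop mu s n GF)).
by apply: eq_integral => x _; rewrite IH E.
Qed.

End BlockIntegrals.

(** * Closure properties of linear and quadratic forms *)

Section FormClosure.
Context {R : realType}.
Notation V := (nat -> R).
Implicit Types (l : V -> R) (q p : V -> R).

Lemma qformD q p : qform q -> qform p -> qform (fun u => q u + p u).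
Proof.
move=> [b [bs bl] qb] [b' [bs' bl'] pb].
exists (fun u v => b u v + b' u v) => [|u]; last by rewrite qb pb.
by split=> [u v|v c u u']; [rewrite bs bs'|rewrite bl bl' mulrDr addrACA].
Qed.

Lemma qformZ c q : qform q -> qform (fun u => c * q u).
Proof.
move=> [b [bs bl] qb]; exists (fun u v => c * b u v) => [|u]; last by rewrite qb.
by split=> [u v|v d u u']; [rewrite bs|rewrite bl; ring].
Qed.

Lemma qformB q p : qform q -> qform p -> qform (fun u => q u - p u).
Proof.
move=> hq hp; under eq_fun do rewrite -mulN1r.
exact: qformD hq (qformZ _ hp).
Qed.

Lemma qform_mul l l' : lin l -> lin l' -> qform (fun u => l u * l' u).
Proof.
move=> L L'; exists (fun u v => (l u * l' v + l' u * l v) / 2) => [|u]; last first.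
  by field.
split=> [u v|v c u u']; first by congr (_ / 2); ring.
by rewrite L L'; field.
Qed.

Lemma qform_sq l : lin l -> qform (fun u => l u ^+ 2).
Proof. by move=> L; exact: qform_mul. Qed.

Lemma qform_sum n (q : nat -> V -> R) : (forall i, (i < n)%N -> qform (q i)) ->
  qform (fun u => \sum_(i < n) q i u).
Proof.
elim: n => [|n IH] H.
  exists (fun _ _ => 0) => [|u]; last by rewrite big_ord0.
  by split=> // v c u u'; rewrite mulr0 addr0.
under eq_fun do rewrite big_ord_recr/=.
by apply: qformD; [apply: IH => i /ltnW; exact: H|exact: H].
Qed.

Lemma qform_comp q (L : V -> V) :
  (forall c u v, L (c *: u + v) = c *: L u + L v) -> qform q ->
  qform (fun u => q (L u)).
Proof.
move=> hL [b [bs bl] qb]; exists (fun u v => b (L u) (L v)) => [|u]; last exact: qb.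
by split=> [u v|v c u u']; [exact: bs|rewrite hL; exact: bl].
Qed.

Lemma lin_coord k : lin (fun u : V => u k).
Proof. by []. Qed.

Lemma linBl l l' : lin l -> lin l' -> lin (fun u => l u - l' u).
Proof. by move=> L L' c u v; rewrite L L'; ring. Qed.

Lemma lin_sum n (l : nat -> V -> R) : (forall i, lin (l i)) ->
  lin (fun u => \sum_(i < n) l i u).
Proof.
move=> L c u v; rewrite mulr_sumr -big_split/=.
by apply: eq_bigr => i _; rewrite L.
Qed.

Lemma sqr_sum_le n (x : nat -> R) :
  (\sum_(i < n) x i) ^+ 2 <= n%:R * \sum_(i < n) x i ^+ 2.
Proof.
elim: n => [|n IH]; first by rewrite !big_ord0 mul0r expr0n.
rewrite !big_ord_recr/=; set S := \sum_(i < n) x i in IH *.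
set Q := \sum_(i < n) x i ^+ 2 in IH *; set y := x n.
have [n0|n0] := posnP n.
  have -> : S = 0 by rewrite /S n0 big_ord0.
  have -> : Q = 0 by rewrite /Q n0 big_ord0.
  by rewrite n0 !add0r mul1r.
have n0' : 0 < n%:R :> R by rewrite ltr0n.
have H : 2 * S * y <= Q + n%:R * y ^+ 2.
  rewrite -(ler_pM2l n0').
  have := sqr_ge0 (S - n%:R * y); nra.
by rewrite -natr1; nra.
Qed.

End FormClosure.

(** * Partition functions *)

Section Chains.
Context {R : realType}.
Notation V := (nat -> R).
Notation M := ({nonneg R} * {nonneg R})%type.
Implicit Types (mu : nat -> M) (F : V -> \bar R) (w v x : V) (k : R).

Definition rho x (i : nat) : R := x i - 2 * x i.+1 + x i.+2.

Definition qR (n : nat) x : R := \sum_(i < n) rho x i ^+ 2.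

(** Zero left boundary values placed in front of the free variables: variable [i] becomes field
    coordinate [i + 2]. *)
Definition pad w : V := fun i => if (i < 2)%N then 0 else w (i - 2)%N.

Definition sh (j : nat) w : V := fun i => w (j + i)%N.

Definition tl (n : nat) w : V := fun i => if (i < n)%N then w i else 0.

Lemma f0E i : (0 : V) i = 0. Proof. by []. Qed.

Lemma lin_rho i : lin (fun x : V => rho x i).
Proof. by move=> c u v; rewrite /rho !fE; ring. Qed.

Lemma pad_linear c u v : pad (c *: u + v) = c *: pad u + pad v.
Proof.
by apply/funext => i; rewrite fE /pad; case: ifP => _; rewrite ?fE// mulr0 addr0.
Qed.

Lemma tl_linear n c u v : tl n (c *: u + v) = c *: tl n u + tl n v.
Proof.
by apply/funext => i; rewrite fE /tl; case: ifP => _; rewrite ?fE// mulr0 addr0.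
Qed.

Lemma qR_ge0 n x : 0 <= qR n x.
Proof. by apply: sumr_ge0 => i _; exact: sqr_ge0. Qed.

Lemma qform_qR n : qform (qR n).
Proof.
apply: (qform_sum (q := fun i x => rho x i ^+ 2)) => i _.
exact: qform_sq (lin_rho i).
Qed.

Lemma qR_cat n m x : qR (n + m) x = qR n x + qR m (sh n x).
Proof.
rewrite /qR big_split_ord/=; congr (_ + _).
by apply: eq_bigr => i _; rewrite /rho /sh !addnS.
Qed.

Lemma nnq_qR k n : 0 <= k -> nnq (fun x => k * qR n x).
Proof.
move=> k0; split; first exact: qformZ (qform_qR n).
by move=> u; rewrite mulr_ge0// qR_ge0.
Qed.

Lemma nnq_qRpad k n : 0 <= k -> nnq (fun w => k * qR n (pad w)).
Proof.
move=> k0; split; first exact: qform_comp pad_linear (qformZ k (qform_qR n)).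
by move=> u; rewrite mulr_ge0// qR_ge0.
Qed.

(** Discrete Poincare inequality. Two factors of the cube come from summing the slopes, one from the
    Cauchy-Schwarz inequality for the second differences. *)
Lemma sqr_le_qR m x i : x 0%N = 0 -> x 1%N = 0 -> (i <= m.+1)%N ->
  x i ^+ 2 <= m.+1%:R ^+ 3 * qR m x.
Proof.
move=> x0 x1 im; pose S := \sum_(j < m) `|rho x j|.
have S0 : 0 <= S by apply: sumr_ge0.
have d j : (j <= m)%N -> `|x j.+1 - x j| <= \sum_(l < j) `|rho x l|.
  elim: j => [|j IH] jm; first by rewrite big_ord0 x0 x1 subrr normr0.
  rewrite big_ord_recr/=; have -> : x j.+2 - x j.+1 = x j.+1 - x j + rho x j.
    by rewrite /rho; ring.
  by apply: le_trans (ler_normD _ _) _; rewrite lerD2r IH// ltnW.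
have dS j : (j <= m)%N -> `|x j.+1 - x j| <= S.
  move=> jm; apply: le_trans (d j jm) _.
  rewrite /S -(subnKC jm) big_split_ord/= lerDl.
  by apply: sumr_ge0.
have xS j : (j <= m.+1)%N -> `|x j| <= j%:R * S.
  elim: j => [|j IH] jm; first by rewrite x0 normr0 mul0r.
  have -> : x j.+1 = x j + (x j.+1 - x j) by ring.
  apply: le_trans (ler_normD _ _) _; rewrite -natr1 mulrDl mul1r lerD ?IH ?dS//.
  exact: ltnW.
have X : `|x i| <= m.+1%:R * S.
  by apply: le_trans (xS i im) _; rewrite ler_wpM2r// ler_nat.
rewrite -real_normK ?num_real//.
apply: (@le_trans _ _ ((m.+1%:R * S) ^+ 2)).
  by rewrite lerXn2r// ?nnegrE ?normr_ge0// mulr_ge0.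
rewrite exprMn [_ ^+ 3]exprSr -mulrA ler_wpM2l ?exprn_ge0//.
apply: le_trans (sqr_sum_le m (fun j => `|rho x j|)) _.
under eq_bigr do rewrite real_normK ?num_real//.
by rewrite ler_wpM2r ?qR_ge0// ler_nat.
Qed.

Lemma qR_rev m x : qR m (fun i => x (m.+1 - i)%N) = qR m x.
Proof.
rewrite /qR (reindex_inj rev_ord_inj)/=; apply: eq_bigr => i _.
rewrite /rho; have im := ltn_ord i.
have -> : (m.+1 - (m - i.+1) = i.+2)%N by lia.
have -> : (m.+1 - (m - i.+1).+1 = i.+1)%N by lia.
have -> : (m.+1 - (m - i.+1).+2 = i)%N by lia.
by congr (_ ^+ 2); ring.
Qed.

Lemma sqr_le_qR_right m x i : x m = 0 -> x m.+1 = 0 ->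
  x i ^+ 2 <= m.+1%:R ^+ 3 * qR m x \/ (m.+1 < i)%N.
Proof.
move=> xm xm1; have [im|] := leqP i m.+1; last by right.
left; rewrite -qR_rev.
have := @sqr_le_qR m (fun j => x (m.+1 - j)%N) (m.+1 - i)%N.
by rewrite subn0 subn1/= subKn//; apply => //; rewrite leq_subr.
Qed.

Lemma Iop_ge_atom m i F w : (forall v, 0 <= F v)%E ->
  ((m.1%:num)%:E * F (upd w i 0%R) <= Iop m i F w)%E.
Proof. by move=> F0; apply: leeDl; rewrite mule_ge0// integral_ge0. Qed.

Definition eR k n : V -> \bar R := fun w => (expR (- (k * qR n w)))%:E.
Definition eP k n : V -> \bar R := fun w => (expR (- (k * qR n.+2 (pad w))))%:E.

Lemma eR_ge0 k n w : (0 <= eR k n w)%E. Proof. by rewrite lee_fin expR_ge0. Qed.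
Lemma eP_ge0 k n w : (0 <= eP k n w)%E. Proof. by rewrite lee_fin expR_ge0. Qed.
Hint Resolve eR_ge0 eP_ge0 : core.

(* Partition functions over [n] sites: [ZR] has zero right boundary values and a
   free left end, [ZP] has zero boundary values on both sides. *)
Definition ZR k mu n : \bar R := Jop mu 0 n (eR k n) 0%R.
Definition ZP k mu n : \bar R := Jop mu 0 n (eP k n) 0%R.

Lemma ZR_ge0 k mu n : (0 <= ZR k mu n)%E. Proof. exact: Jop_ge0. Qed.
Lemma ZP_ge0 k mu n : (0 <= ZP k mu n)%E. Proof. exact: Jop_ge0. Qed.

(** Given the later sites, the first [n] sites integrate to at most their value with zero right
    boundary values, since the origin is a maximum; what remains depends on the later sites only. *)
Lemma ZR_cat k mu n m : 0 <= k ->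
  (ZR k mu (n + m) <= ZR k mu n * ZR k (fun i => mu (n + i)%N) m)%E.
Proof.
move=> k0; rewrite /ZR Jop_cat add0n.
have GR j := GS_expR (nnq_qR j k0).
have E w : Jop mu 0 n (eR k (n + m)) w =
    (Jop mu 0 n (eR k n) w * eR k m (sh n w))%E.
  rewrite -(JopZ mu _ (GR n) (h := fun v => expR (- (k * qR m (sh n v)))))//.
  - congr (Jop _ _ _ _ _); apply/funext => v.
    by rewrite /eR qR_cat mulrDr opprD expRD.
  - move=> v i x; rewrite add0n => /andP[_ ni].
    suff -> : sh n (upd v i x) = sh n v by [].
    apply/funext => j; rewrite /sh /upd ifF//.
    by apply/eqP; lia.
apply: (@le_trans _ _ (Jop mu n m (fun w => ZR k mu n * eR k m (sh n w))%E 0%R)).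
  apply: le_Jop => w; first exact: Jop_ge0.
  rewrite E lee_wpmul2r//; exact: Jop_expR_le0 (nnq_qR n k0).
rewrite (JopZl (Q := fun w => k * qR m (sh n w))) ?ZR_ge0//; last first.
  apply: GS_expR; split; last by move=> u; rewrite mulr_ge0// qR_ge0.
  by apply: (@qform_comp _ (fun x => k * qR m x) (sh n)) => //; exact: qformZ (qform_qR m).
rewrite lee_wpmul2l ?ZR_ge0//.
by have := Jop_relabel mu n 0 m (eR k m) 0%R; rewrite addn0 => ->.
Qed.

Lemma ZP_le_ZR k mu n : 0 <= k -> (ZP k mu n <= ZR k mu n)%E.
Proof.
move=> k0; apply: le_Jop => // w; rewrite lee_fin ler_expR lerN2 ler_wpM2l//.
rewrite -add2n qR_cat; suff -> : sh 2 (pad w) = w by rewrite lerDr qR_ge0.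
by apply/funext => i; rewrite /sh /pad add2n /= subn2.
Qed.

(** Only the atoms at the sites [j] and [j.+1] are kept. A second difference spans three sites, so
    two consecutive zeros separate the chain. *)
Lemma ZP_pinned k mu j m : 0 <= k ->
  (((mu j).1%:num * (mu j.+1).1%:num)%:E *
    (ZP k mu j * ZP k (fun i => mu (j.+2 + i)%N) m) <= ZP k mu (j.+2 + m))%E.
Proof.
move=> k0; rewrite {3}/ZP (Jop_cat mu 0 j.+2 m) add0n.
pose E := eP k (j.+2 + m).
have L w : (((mu j).1%:num * (mu j.+1).1%:num)%:E *
    (ZP k mu j * eP k m (sh j.+2 w)) <= Jop mu 0 j.+2 E w)%E.
  rewrite [Jop mu 0 j.+2 E w]/=.
  apply: (@le_trans _ _ (((mu (0 + j.+1)%N).1%:num)%:E *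
     (((mu (0 + j)%N).1%:num)%:E *
       Jop mu 0 j E (upd (upd w (0 + j.+1) 0) (0 + j) 0))))%E; last first.
    have E0 v : (0 <= E v)%E by exact: eP_ge0.
    apply: (le_trans _ (Iop_ge_atom _ _ _ (fun v => Iop_ge0 _ _ _ (fun v => Jop_ge0 _ _ _ _ E0)))).
    rewrite lee_wpmul2l ?lee_fin//.
    exact: Iop_ge_atom (fun v => Jop_ge0 _ _ _ _ E0).
  rewrite !add0n [leRHS]muleA -EFinM [in leRHS]mulrC lee_wpmul2l ?lee_fin ?mulr_ge0//.
  set u := upd _ _ _.
  have -> : (ZP k mu j * eP k m (sh j.+2 w) =
      Jop mu 0 j (fun v => eP k j v * eP k m (sh j.+2 v)) u)%E.
    rewrite (JopZ mu _ (GS_expR (nnq_qRpad j.+2 k0))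
        (h := fun v => expR (- (k * qR m.+2 (pad (sh j.+2 v))))))//.
      congr (_ * _)%E; last first.
        suff -> : sh j.+2 u = sh j.+2 w by [].
        by apply/funext => i; rewrite /sh /u /upd !ifF//; apply/eqP; lia.
      apply: eq_Jop2 => // v v' vv' h2.
      congr (expR (- (k * _)))%:E; apply: eq_bigr => i _; congr (_ ^+ 2).
      suff X a : (a < j + 4)%N -> pad v a = pad v' a.
        by rewrite /rho !X//; have := ltn_ord i; lia.
      move=> aj; rewrite /pad; case: ifP => // a2.
      have [h|h] := boolP (0 <= a - 2 < 0 + j)%N; first exact: vv'.
      have [-> ->] := h2 _ h; rewrite /u /upd; case: eqP => // ?.
      by case: eqP => // ?; exfalso; lia.
    move=> v i x; rewrite add0n => /andP[_ ni].
    suff -> : sh j.+2 (upd v i x) = sh j.+2 v by [].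
    apply/funext => a; rewrite /sh /upd ifF//.
    by apply/eqP; lia.
  apply: le_Jop2 => [v|v v' vv' h2]; first exact: mule_ge0.
  have -> : v = v'.
    by apply/funext => a; have [/vv'//|/h2[-> ->]//] := boolP (0 <= a < 0 + j)%N.
  rewrite /E /eP -EFinM -expRD lee_fin ler_expR -opprD -mulrDr.
  rewrite lerN2 ler_wpM2l//.
  have -> : (j.+2 + m).+2 = (j.+2 + m.+2)%N by lia.
  rewrite qR_cat lerD2l le_eqVlt; apply/orP; left; apply/eqP.
  apply: eq_bigr => i _; congr (_ ^+ 2).
  suff X a : sh j.+2 (pad v') a = pad (sh j.+2 v') a by rewrite /rho !X.
  rewrite /sh /pad (_ : (j.+2 + a < 2)%N = false); last by lia.
  case: ifP => a2; last by congr v'; lia.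
  have [_ ->] := h2 (j.+2 + a - 2)%N ltac:(lia).
  by rewrite /u /upd; case: eqP => // ?; case: eqP => // ?; exfalso; lia.
have E0 v : (0 <= E v)%E by exact: eP_ge0.
apply: (@le_trans _ _ (Jop mu j.+2 m (fun w =>
    ((mu j).1%:num * (mu j.+1).1%:num)%:E * (ZP k mu j * eP k m (sh j.+2 w)))%E 0%R)).
  have GE : GS (fun w => k * qR m.+2 (pad (sh j.+2 w))) (fun w => eP k m (sh j.+2 w)).
    apply: GS_expR; split; last by move=> u; rewrite mulr_ge0// qR_ge0.
    apply: (@qform_comp _ (fun x => k * qR m.+2 x) (fun w => pad (sh j.+2 w))).
      by move=> c a b; rewrite -pad_linear.
    exact: qformZ (qform_qR _).
  under [X in Jop _ _ _ X]eq_fun do rewrite muleA.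
  rewrite (JopZl _ _ _ _ GE) ?mule_ge0 ?ZP_ge0 ?lee_fin ?mulr_ge0//.
  have := Jop_relabel mu j.+2 0 m (eP k m) 0%R; rewrite addn0 => ->.
  by rewrite muleA.
by apply: le_Jop => // w; rewrite !mule_ge0 ?lee_fin ?mulr_ge0 ?ZP_ge0.
Qed.

Notation gc k := (Num.sqrt (pi / k)).

Lemma Iop_gauss m i k (c : \bar R) w : 0 < k -> (0 <= c)%E ->
  Iop m i (fun v => c * (expR (- (k * v i ^+ 2)))%:E)%E w =
  (c * (m.1%:num + m.2%:num * gc k)%:E)%E.
Proof.
move=> k0 c0; rewrite /Iop; under eq_integral do rewrite {1}/upd eqxx.
rewrite {1}/upd eqxx expr0n mulr0 oppr0 expR0 mule1.
have mk : measurable_fun [set: measurableTypeR R] (fun x : measurableTypeR R => (expR (- (k * x ^+ 2)))%:E).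
  apply/measurable_EFinP; apply: measurableT_comp => //.
  by repeat first [exact: measurable_cst | exact: measurable_id |
    apply: measurable_funM | apply: measurable_funX | apply: measurable_funN].
rewrite (ge0_integralZl (@lebesgue_measure R) measurableT mk)//.
have -> : (\int[@lebesgue_measure R]_x (expR (- (k * x ^+ 2)))%:E = (gc k)%:E)%E.
  by rewrite -(gauss_integral_shift 0 k0); apply: eq_integral => x _; rewrite addr0.
rewrite EFinD EFinM ge0_muleDr ?lee_fin ?mulr_ge0 ?sqrtr_ge0//.
by congr (_ + _)%E; [rewrite muleC|rewrite muleCA].
Qed.

Lemma ZR1 k mu : 0 < k ->
  ZR k mu 1 = ((mu 0%N).1%:num + (mu 0%N).2%:num * gc k)%:E.
Proof.
move=> k0; rewrite -[RHS]mul1e -(Iop_gauss (mu 0%N) 0 0%R k0)//.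
rewrite /ZR; apply: (@eq_Jop2 _ mu 0 1) => // v v' h1 h2.
rewrite mul1e /eR /qR big_ord1 /rho (h1 0%N)//.
have [-> _] := h2 1%N isT; have [-> _] := h2 2%N isT.
by rewrite !f0E mulr0 subr0 addr0.
Qed.

Lemma ZR_le k n mu (B : R) : 0 < k ->
  (forall i, (i < n)%N -> (mu i).1%:num + (mu i).2%:num * gc k <= B) ->
  (ZR k mu n <= (B ^+ n)%:E)%E.
Proof.
move=> k0; elim: n mu => [|n IH] mu H.
  rewrite /ZR /= /eR lee_fin expr0 -[leRHS]expR0 ler_expR oppr_le0.
  by rewrite mulr_ge0 ?qR_ge0// ltW.
have B0 : 0 <= B.
  by apply: le_trans (H 0%N isT); rewrite addr_ge0// mulr_ge0// sqrtr_ge0.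
rewrite -addn1 addnC; apply: le_trans (ZR_cat mu 1 n (ltW k0)) _.
rewrite ZR1// addnC addn1 exprS EFinM lee_pmul ?ZR_ge0//.
- by rewrite lee_fin H.
- by apply: IH => i im; exact: H.
Qed.

Lemma ZR_fin_num k mu n : 0 < k -> ZR k mu n \is a fin_num.
Proof.
move=> k0; rewrite ge0_fin_numE ?ZR_ge0//.
pose B := \sum_(i < n) ((mu i).1%:num + (mu i).2%:num * gc k).
apply: le_lt_trans (ZR_le (B := B) k0 _) (ltey _) => i im.
by rewrite /B (bigD1 (Ordinal im))//= lerDl sumr_ge0// => j _.
Qed.

(** The leftmost site enters a single second difference, so its Lebesgue integral is the same
    constant whatever the other sites are; its atom is discarded. *)
Lemma ZR_free_ge k mu n : 0 < k -> (forall i, (i < n)%N -> (mu i).2%:num = 1) ->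
  ((gc k ^+ n)%:E <= ZR k mu n)%E.
Proof.
move=> k0; rewrite /ZR.
suff H w : (forall i, (i < n)%N -> (mu i).2%:num = 1) ->
    ((gc k ^+ n)%:E <= Jop mu 0 n (eR k n) w)%E by exact: H.
elim: n mu w => [|n IH] mu w H.
  by rewrite /= /eR expr0 /qR big_ord0 mulr0 oppr0 expR0.
rewrite -add1n Jop_cat/=.
have E v : ((gc k)%:E * eR k n (sh 1 v) <= Iop (mu 0%N) 0 (eR k (1 + n)) v)%E.
  rewrite /Iop; apply: le_trans (leeDr _ _); last first.
    by rewrite mule_ge0.
  rewrite H// mul1e.
  have -> : (\int[@lebesgue_measure R]_x eR k (1 + n) (upd v 0 x) =
     \int[@lebesgue_measure R]_x
       ((expR (- (k * (x + (v 2 - 2 * v 1)) ^+ 2)))%:E * eR k n (sh 1 v)))%E.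
    apply: eq_integral => x _; rewrite /eR qR_cat mulrDr opprD expRD EFinM.
    rewrite /qR big_ord1 /rho /upd/=; congr (_%:E * _)%E.
    by congr (expR (- (k * _ ^+ 2))); ring.
  have mk : measurable_fun [set: measurableTypeR R] (fun x : measurableTypeR R =>
     (expR (- (k * (x + (v 2 - 2 * v 1)) ^+ 2)))%:E).
    apply/measurable_EFinP; apply: measurableT_comp => //.
    by repeat first [exact: measurable_cst | exact: measurable_id |
      apply: measurable_funD |
      apply: measurable_funM | apply: measurable_funX | apply: measurable_funN].
  rewrite (ge0_integralZr (@lebesgue_measure R) measurableT mk)//.
  by rewrite gauss_integral_shift.
have S : (Jop mu 1 n (fun v => (gc k)%:E * eR k n (sh 1 v)) w <=
    Jop mu 1 n (Iop (mu 0%N) 0 (eR k (1 + n))) w)%E.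
  by apply: le_Jop => // v; rewrite mule_ge0// lee_fin sqrtr_ge0.
apply: le_trans S; have GE : GS (fun v => k * qR n (sh 1 v)) (fun v => eR k n (sh 1 v)).
  apply: GS_expR; split; last by move=> u; rewrite mulr_ge0 ?qR_ge0// ltW.
  by apply: (@qform_comp _ (fun x => k * qR n x) (sh 1)) => //; exact: qformZ (qform_qR n).
rewrite (JopZl _ _ _ _ GE) ?lee_fin ?sqrtr_ge0//.
have := Jop_relabel mu 1 0 n (eR k n) w => ->.
rewrite exprD expr1 EFinM lee_pmul2l// ?lte_fin ?sqrtr_gt0 ?divr_gt0 ?pi_gt0//.
by apply: IH => i ni; exact: H.
Qed.

(** The two leftmost sites are integrated last. By the Poincare inequality the energy confines them
    on a polynomial scale, so freeing the left end costs a polynomial factor. *)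
Lemma ZR_le_ZP k mu n : 0 < k ->
  (ZR k mu n.+2 <=
   ZP k (fun i => mu (i.+2)) n * 
   (((mu 0%N).1%:num + (mu 0%N).2%:num * gc (k / (2 * n.+3%:R ^+ 3))) *
    ((mu 1%N).1%:num + (mu 1%N).2%:num * gc (k / (2 * n.+3%:R ^+ 3))))%:E)%E.
Proof.
(* The factor 2 shares the Poincare bound between the two sites. *)
move=> k0; set s := k / _.
have s0 : 0 < s by rewrite /s divr_gt0// mulr_gt0// exprn_gt0.
(* Truncation by [tl] builds the zero right boundary values into the form. *)
pose q w := k * qR n.+2 (tl n.+2 w).
pose E : V -> \bar R := fun w => (expR (- q w))%:E.
have E0 w : (0 <= E w)%E by rewrite lee_fin expR_ge0.
have nq : nnq q.
  split; last by move=> u; rewrite mulr_ge0 ?qR_ge0// ltW.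
  exact: qform_comp (tl_linear n.+2) (qformZ k (qform_qR _)).
have GE : GS q E by exact: GS_expR.
have -> : ZR k mu n.+2 = Jop mu 0 n.+2 E 0%R.
  apply: eq_Jop2 => // v v' h1 h2; congr (expR (- (k * qR _ _)))%:E.
  apply/funext => i; rewrite /tl; case: ifP => i2; first exact: h1.
  by have [-> _] := h2 i ltac:(by rewrite add0n i2).
pose p w : R := s * w 0%N ^+ 2 + s * w 1%N ^+ 2.
rewrite -add2n Jop_cat add0n.
have -> : Jop mu 2 n (Jop mu 0 2 E) 0%R =
    Iop (mu 1%N) 1 (Iop (mu 0%N) 0 (Jop mu 2 n E)) 0%R.
  rewrite [Jop mu 0 2 E]/= !add0n.
  rewrite (Jop_IopC mu _ 0%R _ (GS_Iop (mu 0%N) 0 GE))//.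
  congr (Iop _ _ _ _); apply/funext => v.
  exact: (Jop_IopC mu _ v _ GE).
have P0 : ZP k (fun i => mu i.+2) n = Jop mu 2 n E 0%R.
  have := Jop_relabel mu 2 0 n (eP k n) 0%R; rewrite addn0 => H.
  apply: etrans (esym H) _; apply: eq_Jop2 => // v v' h1 h2.
  congr (expR (- (k * qR _ _)))%:E; apply/funext => i; rewrite /pad /tl.
  have [i2|i2] := ltnP i 2.
    have [_ v'0] := h2 i ltac:(lia); rewrite v'0 f0E; case: ifP => //.
  rewrite subnKC//; case: ifP => i3; first by apply: h1; lia.
  by have [-> _] := h2 i ltac:(lia).
have Pp w : (Jop mu 2 n E w <= Jop mu 2 n E 0%R * (expR (- p w))%:E)%E.
  apply: Jop_expR_sub.
  - split.
      apply: qformB; first by case: nq.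
      by apply: qformD; apply: qformZ; exact: qform_sq.
    move=> u; rewrite subr_ge0 /q /p -mulrDr /s -mulrA ler_pM2l//.
    rewrite mulrC ler_pdivrMr ?mulr_gt0 ?exprn_gt0//.
    have z1 : tl n.+2 u n.+2 = 0 by rewrite /tl ltnn.
    have z2 : tl n.+2 u n.+3 = 0 by rewrite /tl ltnNge leqnSn.
    have [H0|] := @sqr_le_qR_right n.+2 _ 0 z1 z2; last by [].
    have [H1|] := @sqr_le_qR_right n.+2 _ 1 z1 z2; last by [].
    by move: H0 H1; rewrite /tl/=; nra.
  - by rewrite /p !f0E expr0n !mulr0 addr0.
  - by move=> v i x; rewrite /p /upd; case: i => [|[|i]].
rewrite P0; set Z := Jop mu 2 n E 0%R in Pp *.
have Z0 : (0 <= Z)%E by exact: Jop_ge0.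
set c0 := (mu 0%N).1%:num + _; set c1 := (mu 1%N).1%:num + _.
have c00 : 0 <= c0 by rewrite addr_ge0// mulr_ge0// sqrtr_ge0.
have GZ : GS (fun v => s * v 0%N ^+ 2) (fun v => Z * (expR (- (s * v 0%N ^+ 2)))%:E)%E.
  apply: GS_scale => //; apply: GS_expR; split; last first.
    by move=> u; rewrite mulr_ge0 ?sqr_ge0// ltW.
  by apply: qformZ; exact: qform_sq.
apply: (@le_trans _ _ (Iop (mu 1%N) 1
    (fun v => (Z * c0%:E) * (expR (- (s * v 1%N ^+ 2)))%:E)%E 0%R)); last first.
  by rewrite Iop_gauss// ?mule_ge0 ?lee_fin// -muleA -EFinM.
apply: le_Iop => v; first by apply: Iop_ge0 => u; exact: Jop_ge0.
rewrite -(Iop_gauss (mu 0%N) 0 v s0 Z0) -(IopZ _ _ GZ (h := fun v => expR (- (s * v 1%N ^+ 2))))//.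
apply: le_Iop => u; first exact: Jop_ge0.
by apply: le_trans (Pp u) _; rewrite /p opprD expRD EFinM muleA.
Qed.

End Chains.

(** * The free energy *)

Section FreeEnergy.
Context {R : realType}.
Implicit Types (e : {nonneg R}) (eta : R) (n m : nat).

Definition full e : nat -> {nonneg R} * {nonneg R} := fun _ => (e, 1%:nng).

Notation gc k := (Num.sqrt (pi / k)).
Notation half := (2^-1 : R).

Definition zr e n : R := fine (ZR half (full e) n).
Definition zp e n : R := fine (ZP half (full e) n).
Definition c1 : R := gc half.

Let half_gt0 : 0 < half. Proof. by []. Qed.

Lemma c1_gt0 : 0 < c1.
Proof. by rewrite sqrtr_gt0 divr_gt0// pi_gt0. Qed.

Lemma zrE e n : ZR half (full e) n = (zr e n)%:E.
Proof. by rewrite fineK// ZR_fin_num. Qed.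

Lemma zpE e n : ZP half (full e) n = (zp e n)%:E.
Proof.
rewrite fineK// ge0_fin_numE ?ZP_ge0//.
by apply: le_lt_trans (ZP_le_ZR (full e) n (ltW half_gt0)) _; rewrite zrE ltey.
Qed.

Lemma zr_ge e n : c1 ^+ n <= zr e n.
Proof. by rewrite -lee_fin -zrE; exact: ZR_free_ge. Qed.

Lemma zr_gt0 e n : 0 < zr e n.
Proof. by apply: lt_le_trans (zr_ge e n); rewrite exprn_gt0// c1_gt0. Qed.

Lemma zr_cat e n m : zr e (n + m) <= zr e n * zr e m.
Proof.
rewrite -lee_fin EFinM -!zrE; exact: ZR_cat (full e) n m (ltW half_gt0).
Qed.

Lemma zr0E n : zr 0%:nng n = c1 ^+ n.
Proof.
apply/eqP; rewrite eq_le zr_ge andbT -lee_fin -zrE.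
by apply: ZR_le => // i _; rewrite /= add0r mul1r.
Qed.

Lemma zr0 e : zr e 0 = 1.
Proof. by rewrite /zr /ZR /= /eR /qR big_ord0 mulr0 oppr0 expR0. Qed.

Lemma zp_le_zr e n : zp e n <= zr e n.
Proof. by rewrite -lee_fin -(zrE e n) -(zpE e n); exact: (ZP_le_ZR (full e) n (ltW half_gt0)). Qed.

Lemma zr_le_zp e n : zr e n.+2 <=
  zp e n * (e%:num + gc (half / (2 * n.+3%:R ^+ 3))) ^+ 2.
Proof.
rewrite -lee_fin EFinM -(zrE e n.+2) -(zpE e n); have := ZR_le_ZP (full e) n half_gt0.
by rewrite /= !mul1r expr2.
Qed.

(** For the subadditive sequence [ln (zr e n)] the infimum of the averages is also their limit; the
    length 0 is left out. *)
Definition rate_inf e : R := inf [set ln (zr e n.+1) / n.+1%:R | n in [set: nat]].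

Let rate_has_inf e : has_inf [set ln (zr e n.+1) / n.+1%:R | n in [set: nat]].
Proof.
split; first by exists (ln (zr e 1) / 1%:R); exists 0%N.
exists (ln c1) => _ [n _ <-]; rewrite ler_pdivlMr// mulr_natr -lnXn ?c1_gt0//.
by rewrite ler_ln ?posrE ?zr_ge ?zr_gt0// exprn_gt0// c1_gt0.
Qed.

Lemma zr_lower e n : expR (n%:R * rate_inf e) <= zr e n.
Proof.
case: n => [|n]; first by rewrite mul0r expR0 zr0.
rewrite -[leRHS]lnK ?posrE ?zr_gt0// ler_expR mulrC -ler_pdivlMr//.
by apply: ge_inf; [case: (rate_has_inf e)|exists n].
Qed.

Lemma zr_upper e eta : 0 < eta ->
  exists2 C, 0 < C & forall n, zr e n <= C * expR (n%:R * (rate_inf e + eta)).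
Proof.
move=> eta0; have [_ [m _ <-]] := inf_adherent eta0 (rate_has_inf e).
rewrite -/(rate_inf e) ltr_pdivrMr// => am; set s := rate_inf e + eta in am *.
have zm : zr e m.+1 <= expR (m.+1%:R * s).
  by rewrite -[leLHS]lnK ?posrE ?zr_gt0// ler_expR mulrC ltW.
(* Lengths are divided by the nearly optimal block length [m.+1]; the sum covers every possible
   remainder. *)
pose C := 1 + \sum_(t < m.+1) zr e t * expR (- (t%:R * s)).
exists C => [|n].
  by rewrite ltr_pwDl// sumr_ge0// => t _; rewrite mulr_ge0 ?expR_ge0// ltW ?zr_gt0.
have H q : zr e (q * m.+1) <= expR ((q * m.+1)%:R * s).
  elim: q => [|q IH]; first by rewrite mul0n mul0r expR0 zr0.
  rewrite mulSn; apply: le_trans (zr_cat _ _ _) _.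
  by rewrite natrD mulrDl expRD ler_pM// ltW ?zr_gt0.
have tm : (n %% m.+1 < m.+1)%N by rewrite ltn_mod.
rewrite {1}(divn_eq n m.+1); apply: le_trans (zr_cat _ _ _) _.
have -> : expR (n%:R * s) = expR ((n %/ m.+1 * m.+1)%:R * s) * expR ((n %% m.+1)%:R * s).
  by rewrite -expRD -mulrDl -natrD -divn_eq.
rewrite mulrCA; apply: ler_pM (H _) _; [exact/ltW/zr_gt0|exact/ltW/zr_gt0|].
rewrite -ler_pdivrMr ?expR_gt0// -expRN.
apply: (@le_trans _ _ (\sum_(t < m.+1) zr e t * expR (- (t%:R * s)))); last first.
  by rewrite /C lerDr.
rewrite (bigD1 (Ordinal tm))//= lerDl sumr_ge0// => t _.
by rewrite mulr_ge0 ?expR_ge0// ltW ?zr_gt0.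
Qed.

Lemma poly_le_expR (k : nat) eta : 0 < eta ->
  exists2 C, 0 < C & forall n, n%:R ^+ k <= C * expR (n%:R * eta).
Proof.
move=> eta0; exists (k.+1`!%:R / eta ^+ k.+1 + 1) => [|n].
  by rewrite ltr_wpDl// divr_ge0// exprn_ge0// ltW.
have [->|n0] := posnP n.
  rewrite mul0r expR0 mulr1 ler_wpDl//.
    by rewrite divr_ge0// exprn_ge0// ltW.
  by case: k => [|k]; rewrite ?expr0// expr0n.
apply: (@le_trans _ _ (n%:R ^+ k.+1)).
  by rewrite exprS ler_peMl ?exprn_ge0// ler1n.
have H := expR_ge1Dxn k (mulr_ge0 (ler0n R n) (ltW eta0)).
have {}H : (n%:R * eta) ^+ k.+1 <= k.+1`!%:R * expR (n%:R * eta).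
  rewrite [leRHS]mulrC -ler_pdivrMr ?ltr0n ?fact_gt0//.
  by apply: le_trans H; rewrite lerDr.
rewrite mulrDl mul1r ler_wpDr ?expR_ge0// mulrAC ler_pdivlMr ?exprn_gt0//.
by rewrite -exprMn.
Qed.

(** The estimate [sqrt X <= 1 + X] is crude but polynomial, which suffices at exponential scale.
    Each of the two end sites contributes a factor of order [m ^ 3], whence the exponent 6. *)
Lemma end_weight_le k e m : 0 < k -> (0 < m)%N ->
  (e%:num + gc (k / (2 * m%:R ^+ 3))) ^+ 2 <= (e%:num + 1 + 2 * pi / k) ^+ 2 * m%:R ^+ 6.
Proof.
move=> k0 m0; have pi0 := pi_gt0 R; have e0 : 0 <= e%:num by [].
have N1 : 1 <= m%:R ^+ 3 :> R by rewrite exprn_ege1// ler1n.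
have p0 : 0 < 2 * pi / k by rewrite divr_gt0// mulr_gt0.
have g1 : gc (k / (2 * m%:R ^+ 3)) <= 1 + 2 * pi / k * m%:R ^+ 3.
  have X0 : 0 <= 2 * pi / k * m%:R ^+ 3 :> R by rewrite mulr_ge0 ?exprn_ge0// ltW.
  have -> : pi / (k / (2 * m%:R ^+ 3)) = 2 * pi / k * m%:R ^+ 3.
    have : m%:R != 0 :> R by rewrite pnatr_eq0 -lt0n.
    by set Y := m%:R => Y0; field; rewrite gt_eqF//= Y0.
  set X := 2 * pi / k * _ in X0 *.
  rewrite -(@ler_pXn2r _ 2)// ?nnegrE ?sqrtr_ge0//; last by lra.
  by rewrite sqr_sqrtr//; nra.
rewrite -[6%N]/(3 * 2)%N exprM -exprMn lerXn2r ?nnegrE//.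
- by rewrite mulr_ge0 ?exprn_ge0//; lra.
apply: le_trans (lerD (lexx _) g1) _.
set Y := m%:R ^+ 3 in N1 *; set p := 2 * pi / k in p0 *; nra.
Qed.

Lemma zp_lower e eta : 0 < eta ->
  exists2 C, 0 < C & forall n, C * expR (n%:R * (rate_inf e - eta)) <= zp e n.
Proof.
move=> eta0; have [C C0 HC] := poly_le_expR 6 eta0.
pose B := (e%:num + 1 + 4 * pi) ^+ 2 * C * expR (3 * eta) * expR (- (2 * rate_inf e)).
have pi0 := pi_gt0 R.
have e0 : 0 <= e%:num by [].
have B0 : 0 < B.
  by rewrite !mulr_gt0 ?expR_gt0//; lra.
exists B^-1 => [|n]; first by rewrite invr_gt0.
have P := @end_weight_le half e n.+3 half_gt0 isT.
rewrite (_ : 2 * pi / half = 4 * pi) in P; last by field.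
have H := le_trans (zr_lower e n.+2) (zr_le_zp e n).
have zp0 : 0 <= zp e n by rewrite fine_ge0// ZP_ge0.
have {H} : expR (n.+2%:R * rate_inf e) <= zp e n *
    ((e%:num + 1 + 4 * pi) ^+ 2 * (C * expR (n.+3%:R * eta))).
  apply: le_trans H _; rewrite ler_wpM2l//; apply: le_trans P _.
  by rewrite ler_wpM2l// sqr_ge0.
rewrite [B^-1 * _]mulrC.
have -> : zp e n * ((e%:num + 1 + 4 * pi) ^+ 2 * (C * expR (n.+3%:R * eta))) =
   (zp e n * B) * expR (n%:R * eta + 2 * rate_inf e).
  rewrite /B (_ : n.+3%:R * eta = 3 * eta + n%:R * eta); last first.
    by rewrite -natr1 -natr1 -natr1; ring.
  rewrite !expRD expRN; field.
  by rewrite gt_eqF// expR_gt0.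
move=> H; rewrite ler_pdivrMr//.
rewrite -(ler_pM2r (expR_gt0 (n%:R * eta + 2 * rate_inf e))).
by apply: le_trans _ H; rewrite -expRD ler_expR -natr1 -natr1; lra.
Qed.

Lemma rate_inf0 : rate_inf 0%:nng = ln c1.
Proof.
rewrite /rate_inf; have -> : [set ln (zr 0%:nng n.+1) / n.+1%:R | n in [set: nat]]
    = [set ln c1]; last by rewrite inf1.
apply/seteqP; split => [_ [n _ <-]|_ ->] /=.
  by rewrite zr0E lnXn ?c1_gt0// -[ln c1 *+ _]mulr_natr mulfK.
by exists 0%N => //; rewrite zr0E expr1 divr1.
Qed.

Lemma rate_inf_ge e : rate_inf 0%:nng <= rate_inf e.
Proof.
rewrite rate_inf0; apply: lb_le_inf; first by case: (rate_has_inf e).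
move=> _ [n _ <-]; rewrite ler_pdivlMr// mulr_natr -lnXn ?c1_gt0//.
by rewrite ler_ln ?posrE ?zr_ge ?zr_gt0// exprn_gt0// c1_gt0.
Qed.

Lemma near_inv_mul_le (K eta : R) : 0 < eta ->
  \forall N \near \oo, N%:R^-1 * K <= eta.
Proof.
move=> eta0; near=> N.
have N0 : 0 < N%:R :> R by rewrite ltr0n; near: N; exact: nbhs_infty_gt.
rewrite mulrC ler_pdivrMr// mulrC -ler_pdivrMr//; apply/ltW.
by near: N; exact: nbhs_infty_gtr.
Unshelve. all: by end_near. Qed.

Lemma zp_gt0 e n : 0 < zp e n.
Proof.
have [C C0 H] := zp_lower e (ltr01 : 0 < 1 :> R).
by apply: lt_le_trans (H n); rewrite mulr_gt0 ?expR_gt0.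
Qed.

Lemma ln_zp_cvg e :
  (fun N : nat => N%:R^-1 * ln (zp e N.-1)) @ \oo --> rate_inf e.
Proof.
set r := rate_inf e; apply/cvgrPdist_le => eta eta0.
have eta2 : 0 < eta / 2 by rewrite divr_gt0.
have [C C0 HC] := zp_lower e eta2; have [D D0 HD] := zr_upper e eta2.
near=> N.
have N0 : 0 < N%:R :> R by rewrite ltr0n; near: N; exact: nbhs_infty_gt.
have NE : N.-1%:R = N%:R - 1 :> R.
  by rewrite -[N in RHS]prednK ?natr1 -?natr1 ?addrK// -(ltr0n R).
have KC : N%:R^-1 * (`|ln C| + `|ln D| + `|r| + eta) <= eta / 2.
  by near: N; exact: near_inv_mul_le.
have L : ln C + N.-1%:R * (r - eta / 2) <= ln (zp e N.-1).
  rewrite -[X in _ + X]expRK -lnM ?posrE ?expR_gt0//.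
  by rewrite ler_ln ?posrE ?mulr_gt0 ?expR_gt0 ?zp_gt0.
have U : ln (zp e N.-1) <= ln D + N.-1%:R * (r + eta / 2).
  rewrite -[X in _ + X]expRK -lnM ?posrE ?expR_gt0//.
  rewrite ler_ln ?posrE ?mulr_gt0 ?expR_gt0 ?zp_gt0//.
  exact: le_trans (zp_le_zr _ _) (HD _).
rewrite NE in L U.
rewrite mulrC ler_pdivrMr// in KC.
rewrite mulrC ler_distl; apply/andP; split.
  rewrite lerBlDr ler_pdivrMr//.
  move: KC U; have := ler_norm (ln D); have := normr_ge0 (ln C).
  have := ler_norm (- r); rewrite normrN.
  nra.
have h1 : - ln C <= `|ln C| by rewrite -normrN ler_norm.
have h2 := ler_norm r; have h3 := normr_ge0 (ln D).
rewrite -lerBlDr ler_pdivlMr//; move: (ln (zp e _)) L => X L.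
clear -h1 h2 h3 L KC eta0 N0; nra.
Unshelve. all: by end_near. Qed.

Lemma free_energy_cvg e :
  (fun N : nat => N%:R^-1 * ln (zp e N.-1 / zp 0%:nng N.-1)) @ \oo -->
  rate_inf e - rate_inf 0%:nng.
Proof.
under eq_fun do rewrite ln_div ?posrE ?zp_gt0// mulrBr.
by apply: cvgB; exact: ln_zp_cvg.
Qed.

End FreeEnergy.

(** * The reference measure *)

Section ReferenceMeasure.
Context {R : realType}.
Notation V := (nat -> R).
Notation mR := (measurableTypeR R).
Notation leb := (@lebesgue_measure R).
Implicit Types (e : {nonneg R}) (F G : V -> \bar R) (w v : V).
Local Open Scope ereal_scope.

Lemma integral_mref e (f : mR -> \bar R) : (forall x, 0 <= f x) ->
  measurable_fun [set: mR] f ->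
  \int[mref e]_x f x = (e%:num)%:E * f 0%R + \int[leb]_x f x.
Proof.
move=> f0 mf; rewrite /mref ge0_integral_measure_add//.
by rewrite ge0_integral_mscale// integral_dirac// diracT mul1e.
Qed.

Import HBSimple HBNNSimple.

Lemma integral_mref_ge e (f : mR -> \bar R) : (forall x, 0 <= f x) ->
  (e%:num)%:E * f 0%R + \int[leb]_x f x <= \int[mref e]_x f x.
Proof.
move=> f0; pose atom x := if x == 0%R :> R then f 0%R else 0.
have matom : measurable_fun [set: mR] atom.
  apply: measurable_fun_ifT => //=.
  by apply: (measurable_fun_eqr (T := mR)) => //; exact: measurable_cst.
pose M := \int[mref e]_x f x.
have key (h : {nnsfun mR >-> R}) : (forall x, (h x)%:E <= f x) ->
    (e%:num)%:E * f 0%R + \int[leb]_x (h x)%:E <= M.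
  (* Raising a simple minorant to [f 0] at the origin keeps it measurable and below [f], leaves its
     Lebesgue integral unchanged and captures the whole atom. *)
  move=> hf; pose h' x := if x == 0%R :> R then f 0%R else (h x)%:E.
  have h'0 x : 0 <= h' x by rewrite /h'; case: ifP => // _; rewrite lee_fin.
  have mh' : measurable_fun [set: mR] h'.
    apply: measurable_fun_ifT => //=; last exact/measurable_EFinP.
    by apply: (measurable_fun_eqr (T := mR)) => //; exact: measurable_cst.
  have -> : \int[leb]_x (h x)%:E = \int[leb]_x h' x.
    apply: ae_eq_integral => //; first exact/measurable_EFinP.
    exists [set 0%R]; split => //; first exact: lebesgue_measure_set1.
    by move=> x /= H; apply: contra_notP H => x0 _; rewrite /h'; case: eqP.
  have -> : f 0%R = h' 0%R by rewrite /h' eqxx.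
  rewrite -integral_mref//; apply: nonmeasurable_le_integral => // x.
  by rewrite /h'; case: eqP => // ->.
have k0 := key nnsfun0 (fun x => f0 x).
rewrite /= integral0 adde0 in k0.
(* If [f 0] is finite, the supremum over [h] is taken after a subtraction; otherwise the right-hand
   side is infinite or the atom has mass 0. *)
move: (f0 0%R) key k0; case: (f 0%R) => [r| |]// r0 key k0.
  rewrite addeC -leeBrDr//; apply: integral_le_simple => // h hf.
  by rewrite leeBrDr// addeC; exact: key.
have [e0|e0] := eqVneq e%:num 0%R; last first.
  rewrite (_ : \int[mref e]_x f x = +oo) ?leey//.
  apply/eqP; rewrite -leye_eq; apply: le_trans k0.
  by rewrite mulry gtr0_sg ?mul1e// lt_neqAle eq_sym e0/=.
rewrite e0 mul0e add0e; apply: integral_le_simple => // h hf.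
by have := key h hf; rewrite e0 mul0e add0e.
Qed.

Let measurable_fun_default (h : R -> R) :
  @measurable_fun _ _ mR R setT h -> @measurable_fun _ _ R R setT h.
Proof. by []. Qed.

Let measurable_fun_undefault (h : R -> R) :
  @measurable_fun _ _ R R setT h -> @measurable_fun _ _ mR R setT h.
Proof. by []. Qed.

Let nnsfun_default (h : {nnsfun mR >-> R}) : {nnsfun R >-> R} :=
  HB.pack (h : R -> R)
    (isMeasurableFun.Build _ _ R R (h : R -> R)
      (measurable_fun_default (measurable_funPT h)))
    (FiniteImage.Build R R (h : R -> R) (fimfunP h))
    (isNonNegFun.Build R R (h : R -> R) (@fun_ge0 _ _ h)).

Let nnsfun_undefault (h : {nnsfun R >-> R}) : {nnsfun mR >-> R} :=
  HB.pack (h : mR -> R)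
    (isMeasurableFun.Build _ _ mR R (h : mR -> R)
      (measurable_fun_undefault (measurable_funPT h)))
    (FiniteImage.Build mR R (h : mR -> R) (fimfunP h))
    (isNonNegFun.Build mR R (h : mR -> R) (@fun_ge0 _ _ h)).

(* The integrals of [iint] are taken with respect to the default measurable
   structure on [R], those against [lebesgue_measure] with respect to
   [measurableTypeR R]: same sets, different displays. *)
Definition Im (m : set R -> \bar R) (f : R -> \bar R) : \bar R := \int[m]_x f x.

Lemma ImE e f : Im (mref e) f = \int[mref e]_x f x.
Proof.
have K (g : R -> \bar R) :
  [set sintegral (mref e) h | h in [set h : {nnsfun R >-> R} | forall x, (h x)%:E <= g x]]
  = [set sintegral (mref e) h | h in [set h : {nnsfun mR >-> R} | forall x, (h x)%:E <= g x]].
  apply/seteqP; split => _ [h /= hg <-].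
    by exists (nnsfun_undefault h).
  by exists (nnsfun_default h).
by rewrite /Im /integral !K.
Qed.

Fixpoint Jm e n F : V -> \bar R :=
  if n is n'.+1 then fun w => Im (mref e) (fun x => Jm e n' F (upd w n' x)) else F.

Lemma Jm_ge0 e n F w : (forall v, 0 <= F v) -> 0 <= Jm e n F w.
Proof. by move=> F0; elim: n w => //= n IH w; rewrite ImE; exact: integral_ge0. Qed.

Lemma iint_Jm e n F w :
  iint (mref e) n (fun v => F (fun i => if (i < n)%N then v i else w i)) =
  Jm e n F w.
Proof.
elim: n w => [|n IH] w //=.
rewrite -/(Im _ _); apply: (f_equal (Im (mref e))); apply/funext => x.
apply: etrans (IH (upd w n x)).
apply: (f_equal (iint (mref e) n)); apply/funext => v.
apply: (f_equal F); apply/funext => i; rewrite /upd ltnS leq_eqVlt.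
by case: (eqVneq i n) => [->|] //=; rewrite ltnn.
Qed.

Lemma Jop_le_Jm e n F w : (forall v, 0 <= F v) ->
  Jop (full e) 0 n F w <= Jm e n F w.
Proof.
move=> F0; elim: n w => //= n IH w; rewrite add0n ImE.
have := @integral_mref_ge e (fun x => Jm e n F (upd w n x)) (fun x => Jm_ge0 e n _ F0).
apply: le_trans; rewrite /Iop/= mul1e; apply: leeD.
  by rewrite lee_wpmul2l ?lee_fin.
by apply: nonmeasurable_le_integral => // x; exact: Jop_ge0.
Qed.

Lemma Jm_GS Q e n F w : GS Q F -> Jm e n F w = Jop (full e) 0 n F w.
Proof.
move=> GF; have F0 v := GS_ge0 v GF.
elim: n w => //= n IH w; rewrite add0n ImE.
under eq_integral do rewrite IH.
rewrite (@integral_mref e (fun x => Jop (full e) 0 n F (upd w n x))).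
- by rewrite /Iop/= mul1e.
- by move=> x; exact: Jop_ge0.
- exact: GS_measurable (GS_Jop (full e) 0 n GF).
Qed.

Definition pin e (A : pred nat) : nat -> {nonneg R} * {nonneg R} :=
  fun i => (if A i then e else 0%:nng, 1%:nng)%R.

Definition avoids (A : pred nat) m n v :=
  all (fun i => (i < m)%N || A i || (v i != 0%R)) (iota 0 n).

Lemma avoidsP A m n v : reflect (forall i, (m <= i < n)%N -> ~~ A i -> v i <> 0%R)
  (avoids A m n v).
Proof.
apply: (iffP allP) => [H i /andP[mi ni] Ai|H i].
  have := H i; rewrite mem_iota/= add0n => /(_ ni).
  by rewrite ltnNge mi (negbTE Ai)/= => /eqP.
rewrite mem_iota/= add0n => ni; have [//|mi] := ltnP i m.
by have [//|Ai] := boolP (A i); apply/eqP/H => //; rewrite mi.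
Qed.

(** Where a site outside [A l] has to be nonzero its atom contributes nothing, so [pin] removes it.
    Measurability is asked of the majorants, not of [F]; there are several of them because the
    certificates of a finite cover are combined. *)
Lemma Jm_pinned_le e n p (A : nat -> pred nat) (Q : nat -> V -> R)
    (G : nat -> V -> \bar R) F w :
  (forall v, 0 <= F v) -> (forall l, GS (Q l) (G l)) ->
  (forall v, (forall k, (n <= k)%N -> v k = w k) ->
     F v <= \sum_(l < p) (if avoids (A l) 0 n v then G l v else 0)) ->
  Jm e n F w <= \sum_(l < p) Jop (pin e (A l)) 0 n (G l) w.
Proof.
move=> F0 GG FG; have G0 l v := GS_ge0 v (GG l).
pose J l m v := Jop (pin e (A l)) 0 m (G l) v.
have J0 l m v : 0 <= J l m v by exact: Jop_ge0.
have mJ l m v : measurable_fun [set: mR] (fun x : mR => J l m (upd v m x)).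
  exact: GS_measurable (GS_Jop (pin e (A l)) 0 m (GG l)).
(* Induction on the number of integrated sites: the avoidance condition survives on the sites from
   [m] on. *)
suff H m : (m <= n)%N -> forall v, (forall k, (n <= k)%N -> v k = w k) ->
    Jm e m F v <=
    \sum_(l < p) (if avoids (A l) m n v then J l m v else 0).
  apply: le_trans (H n (leqnn n) w (fun _ _ => erefl)) _; apply: lee_sum => l _.
  by case: ifP => // _; exact: J0.
elim: m => [|m IH] mn v vw; first exact: FG.
pose g l (x : mR) := if avoids (A l) m n (upd v m x) then J l m (upd v m x) else 0.
have g0 l x : 0 <= g l x by rewrite /g; case: ifP => // _; exact: J0.
have avE l x : avoids (A l) m n (upd v m x) =
    (A l m || (x != 0%R)) && avoids (A l) m.+1 n v.
  apply/avoidsP/andP => [H|[Hm /avoidsP H] i /andP[mi ni] Ai].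
    split.
      have [//|Am] := boolP (A l m); apply/eqP => x0.
      by have := H m; rewrite leqnn mn /upd eqxx => /(_ isT Am).
    apply/avoidsP => i /andP[mi ni] Ai.
    have := H i; rewrite ni (ltnW mi) /upd => /(_ isT Ai).
    by rewrite gtn_eqF.
  rewrite /upd; case: eqP => [im|im].
    by move: Hm Ai; rewrite im => /orP[->//|/eqP].
  by apply: H => //; rewrite ni andbT ltn_neqAle mi andbT eq_sym; apply/eqP.
have mg l : measurable_fun [set: mR] (g l).
  rewrite /g; under eq_fun do rewrite avE.
  case: (avoids (A l) m.+1 n v); last first.
    by under eq_fun do rewrite andbF; exact: measurable_cst.
  under eq_fun do rewrite andbT.
  case: (A l m); first exact: mJ.
  apply: measurable_fun_ifT => //=.
  by apply: measurable_neg; apply: (measurable_fun_eqr (T := mR)).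
rewrite [Jm _ _ _ _]/= ImE.
apply: (@le_trans _ _ (\int[mref e]_x \sum_(l < p) g l x)).
  apply: nonmeasurable_le_integral => x; first exact: Jm_ge0.
  apply: IH (ltnW mn) _ _ => k nk; rewrite /upd gtn_eqF ?vw//.
  exact: leq_trans mn nk.
rewrite ge0_integral_sum//.
apply: lee_sum => l _; rewrite integral_mref// /g !avE.
have [av|av] := boolP (avoids (A l) m.+1 n v); last first.
  rewrite !andbF mule0 add0e.
  by under eq_integral do rewrite avE (negbTE av) andbF; rewrite integral0.
rewrite andbT eqxx orbF.
have -> : J l m.+1 v = ((pin e (A l) m).1%:num)%:E * J l m (upd v m 0%R) +
    1 * \int[leb]_x J l m (upd v m x) by [].
apply: leeD; first rewrite /pin/=.
  by case: (A l m) => //=; rewrite mule0 mul0e.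
rewrite mul1e; apply: nonmeasurable_le_integral => x.
  by case: ifP => // _; exact: J0.
by case: ifP => // _; exact: J0.
Qed.

End ReferenceMeasure.

(** * The two models and their profiles *)

Section Model.
Context {R : realType}.
Notation V := (nat -> R).
Notation half := (2^-1 : R).
Implicit Types (e : {nonneg R}) (F G : V -> \bar R) (w v : V).

Lemma HamE N (f : V) : Ham N f = half * qR N.+1 f.
Proof.
rewrite /Ham /qR big_add1/= big_mkord mulr_sumr; apply: eq_bigr => i _.
by rewrite /rho; field.
Qed.

Variables (a al b be : R).

(* The two models share the density [dens] on [fld_a]; the clamped model is
   obtained by not integrating the coordinates [N.-1] and [N], that carry its
   right boundary values.  The coordinate [N.+1] is always [1]. *)
Variables (free : bool).

Definition nfree N := if free then N.+1 else N.-1.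

Definition base N : V := fun i =>
  if i == N.-1 then b * N%:R ^+ 2
  else if i == N then b * N%:R ^+ 2 + be * N%:R else 1.

Definition ev N (E : set (R -> R)) : set V := [set fld | E (profile N fld)].

Definition dens N (E : set (R -> R)) w : \bar R :=
  ((expR (- Ham N (fld_a a al N w))) * \1_(ev N E) (fld_a a al N w))%:E.

Definition wgt e N (E : set (R -> R)) : \bar R :=
  if free then weight e N.+1 (fld_a a al N) N (ev N E)
  else weight e N.-1 (fld_r a al b be N) N (ev N E).

Lemma profile_ext N (f g : V) : (0 < N)%N -> (forall i, (i <= N.+1)%N -> f i = g i) ->
  profile N f = profile N g.
Proof.
move=> N0 fg; apply/funext => t; rewrite /profile.
set k := minn _ _; have kN : (k <= N.-1)%N by rewrite geq_minr.
by rewrite !fg// -(prednK N0) !ltnS; lia.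
Qed.

Lemma qR_ext n (f g : V) : (forall i, (i < n.+2)%N -> f i = g i) -> qR n f = qR n g.
Proof.
by move=> fg; apply: eq_bigr => i _; rewrite /rho !fg// !ltnS; have := ltn_ord i; lia.
Qed.

Lemma dens_ext N E (f g : V) : (0 < N)%N -> (forall i, (i < N.+3)%N -> f i = g i) ->
  ((expR (- Ham N f)) * \1_(ev N E) f)%:E = ((expR (- Ham N g)) * \1_(ev N E) g)%:E :> \bar R.
Proof.
move=> N0 fg; rewrite !HamE (qR_ext (g := g))//; congr (_ * _)%:E.
have -> : \1_(ev N E) f = (\1_E (profile N f) : R).
  rewrite !indicE; congr (_%:R); apply/idP/idP; rewrite !inE//.
have -> : \1_(ev N E) g = (\1_E (profile N g) : R).
  rewrite !indicE; congr (_%:R); apply/idP/idP; rewrite !inE//.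
by rewrite (@profile_ext N f g)// => i iN; rewrite fg// ltnS; lia.
Qed.

Lemma wgtE e N E : (0 < N)%N ->
  wgt e N E = Jm e (nfree N) (dens N E) (base N).
Proof.
move=> N0; rewrite /wgt /nfree /weight; case: free; rewrite -iint_Jm;
  congr (iint _ _ _); apply/funext => v; apply: dens_ext => // i iN;
  rewrite /fld_a /fld_r; case: eqP => // i0; case: eqP => // i1.
  by rewrite ifT//; lia.
case: eqP => iN1; first by rewrite ifF ?/base ?ifT//; lia.
case: eqP => iN2.
  have -> : (i - 2 < N.-1)%N = false by lia.
  have i2 : (i - 2)%N = N by lia.
  by rewrite /base i2 eqxx ifF//; apply/eqP; lia.
by rewrite ifT//; lia.
Qed.

End Model.

Section Profile.
Context {R : realType}.
Notation V := (nat -> R).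
Notation half := (2^-1 : R).
Implicit Types (f : V) (t : R).

Lemma fld_slope f k : f k.+1 - f k = f 1%N - f 0%N + \sum_(j < k) rho f j.
Proof.
elim: k => [|k IH]; first by rewrite big_ord0 addr0.
by rewrite big_ord_recr/= addrA -IH /rho; ring.
Qed.

Lemma fld_expand f k : f k.+1 =
  f 1%N + k%:R * (f 1%N - f 0%N) + \sum_(j < k) (k%:R - j%:R) * rho f j.
Proof.
elim: k => [|k IH]; first by rewrite big_ord0 mul0r !addr0.
have -> : f k.+2 = f k.+1 + (f k.+2 - f k.+1) by ring.
rewrite fld_slope IH !big_ord_recr/=.
have -> : \sum_(j < k) (k.+1%:R - j%:R) * rho f j =
    \sum_(j < k) (k%:R - j%:R) * rho f j + \sum_(j < k) rho f j.
  by rewrite -big_split/=; apply: eq_bigr => j _; rewrite -natr1; ring.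
by rewrite -natr1; ring.
Qed.

Definition ramp t (x : R) : R := Num.max (t - x) 0.

Lemma profile_cell N f t : (0 < N)%N -> 0 <= t <= 1 -> exists2 k, (k < N)%N &
  k%:R <= N%:R * t <= k.+1%:R /\ profile N f t =
  ((k.+1%:R - N%:R * t) * f k.+1 + (N%:R * t - k%:R) * f k.+2) / N%:R ^+ 2.
Proof.
move=> N0 /andP[t0 t1]; set s := N%:R * t.
have N0' : 0 < N%:R :> R by rewrite ltr0n.
have s0 : 0 <= s by rewrite mulr_ge0// ltW.
(* The cap [N.-1] assigns [t = 1] to the last cell. *)
exists (minn (Num.truncn s) N.-1); first by rewrite -{2}(prednK N0) ltnS geq_minr.
split; last by [].
apply/andP; split.
  apply: le_trans (_ : (Num.truncn s)%:R <= s); last by rewrite truncn_le.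
  by rewrite ler_nat geq_minl.
rewrite /minn; case: ltnP => _; last by rewrite prednK// -[leRHS]mulr1 ler_pM2l.
by apply/ltW; rewrite truncnS_gt.
Qed.

Lemma profileE N f t : (0 < N)%N -> 0 <= t <= 1 ->
  profile N f t = f 1%N / N%:R ^+ 2 + t * (f 1%N - f 0%N) / N%:R +
    N%:R^-1 * \sum_(j < N.+1) ramp t (j%:R / N%:R) * rho f j.
Proof.
move=> N0 t01; have N0' : 0 < N%:R :> R by rewrite ltr0n.
have [k kN [/andP[ks sk] ->]] := profile_cell f N0 t01.
set s := N%:R * t in ks sk *.
have -> : \sum_(j < N.+1) ramp t (j%:R / N%:R) * rho f j =
    N%:R^-1 * \sum_(j < k.+1) (s - j%:R) * rho f j.
  rewrite (big_ord_widen _ (fun j => (s - j%:R) * rho f j) (_ : k.+1 <= N.+1)%N)//; last first.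
    by rewrite ltnS ltnW.
  rewrite [in RHS]big_mkcond/= mulr_sumr; apply: eq_bigr => j _.
  rewrite /ramp; have -> : t - j%:R / N%:R = (s - j%:R) / N%:R.
    by rewrite /s; field; rewrite gt_eqF.
  case: ifP => jk.
    rewrite max_l; first by field; rewrite gt_eqF.
    rewrite divr_ge0 ?(ltW N0')// subr_ge0; apply: le_trans ks.
    by rewrite ler_nat -ltnS.
  rewrite max_r ?mul0r ?mulr0//.
  rewrite ler_pdivrMr// mul0r subr_le0; apply: le_trans sk _.
  by rewrite ler_nat; move/negbT: jk; rewrite -leqNgt.
have E : (k.+1%:R - s) * f k.+1 + (s - k%:R) * f k.+2 =
    f 1%N + s * (f 1%N - f 0%N) + \sum_(j < k.+1) (s - j%:R) * rho f j.
  transitivity (f k.+1 + (s - k%:R) * (f k.+2 - f k.+1)).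
    by rewrite -natr1; ring.
  rewrite fld_slope fld_expand !big_ord_recr/=.
  have -> : \sum_(j < k) (s - j%:R) * rho f j =
      \sum_(j < k) (k%:R - j%:R) * rho f j + (s - k%:R) * \sum_(j < k) rho f j.
    by rewrite mulr_sumr -big_split/=; apply: eq_bigr => j _; ring.
  by ring.
rewrite E; move: (\sum_(j < k.+1) _) => S; rewrite /s; field.
by rewrite gt_eqF.
Qed.

Lemma profile_grid N f k : (0 < N)%N -> (k <= N)%N ->
  profile N f (k%:R / N%:R) = f k.+1 / N%:R ^+ 2.
Proof.
move=> N0 kN; have N0' : 0 < N%:R :> R by rewrite ltr0n.
rewrite profileE//; last first.
  by rewrite divr_ge0// ler_pdivrMr// mul1r ler_nat.
rewrite [f k.+1]fld_expand.
rewrite (big_ord_widen _ (fun j => (k%:R - j%:R) * rho f j) (_ : k <= N.+1)%N)//; last first.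
  exact: leqW.
rewrite [in RHS]big_mkcond/=.
have -> : \sum_(j < N.+1) ramp (k%:R / N%:R) (j%:R / N%:R) * rho f j =
  N%:R^-1 * \sum_(j < N.+1) (if (j < k)%N then (k%:R - j%:R) * rho f j else 0).
  rewrite mulr_sumr; apply: eq_bigr => j _; rewrite /ramp -mulrBl.
  case: ltnP => jk.
    rewrite max_l; first by field; rewrite gt_eqF.
    by rewrite divr_ge0 ?(ltW N0')// subr_ge0 ler_nat ltnW.
  by rewrite max_r ?mul0r ?mulr0// ler_pdivrMr// mul0r subr_le0 ler_nat.
by move: (\sum_(j < _) _) => S; field; rewrite gt_eqF.
Qed.

Lemma ramp_lip t t' x : `|ramp t x - ramp t' x| <= `|t - t'|.
Proof.
rewrite /ramp; have := ler_norm (t - t'); have := ler_norm (t' - t).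
rewrite -(distrC t t'); case: (leP (t - x) 0); case: (leP (t' - x) 0) => h1 h2 h3 h4.
- by rewrite subrr normr0.
- by rewrite ler_norml; apply/andP; split; lra.
- by rewrite ler_norml; apply/andP; split; lra.
- by rewrite (_ : t - x - (t' - x) = t - t')//; ring.
Qed.

Lemma profile_lipschitz N f t t' : (0 < N)%N -> 0 <= t <= 1 -> 0 <= t' <= 1 ->
  `|profile N f t - profile N f t'| <=
  (`|f 1%N - f 0%N| / N%:R + N%:R^-1 * \sum_(j < N.+1) `|rho f j|) * `|t - t'|.
Proof.
move=> N0 ht ht'; have N0' : 0 < N%:R :> R by rewrite ltr0n.
rewrite !profileE//.
set S := \sum_(j < _) _; set S' := \sum_(j < _) _.
have -> : f 1%N / N%:R ^+ 2 + t * (f 1%N - f 0%N) / N%:R + N%:R^-1 * S -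
  (f 1%N / N%:R ^+ 2 + t' * (f 1%N - f 0%N) / N%:R + N%:R^-1 * S') =
  (t - t') * ((f 1%N - f 0%N) / N%:R) + N%:R^-1 * (S - S') by ring.
apply: le_trans (ler_normD _ _) _; rewrite !normrM mulrDl.
have NV : `|N%:R^-1| = N%:R^-1 :> R by rewrite ger0_norm// invr_ge0 ltW.
rewrite NV; apply: lerD; first by rewrite mulrC.
rewrite -mulrA ler_pM2l ?invr_gt0// /S /S' -sumrB mulr_suml.
apply: le_trans (ler_norm_sum _ _ _) _; apply: ler_sum => j _.
by rewrite -mulrBl normrM mulrC ler_wpM2l// ramp_lip.
Qed.

End Profile.

(** * Upper bounds by exponential tilting *)

Section Upper.
Context {R : realType}.
Notation V := (nat -> R).
Notation half := (2^-1 : R).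
Notation gc k := (Num.sqrt (pi / k)).
Implicit Types (e : {nonneg R}) (F G : V -> \bar R) (w v : V).
Variables (a al b be : R) (free : bool).

Notation nf := (nfree free).
Notation bs := (base b be).
Notation wg := (wgt a al b be free).
Notation dn := (dens a al).

(** The boundary data are multiplied by the coordinate [N.+1], so the field is linear in [w]: it is
    the field of the model when that coordinate is 1 and [pad w] when it is 0. *)
Definition fldh N w : V := fld_a (a * w N.+1) (al * w N.+1) N w.

Lemma fldh_linear N c u v : fldh N (c *: u + v) = c *: fldh N u + fldh N v.
Proof.
apply/funext => i; rewrite fE /fldh /fld_a !fE.
by case: eqP => _; [ring|case: eqP => _; [ring|]].
Qed.

Lemma fldh0 N w : w N.+1 = 0 -> fldh N w = pad w.
Proof.
move=> w0; apply/funext => -[|[|i]]; rewrite /fldh /fld_a /pad/= ?w0;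
  by rewrite ?mulr0 ?mul0r ?subr0.
Qed.

Lemma fldh1 N w : w N.+1 = 1 -> fldh N w = fld_a a al N w.
Proof. by move=> w1; rewrite /fldh w1 !mulr1. Qed.

Lemma lin_rho_fldh N j : lin (fun w => rho (fldh N w) j).
Proof. by move=> c u v; rewrite fldh_linear (lin_rho j). Qed.

Lemma base1 N : (0 < N)%N -> bs N N.+1 = 1.
Proof. by move=> N0; rewrite /base !ifF//; lia. Qed.

Lemma nfree_le N : (0 < N)%N -> (nf N <= N.+1)%N.
Proof. by rewrite /nfree; case: free; lia. Qed.

Definition Zpin k (mu : nat -> {nonneg R} * {nonneg R}) N : \bar R :=
  Jop mu 0 (nf N) (fun w => (expR (- (k * qR N.+1 (pad w))))%:E) 0%R.

Lemma Zpin_ge0 k mu N : (0 <= Zpin k mu N)%E.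
Proof. by apply: Jop_ge0 => v; rewrite lee_fin expR_ge0. Qed.

Definition endfactor k e N : R :=
  if free then (e%:num + gc (k / (2 * N.+2%:R ^+ 3))) ^+ 2 else 1.

(** The clamped case is [ZP <= ZR]. At a free end the last two sites are integrated last, against
    the Gaussian decay [p] that the Poincare inequality extracts from the energy. *)
Lemma Zpin_le k e mu N : (0 < N)%N -> 0 < k ->
  (forall i, (mu i).1%:num <= e%:num /\ (mu i).2%:num <= 1) ->
  (Zpin k mu N <= ZR k mu N.-1 * (endfactor k e N)%:E)%E.
Proof.
move=> N0 k0 mule; have NE : N.+1 = N.-1.+2 by lia.
have LP := @ZP_le_ZR R k mu N.-1 (ltW k0).
have EP : (fun w => (expR (- (k * qR N.+1 (pad w))))%:E) = eP k N.-1 :> (V -> \bar R).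
  by rewrite /eP NE.
rewrite /Zpin /endfactor /nfree EP; case: free; last by rewrite mule1.
set s := k / _; have s0 : 0 < s by rewrite /s divr_gt0// mulr_gt0// exprn_gt0.
pose p w : R := s * w N.-1 ^+ 2 + s * w N ^+ 2.
have nq : nnq (fun w => k * qR N.-1.+2 (pad w)) by exact: nnq_qRpad (ltW k0).
have Pp w : (Jop mu 0 N.-1 (eP k N.-1) w <= ZP k mu N.-1 * (expR (- p w))%:E)%E.
  apply: Jop_expR_sub.
  - split.
      apply: qformB; first by case: nq.
      by apply: qformD; apply: qformZ; exact: qform_sq.
    move=> u; rewrite subr_ge0 /p -mulrDr /s -NE -mulrA ler_pM2l//.
    rewrite mulrC ler_pdivrMr ?mulr_gt0 ?exprn_gt0//.
    have H0 := @sqr_le_qR _ N.+1 (pad u) N.+1 erefl erefl (leqnSn _).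
    have H1 := @sqr_le_qR _ N.+1 (pad u) N.+2 erefl erefl (leqnn _).
    move: H0 H1; rewrite /pad NE !subSS !subn0/=; rewrite (prednK N0).
    by rewrite -/(pad u); nra.
  - by rewrite /p !f0E expr0n !mulr0 addr0.
  - by move=> v i x /andP[_ iN]; rewrite /p /upd !ifF//; lia.
have Z0 := ZP_ge0 k mu N.-1; set Z := ZP k mu N.-1 in Pp Z0 LP.
set f := e%:num + gc s.
have f0 : 0 <= f by rewrite addr_ge0// sqrtr_ge0.
have fm i : (mu i).1%:num + (mu i).2%:num * gc s <= f.
  have [h1 h2] := mule i; rewrite /f lerD//.
  by rewrite ler_piMl// sqrtr_ge0.
rewrite NE /= !add0n (prednK N0).
apply: (@le_trans _ _ (Z * (f ^+ 2)%:E)%E); last by rewrite lee_wpmul2r// lee_fin exprn_ge0.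
have GZ : GS (fun v => s * v N.-1 ^+ 2) (fun v => Z * (expR (- (s * v N.-1 ^+ 2)))%:E)%E.
  apply: GS_scale => //; apply: GS_expR; split; last first.
    by move=> u; rewrite mulr_ge0 ?sqr_ge0// ltW.
  by apply: qformZ; exact: qform_sq.
apply: (@le_trans _ _ (Iop (mu N) N
    (fun v => (Z * f%:E) * (expR (- (s * v N ^+ 2)))%:E)%E 0%R)); last first.
  rewrite Iop_gauss ?mule_ge0 ?lee_fin// -muleA -EFinM lee_wpmul2l//.
  by rewrite lee_fin expr2 ler_wpM2l.
have E0 v : (0 <= eP k N.-1 v)%E by rewrite lee_fin expR_ge0.
apply: le_Iop => v; first by apply: Iop_ge0 => u; exact: Jop_ge0.
apply: (@le_trans _ _ (Z * ((mu N.-1).1%:num + (mu N.-1).2%:num * gc s)%:E *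
   (expR (- (s * v N ^+ 2)))%:E)%E); last first.
  by rewrite lee_wpmul2r ?lee_fin ?expR_ge0// lee_wpmul2l// lee_fin.
rewrite -(Iop_gauss (mu N.-1) N.-1 v s0 Z0).
rewrite -(IopZ _ _ GZ (h := fun v => expR (- (s * v N ^+ 2))))//; last first.
  by move=> u x; rewrite /upd ifF//; lia.
apply: le_Iop => u; first exact: Jop_ge0.
by apply: le_trans (Pp u) _; rewrite /p opprD expRD EFinM muleA.
Qed.

Lemma Zpin_fin_num k e mu N : (0 < N)%N -> 0 < k ->
  (forall i, (mu i).1%:num <= e%:num /\ (mu i).2%:num <= 1) ->
  Zpin k mu N \is a fin_num.
Proof.
move=> N0 k0 mule; rewrite ge0_fin_numE ?Zpin_ge0//.
apply: le_lt_trans (Zpin_le N0 k0 mule) _.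
by rewrite -(fineK (ZR_fin_num mu _ k0)) -EFinM ltey.
Qed.

Lemma nnq_tilt k N (theta : nat -> R) : 0 <= k ->
  nnq (fun w => k * \sum_(j < N.+1) (rho (fldh N w) j - w N.+1 * theta j) ^+ 2).
Proof.
move=> k0; split; last first.
  by move=> u; rewrite mulr_ge0// sumr_ge0// => j _; exact: sqr_ge0.
apply: qformZ; apply: (qform_sum (q := fun j w => (rho (fldh N w) j - w N.+1 * theta j) ^+ 2)).
move=> j _; apply: qform_sq; apply: linBl; first exact: lin_rho_fldh.
by move=> c u v; rewrite !fE; ring.
Qed.

(** At the origin the coordinate [N.+1] is 0, so boundary data and tilt disappear together and the
    untilted pinned partition function is left. *)
Lemma Jop_tilt_le k mu N (theta : nat -> R) w : (0 < N)%N -> 0 <= k ->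
  (Jop mu 0 (nf N) (fun w =>
     (expR (- (k * \sum_(j < N.+1) (rho (fldh N w) j - w N.+1 * theta j) ^+ 2)))%:E) w
   <= Zpin k mu N)%E.
Proof.
move=> N0 k0; apply: le_trans (Jop_expR_le0 _ _ _ _ (nnq_tilt N theta k0)) _.
apply: le_Jop2 => [v|v v' h1 h2]; first by rewrite lee_fin expR_ge0.
have vv : v = v'.
  by apply/funext => i; have [/h1//|/h2[-> ->]//] := boolP (0 <= i < 0 + nf N)%N.
have v0 : v' N.+1 = 0.
  by have [_ ->] := h2 N.+1 ltac:(by rewrite add0n /= -leqNgt nfree_le).
rewrite vv lee_fin ler_expR lerN2 ler_wpM2l// /qR -(fldh0 v0).
by under [leRHS]eq_bigr do rewrite v0 mul0r subr0.
Qed.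

(* Certified upper bounds: [ubd e N E X] implies [wg e N E <= X], is stable
   under unions, and does not require [E] to be measurable. *)
Definition ubd e N (E : set (R -> R)) (X : R) : Prop :=
  exists p (A : nat -> pred nat) (Q : nat -> V -> R) (G : nat -> V -> \bar R),
  [/\ forall l, GS (Q l) (G l),
   (forall v, (forall k, (nf N <= k)%N -> v k = bs N k) ->
     (dn N E v <= \sum_(l < p) (if avoids (A l) 0 (nf N) v then G l v else 0))%E) &
   (\sum_(l < p) Jop (pin e (A l)) 0 (nf N) (G l) (bs N) <= X%:E)%E].

Lemma dens_ge0 N E v : (0 <= dn N E v)%E.
Proof. by rewrite lee_fin mulr_ge0 ?expR_ge0. Qed.

Lemma ubd_wgt e N E X : (0 < N)%N -> ubd e N E X -> (wg e N E <= X%:E)%E.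
Proof.
move=> N0 [p [A [Q [G [GG dG JX]]]]]; rewrite wgtE//.
by apply: le_trans JX; exact: Jm_pinned_le (fun v => dens_ge0 _ _ _) GG dG.
Qed.

Lemma ubd_le e N E X X' : X <= X' -> ubd e N E X -> ubd e N E X'.
Proof.
move=> XX [p [A [Q [G [GG dG JX]]]]]; exists p, A, Q, G; split => //.
by apply: le_trans JX _; rewrite lee_fin.
Qed.

Lemma ubdU e N E E1 E2 X1 X2 : E `<=` E1 `|` E2 ->
  ubd e N E1 X1 -> ubd e N E2 X2 -> ubd e N E (X1 + X2).
Proof.
move=> EE [p [A [Q [G [GG dG JX]]]]] [p' [A' [Q' [G' [GG' dG' JX']]]]].
pose cmb T (x y : nat -> T) l := if (l < p)%N then x l else y (l - p)%N.
have cl T (x y : nat -> T) (l : 'I_p) : cmb T x y (lshift p' l) = x l.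
  by rewrite /cmb/= ltn_ord.
have cr T (x y : nat -> T) (l : 'I_p') : cmb T x y (rshift p l) = y l.
  by rewrite /cmb/= ltnNge leq_addr/= addKn.
exists (p + p')%N, (cmb _ A A'), (cmb _ Q Q'), (cmb _ G G'); split.
- by move=> l; rewrite /cmb; case: ifP.
- move=> v vb; rewrite big_split_ord/=.
  under eq_bigr do rewrite !cl; under [X in (_ + X)%E]eq_bigr do rewrite !cr.
  apply: le_trans (leeD (dG v vb) (dG' v vb)).
  rewrite -EFinD lee_fin -mulrDr ler_wpM2l ?expR_ge0//.
  rewrite !indicE -natrD ler_nat.
  have [/set_mem|//] := boolP (_ \in ev N E).
  by move=> /EE[H|H]; rewrite (mem_set (H : ev N _ _)) ?addn1// leq_addr.
- rewrite big_split_ord/=.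
  under eq_bigr do rewrite !cl; under [X in (_ + X)%E]eq_bigr do rewrite !cr.
  by rewrite EFinD leeD.
Qed.

Lemma ubdS e N E E' X : E `<=` E' -> ubd e N E' X -> ubd e N E X.
Proof.
move=> EE [p [A [Q [G [GG dG JX]]]]]; exists p, A, Q, G; split => // v vb.
apply: le_trans (dG v vb); rewrite lee_fin ler_wpM2l ?expR_ge0//.
rewrite !indicE ler_nat.
have [/set_mem|//] := boolP (_ \in ev N E).
by move=> /EE H; rewrite (mem_set (H : ev N _ _)).
Qed.

Lemma ubd1 e N E (A : pred nat) Q G : GS Q G -> (0 <= G (bs N))%E ->
  (forall v, (forall k, (nf N <= k)%N -> v k = bs N k) ->
     ev N E (fld_a a al N v) ->
     avoids A 0 (nf N) v /\ ((expR (- Ham N (fld_a a al N v)))%:E <= G v)%E) ->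
  Jop (pin e A) 0 (nf N) G (bs N) \is a fin_num ->
  ubd e N E (fine (Jop (pin e A) 0 (nf N) G (bs N))).
Proof.
move=> GG G0 H fn; exists 1%N, (fun _ => A), (fun _ => Q), (fun _ => G).
split => //; last by rewrite big_ord1 fineK.
move=> v vb; rewrite big_ord1 /dens indicE.
have [/set_mem Ev|_] := boolP (_ \in ev N E).
  by have [-> ?] := H v vb Ev; rewrite mulr1.
by rewrite mulr0; case: ifP => // _; exact: GS_ge0 GG.
Qed.

End Upper.

(** * Tilting by test kernels *)

Section Tests.
Context {R : realType}.
Notation V := (nat -> R).
Notation half := (2^-1 : R).
Notation gc k := (Num.sqrt (pi / k)).
Implicit Types (e : {nonneg R}) (w v : V) (f : R -> R).
Variables (a al b be : R) (free : bool).

Notation nf := (nfree free).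
Notation bs := (base b be).
Notation wg := (wgt a al b be free).
Notation dn := (dens a al).
Notation ubd := (ubd a al b be free).

(* A test consists of a kernel, a finite combination of ramps, of the position at
   time 1 and of the velocity at time 1; by Taylor's formula its integral against
   the second derivative of [h] is [Lam] at [h]. *)
Record test := Test { tc0 : R ; tc1 : R ; tcs : seq (R * R) }.

(** At a free end position and velocity at time 1 are not prescribed, so the kernel must not test
    them. *)
Definition test_ok (k : test) : Prop :=
  (free -> tc0 k = 0 /\ tc1 k = 0) /\ all (fun p => 0 <= p.2 <= 1) (tcs k).

Definition kern (k : test) (x : R) : R :=
  tc0 k + tc1 k * (1 - x) + \sum_(p <- tcs k) p.1 * ramp p.2 x.

Definition Lam (k : test) f : R :=
  tc0 k * (be - al) + tc1 k * (b - a - al) +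
  \sum_(p <- tcs k) p.1 * (f p.2 - a - al * p.2).

Definition tnorm (k : test) : R := \sum_(p <- tcs k) `|p.1|.

Definition theta (k : test) N (j : nat) : R := kern k (j%:R / N%:R).

Definition ksq (k : test) N : R := N%:R^-1 * \sum_(j < N.+1) theta k N j ^+ 2.

(** Each constituent of the kernel reads off one quantity: the constant telescopes to the change of
    slope, [1 - x] agrees with the ramp at 1 and gives the profile at 1, and the ramp at [t] gives
    the profile at [t]. *)
Lemma pairing k N (f : V) : (0 < N)%N -> test_ok k ->
  f 0%N = a * N%:R ^+ 2 - al * N%:R -> f 1%N = a * N%:R ^+ 2 ->
  (~~ free -> f N.+1 = b * N%:R ^+ 2 /\ f N.+2 = b * N%:R ^+ 2 + be * N%:R) ->
  \sum_(j < N.+1) theta k N j * rho f j = N%:R * Lam k (profile N f).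
Proof.
move=> N0 [kf kt] f0 f1 fN; have N0' : 0 < N%:R :> R by rewrite ltr0n.
have Nn0 : N%:R != 0 :> R by rewrite gt_eqF.
have d : f 1%N - f 0%N = al * N%:R by rewrite f0 f1; ring.
have P t : 0 <= t <= 1 -> \sum_(j < N.+1) ramp t (j%:R / N%:R) * rho f j =
    N%:R * (profile N f t - a - al * t).
  by move=> t01; rewrite profileE// d f1; move: (\sum_(j < N.+1) _) => S; field.
have E : \sum_(j < N.+1) theta k N j * rho f j =
  tc0 k * \sum_(j < N.+1) rho f j +
  tc1 k * \sum_(j < N.+1) (1 - j%:R / N%:R) * rho f j +
  \sum_(p <- tcs k) p.1 * \sum_(j < N.+1) ramp p.2 (j%:R / N%:R) * rho f j.
  under [X in _ = _ + X]eq_bigr do rewrite mulr_sumr.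
  rewrite exchange_big/= !mulr_sumr -!big_split/=; apply: eq_bigr => j _.
  rewrite /theta /kern mulrDl mulrDl mulr_suml -mulrA; congr (_ + _).
  by apply: eq_bigr => p _; rewrite mulrA.
rewrite E /Lam !mulrDr mulr_sumr; congr (_ + _ + _); last first.
  rewrite !big_seq; apply: eq_bigr => p pk.
  by rewrite P ?(allP kt)//; ring.
- have [/kf[_ ->]|/fN[fN1 fN2]] := boolP free; first by rewrite !mul0r !mulr0 !addr0.
  have -> : \sum_(j < N.+1) (1 - j%:R / N%:R) * rho f j =
      \sum_(j < N.+1) ramp 1 (j%:R / N%:R) * rho f j.
    apply: eq_bigr => j _; rewrite /ramp max_l// subr_ge0 ler_pdivrMr// mul1r.
    by rewrite ler_nat -ltnS.
  rewrite P ?ler01 ?lexx//.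
  have -> : profile N f 1 = b.
    have := profile_grid f N0 (leqnn N); rewrite divff// => ->.
    by rewrite fN1; field.
  by ring.
- have [/kf[-> _]|/fN[fN1 fN2]] := boolP free; first by rewrite !mul0r !mulr0 !addr0.
  have := fld_slope f N.+1; rewrite d fN1 fN2 => H.
  have -> : \sum_(j < N.+1) rho f j = N%:R * (be - al).
    by apply/eqP; rewrite -(inj_eq (addrI (al * N%:R))) -H; apply/eqP; ring.
  by ring.
Qed.

Lemma Lam_near k f g d : test_ok k -> (forall t, 0 <= t <= 1 -> `|f t - g t| <= d) ->
  Lam k f - d * tnorm k <= Lam k g.
Proof.
move=> [_ kt] fg; rewrite lerBlDr -lerBlDl.
have -> : Lam k f - Lam k g = \sum_(p <- tcs k) p.1 * (f p.2 - g p.2).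
  rewrite /Lam opprD addrACA subrr add0r -sumrB; apply: eq_bigr => p _; ring.
rewrite /tnorm mulr_sumr !big_seq; apply: ler_sum => p pk.
apply: le_trans (ler_norm _) _; rewrite normrM mulrC ler_wpM2r//.
by rewrite fg// (allP kt).
Qed.

Let I01P t : (t \in @I01 R) = (0 <= t <= 1).
Proof. by rewrite /I01 mem_setE in_itv. Qed.

Lemma fld_a_bound N v : (0 < N)%N -> (forall k, (nf N <= k)%N -> v k = bs N k) ->
  ~~ free -> fld_a a al N v N.+1 = b * N%:R ^+ 2 /\
    fld_a a al N v N.+2 = b * N%:R ^+ 2 + be * N%:R.
Proof.
move=> N0 vb; move: vb; rewrite /nfree; case: free => // vb _.
have N1 : N.-1.+1 = N by rewrite prednK.
split; rewrite /fld_a/= ?subSS ?subn0.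
  have -> : (N.+1 == 1)%N = false by lia.
  by rewrite subn1 vb// /base eqxx.
by rewrite vb ?leq_pred// /base eqxx ifF//; lia.
Qed.

(** Half the sum of [(rho - theta) ^ 2] is the Hamiltonian minus [N * Lam] plus [N * ksq / 2], and
    [Lam] is nearly constant on the ball. A site where [|f| >= d] cannot vanish; the site [N] of a
    free end lies beyond time 1, where the ball says nothing, and keeps its atom. *)
Lemma ubd_tilt e k N f d (A : pred nat) : (0 < N)%N -> test_ok k ->
  (forall i, (i < nf N)%N -> (i < N)%N -> `|f (i.+1%:R / N%:R)| < d -> A i) ->
  (forall i, (N <= i)%N -> A i) ->
  ubd e N (uball f d)
    (expR (- (N%:R * (Lam k f - d * tnorm k - half * ksq k N))) *
     fine (Zpin free half (pin e A) N)).
Proof.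
move=> N0 ok Af AN; have N0' : 0 < N%:R :> R by rewrite ltr0n.
set c := expR _.
have pinle i : (pin e A i).1%:num <= e%:num /\ (pin e A i).2%:num <= 1.
  rewrite /pin /=; case: (A i) => /=; split => //; exact: ge0.
have half0 : 0 < half by [].
have Zfn := Zpin_fin_num free N0 half0 pinle.
pose G0 w : \bar R := (expR (- (half *
  \sum_(j < N.+1) (rho (fldh a al N w) j - w N.+1 * theta k N j) ^+ 2)))%:E.
pose G w : \bar R := (c%:E * G0 w)%E.
have GG0 := GS_expR (nnq_tilt a al N (theta k N) (ltW half0)).
have GG := GS_scale (_ : (0 <= c%:E)%E) GG0.
have c0 : (0 <= c%:E)%E by rewrite lee_fin expR_ge0.
have JG : Jop (pin e A) 0 (nf N) G (bs N) = (c%:E * Jop (pin e A) 0 (nf N) G0 (bs N))%E.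
  exact: JopZl GG0 c0.
have JG0 := Jop_tilt_le a al free (pin e A) (theta k N) (bs N) N0 (ltW half0).
have J0 : (0 <= Jop (pin e A) 0 (nf N) G0 (bs N))%E.
  by apply: Jop_ge0 => v; rewrite lee_fin expR_ge0.
have J0fn : Jop (pin e A) 0 (nf N) G0 (bs N) \is a fin_num.
  rewrite ge0_fin_numE//; apply: le_lt_trans JG0 _.
  by rewrite -(fineK Zfn) ltey.
have JGfn : Jop (pin e A) 0 (nf N) G (bs N) \is a fin_num by rewrite JG fin_numM.
apply: (@ubd_le _ _ _ _ _ _ _ _ _ (fine (Jop (pin e A) 0 (nf N) G (bs N)))).
  by rewrite JG fineM//= ler_wpM2l ?expR_ge0// fine_le.
apply: (ubd1 (GG c0)) => //; first by rewrite mule_ge0// lee_fin expR_ge0.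
move=> v vb Ev; have v1 : v N.+1 = 1 by rewrite vb ?base1 ?nfree_le.
have [CE {}Ev] := Ev; split.
  apply/avoidsP => i /andP[_ inf] Ai vi; move/negP: Ai; apply.
  have [iN|] := ltnP i N; last exact: AN.
  apply: Af => //; have := Ev (i.+1%:R / N%:R); rewrite I01P.
  have -> : profile N (fld_a a al N v) (i.+1%:R / N%:R) = 0.
    by rewrite profile_grid// /fld_a/= subn2/= vi mul0r.
  rewrite subr0; apply.
  by rewrite divr_ge0// ler_pdivrMr// mul1r ler_nat.
rewrite /G /G0 -EFinM lee_fin /c -expRD ler_expR HamE.
rewrite fldh1//; set F := fld_a a al N v.
have P := pairing N0 ok (_ : F 0%N = _) (_ : F 1%N = _) (fld_a_bound N0 vb).
rewrite -/F in P; have {}P := P erefl erefl.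
have L : Lam k f - d * tnorm k <= Lam k (profile N F).
  by apply: Lam_near => // t t01; apply/ltW/Ev; rewrite I01P.
have S : \sum_(j < N.+1) (rho F j - v N.+1 * theta k N j) ^+ 2 =
    qR N.+1 F - 2 * (N%:R * Lam k (profile N F)) + N%:R * ksq k N.
  rewrite -P /ksq mulrA divff ?gt_eqF// mul1r v1 /qR mulr_sumr -sumrB -big_split/=.
  by apply: eq_bigr => j _; ring.
rewrite S; move: (ksq _ _) (Lam k f) (Lam k (profile N F)) (qR _ _) (tnorm k) L => K l1 l2 q tn L.
have {}L : N%:R * (l1 - d * tn) <= N%:R * l2 by apply: ler_wpM2l => //; exact: ltW.
by move: L; clear; lra.
Qed.

(** The Hamiltonian is [qR / 2]: one half of it exceeds [L * N / 4] on this event, the other half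
    keeps the weight integrable. *)
Lemma ubd_energy e N L : (0 < N)%N ->
  ubd e N [set g | ~ exists2 v : V, (forall k, (nf N <= k)%N -> v k = bs N k) /\
      qR N.+1 (fld_a a al N v) <= L * N%:R & g = profile N (fld_a a al N v)]
   (expR (- (L * N%:R / 4)) * fine (Zpin free (4^-1) (pin e predT) N)).
Proof.
move=> N0; have N0' : 0 < N%:R :> R by rewrite ltr0n.
set c := expR _.
have q0 : 0 < 4^-1 :> R by [].
have pinle i : (pin e predT i).1%:num <= e%:num /\ (pin e predT i).2%:num <= 1 by [].
have Zfn := Zpin_fin_num free N0 q0 pinle.
pose G0 w : \bar R := (expR (- (4^-1 *
  \sum_(j < N.+1) (rho (fldh a al N w) j - w N.+1 * (fun _ => 0) j) ^+ 2)))%:E.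
pose G w : \bar R := (c%:E * G0 w)%E.
have GG0 := GS_expR (nnq_tilt a al N (fun _ => 0) (ltW q0)).
have GG := GS_scale (_ : (0 <= c%:E)%E) GG0.
have c0 : (0 <= c%:E)%E by rewrite lee_fin expR_ge0.
have JG : Jop (pin e predT) 0 (nf N) G (bs N) = (c%:E * Jop (pin e predT) 0 (nf N) G0 (bs N))%E.
  exact: JopZl GG0 c0.
have JG0 := Jop_tilt_le a al free (pin e predT) (fun _ => 0) (bs N) N0 (ltW q0).
have J0 : (0 <= Jop (pin e predT) 0 (nf N) G0 (bs N))%E.
  by apply: Jop_ge0 => v; rewrite lee_fin expR_ge0.
have J0fn : Jop (pin e predT) 0 (nf N) G0 (bs N) \is a fin_num.
  rewrite ge0_fin_numE//; apply: le_lt_trans JG0 _.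
  by rewrite -(fineK Zfn) ltey.
have JGfn : Jop (pin e predT) 0 (nf N) G (bs N) \is a fin_num by rewrite JG fin_numM.
apply: (@ubd_le _ _ _ _ _ _ _ _ _ (fine (Jop (pin e predT) 0 (nf N) G (bs N)))).
  by rewrite JG fineM//= ler_wpM2l ?expR_ge0// fine_le.
apply: (ubd1 (GG c0)) => //; first by rewrite mule_ge0// lee_fin expR_ge0.
move=> v vb Ev; have v1 : v N.+1 = 1 by rewrite vb ?base1 ?nfree_le.
split; first by apply/avoidsP.
rewrite /G /G0 -EFinM lee_fin /c -expRD ler_expR HamE fldh1//.
have -> : \sum_(j < N.+1) (rho (fld_a a al N v) j - v N.+1 * 0) ^+ 2 = qR N.+1 (fld_a a al N v).
  by apply: eq_bigr => j _; rewrite mulr0 subr0.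
have : L * N%:R < qR N.+1 (fld_a a al N v).
  by rewrite ltNge; apply/negP => H; apply: Ev; exists v.
lra.
Qed.

End Tests.

(** * Partially pinned partition functions *)

Section Freeze.
Context {R : realType}.
Notation V := (nat -> R).
Notation leb := (@lebesgue_measure R).
Notation half := (2^-1 : R).
Notation gc k := (Num.sqrt (pi / k)).
Implicit Types (e : {nonneg R}) (F G : V -> \bar R) (w v : V)
  (mu : nat -> {nonneg R} * {nonneg R}).

Lemma sum_indic_le (m s c : nat) (y : R) : 0 <= y ->
  \sum_(j < m) (if (j + s == c)%N then y else 0) <= y.
Proof.
move=> y0; elim: m => [|m IH]; first by rewrite big_ord0.
rewrite big_ord_recr/=; case: ifP => [/eqP mc|_]; last by rewrite addr0.
rewrite big1 ?add0r// => j _; rewrite ifF//; apply/eqP.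
by have := ltn_ord j; lia.
Qed.

(** The constant is [6 * 3]: [(a - 2 b + c) ^ 2 <= 6 (a ^ 2 + b ^ 2 + c ^ 2)], and a coordinate
    enters at most three second differences. *)
Lemma qR_pad_dl n i x : qR n (pad (upd (0 : V) i x)) <= 18 * x ^+ 2.
Proof.
pose p s j : R := if (j + s == i.+2)%N then x ^+ 2 else 0.
have P j s : pad (upd (0 : V) i x) (j + s) ^+ 2 = p s j.
  rewrite /p /pad /upd; have [->|/eqP H] := eqVneq (j + s)%N i.+2.
    by rewrite ltnNge/= subSS subn1/= eqxx.
  case: ltnP => a2; first by rewrite expr0n.
  by case: eqP => ?; [exfalso; lia|rewrite f0E expr0n].
apply: (@le_trans _ _ (\sum_(j < n) 6 * (p 0 j + p 1 j + p 2 j))); last first.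
  rewrite -mulr_sumr !big_split/=.
  have := @sum_indic_le n 0 i.+2 _ (sqr_ge0 x).
  have := @sum_indic_le n 1 i.+2 _ (sqr_ge0 x).
  have := @sum_indic_le n 2 i.+2 _ (sqr_ge0 x).
  by rewrite -![\sum_(j < n) (if _ then _ else _)]/(\sum_(j < n) p _ j) /p; lra.
apply: ler_sum => j _; rewrite -!P addn0 addn1 addn2 /rho.
move: (pad _ _) (pad _ _) (pad _ _) => c b a.
by have := sqr_ge0 (2 * a + b); have := sqr_ge0 (a - c); have := sqr_ge0 (b + 2 * c); nra.
Qed.

Definition frozen i (c : {nonneg R}) mu : nat -> {nonneg R} * {nonneg R} :=
  fun j => if j == i then (c, 0%:nng) else mu j.

Definition kap (k : R) : {nonneg R} := NngNum (sqrtr_ge0 (pi / (18 * k))).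

Lemma kap_gt0 k : 0 < k -> 0 < (kap k)%:num.
Proof. by move=> k0; rewrite /= sqrtr_gt0 divr_gt0 ?pi_gt0// mulr_gt0. Qed.

(** The envelope bounds [K] from below by its value at 0 times a Gaussian of fixed width. Hence
    freezing a site at 0 costs a factor that depends on [k] only, whatever the measures at the other
    sites are. *)
Lemma Iop_freeze Q k i c (K : V -> \bar R) : 0 < k -> GS Q K ->
  (forall x, Q (upd (0 : V) i x) <= k * (18 * x ^+ 2)) ->
  (((kap k)%:num)%:E * K 0%R <= Iop (c, (1%:nng)%R) i K 0%R)%E.
Proof.
move=> k0 GK HQ; have K0 v := GS_ge0 v GK.
have k18 : 0 < 18 * k by rewrite mulr_gt0.
apply: (@le_trans _ _ (Iop ((0%:nng)%R, (1%:nng)%R) i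
    (fun v => K 0%R * (expR (- (18 * k * v i ^+ 2)))%:E)%E 0%R)).
  by rewrite Iop_gauss//= add0r mul1r muleC.
apply: (@le_trans _ _ (Iop ((0%:nng)%R, (1%:nng)%R) i K 0%R)); last by apply: Iop_mono => //=; exact: ge0.
rewrite /Iop/= !mul0e !add0e !mul1e.
apply: nonmeasurable_le_integral => x; first by rewrite mule_ge0// lee_fin expR_ge0.
apply: le_trans (GS_env _ GK); rewrite muleC lee_wpmul2r// lee_fin ler_expR lerN2.
by apply: le_trans (HQ x) _; rewrite {1}/upd eqxx; lra.
Qed.

Lemma ZP_freeze k mu i n : 0 < k -> (i < n)%N -> (mu i).2 = 1%:nng ->
  (ZP k (frozen i (kap k) mu) n <= ZP k mu n)%E.
Proof.
move=> k0 iin mu1; have -> : n = (i.+1 + (n - i.+1))%N by lia.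
move: (n - i.+1)%N => m; set N := (i.+1 + m)%N.
have GE := GS_expR (nnq_qRpad N.+2 (ltW k0)).
have E0 v : (0 <= eP k N v)%E by exact: eP_ge0.
have split mu' : ZP k mu' N = Iop (mu' i) i (Jop mu' i.+1 m (Jop mu' 0 i (eP k N))) 0%R.
  rewrite /ZP {1}/N Jop_cat add0n (Jop_IopC (Q := fun w => k * qR N.+2 (pad (cut 0 i w))))//; first by rewrite ltnn.
  exact: (GS_Jop mu' 0 i GE).
rewrite !split; have -> : frozen i (kap k) mu i = (kap k, 0%:nng) by rewrite /frozen eqxx.
have -> : Jop (frozen i (kap k) mu) i.+1 m (Jop (frozen i (kap k) mu) 0 i (eP k N)) =
    Jop mu i.+1 m (Jop mu 0 i (eP k N)).
  apply/funext => w; have -> : Jop (frozen i (kap k) mu) 0 i (eP k N) = Jop mu 0 i (eP k N).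
    apply/funext => v; apply: eq_mu_Jop => // j ji; rewrite /frozen ifF//; lia.
  apply: eq_mu_Jop => [v|j ji]; first exact: Jop_ge0.
  by rewrite /frozen ifF//; lia.
have GK := GS_Jop mu i.+1 m (GS_Jop mu 0 i GE).
rewrite {1}/Iop/= mul0e adde0 upd0 [mu i]surjective_pairing mu1.
apply: (Iop_freeze _ k0 GK) => x; rewrite ler_pM2l//.
set u := cut _ _ _; have -> : u = upd (0 : V) i x.
  apply/funext => j; rewrite /u /cut /upd add0n.
  by case: ifP => [/andP[_ ji]|_]; [rewrite ltn_eqF|case: ifP => // jj; rewrite gtn_eqF//; lia].
exact: qR_pad_dl.
Qed.

Lemma ZP_mono k mu mu' n : (forall i, (i < n)%N ->
  (mu i).1%:num <= (mu' i).1%:num /\ (mu i).2%:num <= (mu' i).2%:num) ->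
  (ZP k mu n <= ZP k mu' n)%E.
Proof. move=> h; apply: Jop_mono => [v|i]; first exact: eP_ge0.
by rewrite add0n => /andP[_ ?]; exact: h. Qed.

(** Supermultiplicativity up to a constant, uniformly in the pinning: the two separating zeros are
    obtained by freezing, so the sites need not have atoms. *)
Lemma ZP_split k mu j m : 0 < k -> (mu j).2 = 1%:nng -> (mu j.+1).2 = 1%:nng ->
  (((kap k)%:num ^+ 2)%:E * (ZP k mu j * ZP k (fun i => mu (j.+2 + i)%N) m) <=
   ZP k mu (j.+2 + m))%E.
Proof.
move=> k0 m0 m1; pose mu1 := frozen j (kap k) mu; pose mu2 := frozen j.+1 (kap k) mu1.
apply: le_trans (ZP_freeze k0 _ m0); last by lia.
apply: le_trans (ZP_freeze (i := j.+1) k0 _ _); last 2 first.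
- by lia.
- by rewrite /frozen ifF//; apply/eqP; lia.
have := ZP_pinned mu2 j m (ltW k0).
have -> : ((mu2 j).1%:num * (mu2 j.+1).1%:num) = (kap k)%:num ^+ 2.
  by rewrite /mu2 /mu1 /frozen !eqxx (_ : (j == j.+1) = false)//; apply/eqP; lia.
have -> : ZP k mu2 j = ZP k mu j.
  apply: eq_mu_Jop => [v|i]; first exact: eP_ge0.
  by rewrite add0n => /andP[_ ij]; rewrite /mu2 /mu1 /frozen !ifF//; apply/eqP; lia.
suff -> : (fun i => mu2 (j.+2 + i)%N) = (fun i => mu (j.+2 + i)%N) by [].
by apply/funext => i; rewrite /mu2 /mu1 /frozen !ifF//; apply/eqP; lia.
Qed.

Lemma ZP_succ k mu n : 0 < k -> (mu n).2 = 1%:nng ->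
  (((kap k)%:num)%:E * ZP k mu n <= ZP k mu n.+1)%E.
Proof.
move=> k0 m1; apply: le_trans (ZP_freeze (i := n) k0 _ m1); last by [].
rewrite {2}/ZP /= add0n {1}/Iop /frozen eqxx/= mul0e adde0 upd0 lee_wpmul2l//.
rewrite -/(frozen n (kap k) mu).
have -> : ZP k mu n = Jop (frozen n (kap k) mu) 0 n (eP k n) 0%R.
  apply: eq_mu_Jop => [v|i]; first exact: eP_ge0.
  by rewrite add0n => /andP[_ ij]; rewrite /frozen !ifF//; apply/eqP; lia.
apply: le_Jop2 => [v|v v' h1 h2]; first exact: eP_ge0.
have -> : v = v'.
  by apply/funext => i; have [/h1//|/h2[-> ->]//] := boolP (0 <= i < 0 + n)%N.
rewrite /eP lee_fin ler_expR lerN2 ler_wpM2l ?(ltW k0)//.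
rewrite {1}/qR big_ord_recr/= -/(qR _ _).
have Z i : (n <= i)%N -> v' i = 0.
  by move=> ni; have [_ ->] := h2 i ltac:(lia).
have P i : (n.+2 <= i)%N -> pad v' i = 0.
  by move=> ni; rewrite /pad ifF ?Z//; lia.
have -> : rho (pad v') n.+2 = 0 by rewrite /rho !P; [ring|lia..].
by rewrite expr0n addr0.
Qed.

Lemma ZP_fin_num k mu n : 0 < k -> ZP k mu n \is a fin_num.
Proof.
move=> k0; rewrite ge0_fin_numE ?ZP_ge0//.
apply: le_lt_trans (ZP_le_ZR mu n (ltW k0)) _.
by rewrite ltey_eq ZR_fin_num.
Qed.

End Freeze.

(** * Growth of chains that are pinned on blocks *)

Section Blocks.
Context {R : realType}.
Notation half := (2^-1 : R).
Implicit Types (e : {nonneg R}) (A B : pred nat) (eta : R).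

Definition zpA e A n : R := fine (ZP half (pin e A) n).
Definition zrA e A n : R := fine (ZR half (pin e A) n).

Let half_gt0 : 0 < half. Proof. by []. Qed.

Lemma zpAE e A n : ZP half (pin e A) n = (zpA e A n)%:E.
Proof. by rewrite fineK// ZP_fin_num. Qed.

Lemma zrAE e A n : ZR half (pin e A) n = (zrA e A n)%:E.
Proof. by rewrite fineK// ZR_fin_num. Qed.

Lemma zpA_ge0 e A n : 0 <= zpA e A n.
Proof. by rewrite fine_ge0// ZP_ge0. Qed.

Lemma zrA_ge0 e A n : 0 <= zrA e A n.
Proof. by rewrite fine_ge0// ZR_ge0. Qed.

Lemma zpA0 e A : zpA e A 0 = 1.
Proof.
rewrite /zpA /ZP /= /eP /qR big1 ?mulr0 ?oppr0 ?expR0// => i _.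
have P j : pad (0 : nat -> R) j = 0 by rewrite /pad; case: ifP.
by rewrite /rho !P mulr0 subr0 addr0 expr0n.
Qed.

Lemma zrA0 e A : zrA e A 0 = 1.
Proof. by rewrite /zrA /ZR /= /eR /qR big_ord0 mulr0 oppr0 expR0. Qed.

Lemma zpA_append e e' eta : 0 < eta -> exists2 D, 0 < D & forall A n n', (n <= n')%N ->
  (forall i, (n <= i < n')%N -> e'%:num <= (pin e A i).1%:num) ->
  expR ((n' - n)%:R * (rate_inf e' - eta)) * zpA e A n <= D * zpA e A n'.
Proof.
move=> eta0; have [C C0 HC] := zp_lower e' eta0; set s := rate_inf e' - eta in HC *.
have K0 := kap_gt0 half_gt0; set K := (kap half)%:num in K0.
have T1 : 0 < expR s / K by rewrite divr_gt0 ?expR_gt0.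
have T2 : 0 < expR (2 * s) / (K ^+ 2 * C).
  by rewrite divr_gt0 ?expR_gt0// mulr_gt0// exprn_gt0.
exists (1 + expR s / K + expR (2 * s) / (K ^+ 2 * C)) => [|A n n' nn H]; first by lra.
have z0 := zpA_ge0 e A n; have z0' := zpA_ge0 e A n'.
(* Two frozen sites separate the old chain from the appended one; an extension by 0 or 1 sites is
   too short for that. *)
have [->|[->|[m mE]]] : n' = n \/ n' = n.+1 \/ exists m, n' = (n.+2 + m)%N.
  have [->|] := eqVneq n' n; [by left|move=> ?]; right.
  have [->|] := eqVneq n' n.+1; [by left|move=> ?]; right.
  by exists (n' - n.+2)%N; lia.
- by rewrite subnn mul0r expR0 ler_wpM2r//; lra.
- rewrite subSnn mul1r; have := ZP_succ half_gt0 (erefl : (pin e A n).2 = _).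
  rewrite !zpAE -EFinM lee_fin -/K => h.
  apply: (@le_trans _ _ (expR s / K * zpA e A n.+1)).
    by rewrite mulrAC ler_pdivlMr// -mulrA ler_pM2l ?expR_gt0// mulrC.
  by rewrite ler_wpM2r ?zpA_ge0//; lra.
- rewrite mE (_ : (n.+2 + m - n = 2 + m)%N); last by lia.
  have := @ZP_split R half (pin e A) n m half_gt0 erefl erefl.
  rewrite -/K !zpAE => h.
  have h2 : (zp e' m * (zpA e A n * K ^+ 2) <= zpA e A (n.+2 + m)%N).
    rewrite -lee_fin; apply: le_trans h; rewrite mulrA [leLHS]EFinM muleC.
    rewrite lee_wpmul2l ?lee_fin ?exprn_ge0 ?(ltW K0)//.
    rewrite mulrC ler_wpM2l// -lee_fin -(zpE e' m) -zpAE; apply: ZP_mono => i im; split => //=.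
    have := H (n.+2 + i)%N; rewrite mE => /(_ ltac:(lia)).
    by rewrite /pin/=; case: (A _).
  apply: (@le_trans _ _ (expR (2 * s) / (K ^+ 2 * C) * zpA e A (n.+2 + m))); last first.
    by rewrite ler_wpM2r ?zpA_ge0//; lra.
  rewrite natrD mulrDl expRD -!mulrA ler_pM2l ?expR_gt0//.
  rewrite mulrC -[leRHS]mulrC ler_pdivlMr ?mulr_gt0 ?exprn_gt0//.
  apply: le_trans h2; have := HC m; have : 0 <= zpA e A n * K ^+ 2.
    by rewrite mulr_ge0 ?exprn_ge0// ltW.
  move=> u0 /(ler_wpM2r u0); apply: le_trans.
  by rewrite le_eqVlt; apply/orP; left; apply/eqP; ring.
Qed.

(** Gaps and intervals are appended alternately, a gap at the Gaussian rate and an interval inside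
    [A] at the pinned rate. The constant depends on the number of intervals, not on their
    position. *)
Lemma zpA_intervals e eta (M : nat) : 0 < eta -> exists2 D, 0 < D &
  forall A (p q : nat -> nat) n,
    (forall j, (j < M)%N -> (p j <= q j <= n)%N) ->
    (forall j, (j.+1 < M)%N -> (q j <= p j.+1)%N) ->
    (forall j i, (j < M)%N -> (p j <= i < q j)%N -> A i) ->
  expR (n%:R * (rate_inf 0%:nng - eta) +
    (rate_inf e - rate_inf 0%:nng) * \sum_(j < M) (q j - p j)%:R) <= D * zpA e A n.
Proof.
move=> eta0; have [D0 D00 H0] := zpA_append e 0%:nng eta0.
have [D1 D10 H1] := zpA_append e e eta0.
move: (rate_inf e) (rate_inf 0%:nng) H0 H1 => r r0 H0 H1.
pose Q (q : nat -> nat) j := if j is j'.+1 then q j' else 0%N.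
exists (D0 * (D0 * D1) ^+ M) => [|A p q n pq qp pA].
  by rewrite mulr_gt0// exprn_gt0// mulr_gt0.
have X j : (j <= M)%N -> expR ((Q q j)%:R * (r0 - eta) +
    (r - r0) * \sum_(i < j) (q i - p i)%:R) <= (D0 * D1) ^+ j * zpA e A (Q q j).
  elim: j => [|j IH] jM; first by rewrite big_ord0 mul0r mulr0 addr0 expR0 expr0 zpA0 mul1r.
  have /andP[pqj _] := pq j jM.
  have Qp : (Q q j <= p j)%N by case: j jM {IH pqj} => // j jM; exact: qp.
  have h0 := H0 A _ _ Qp ltac:(by move=> i _ /=; exact: ge0).
  have h1 := H1 A _ _ pqj ltac:(by move=> i /(pA _ _ jM)/= ->).
  rewrite [Q q j.+1]/= big_ord_recr/=.
  have -> : (q j)%:R * (r0 - eta) + (r - r0) * (\sum_(i < j) (q i - p i)%:R + (q j - p j)%:R) =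
     (q j - p j)%:R * (r - eta) + ((p j - Q q j)%:R * (r0 - eta) + ((Q q j)%:R * (r0 - eta) +
    (r - r0) * \sum_(i < j) (q i - p i)%:R)).
    rewrite !natrB//; clear; move: (\sum_(i < j) _) => S; ring.
  rewrite expRD [expR (_ + (_ + _))]expRD.
  have {}IH := IH (ltnW jM).
  apply: (@le_trans _ _ (expR ((q j - p j)%:R * (r - eta)) *
    (expR ((p j - Q q j)%:R * (r0 - eta)) * ((D0 * D1) ^+ j * zpA e A (Q q j))))).
    by rewrite !ler_pM2l ?expR_gt0.
  apply: (@le_trans _ _ (expR ((q j - p j)%:R * (r - eta)) *
    ((D0 * D1) ^+ j * (D0 * zpA e A (p j))))).
    rewrite ler_pM2l ?expR_gt0// mulrCA ler_pM2l//.
    by rewrite exprn_gt0// mulr_gt0.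
  rewrite exprSr; set P := (D0 * D1) ^+ j; set E1 := expR _.
  have -> : E1 * (P * (D0 * zpA e A (p j))) = P * D0 * (E1 * zpA e A (p j)) by ring.
  have -> : P * (D0 * D1) * zpA e A (q j) = P * D0 * (D1 * zpA e A (q j)) by ring.
  by rewrite ler_pM2l// mulr_gt0 ?exprn_gt0 ?mulr_gt0.
have QM : (Q q M <= n)%N.
  case: (M) pq => // m; move=> /(_ m (ltnSn _)) /andP[_ h]; exact: h.
have h := H0 A _ _ QM ltac:(by move=> i _ /=; exact: ge0).
have -> : n%:R * (r0 - eta) + (r - r0) * \sum_(i < M) (q i - p i)%:R =
  (n - Q q M)%:R * (r0 - eta) + ((Q q M)%:R * (r0 - eta) + (r - r0) * \sum_(i < M) (q i - p i)%:R).
  by rewrite natrB//; clear; move: (\sum_(i < M) _) => S; ring.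
rewrite expRD; apply: (@le_trans _ _ (expR ((n - Q q M)%:R * (r0 - eta)) *
   ((D0 * D1) ^+ M * zpA e A (Q q M)))); first by rewrite ler_pM2l ?expR_gt0// X.
set P := (D0 * D1) ^+ M; have P0 : 0 < P by rewrite exprn_gt0// mulr_gt0.
rewrite mulrCA (_ : D0 * P * _ = P * (D0 * zpA e A n)); last by ring.
by rewrite ler_pM2l.
Qed.

Lemma zrA_append e e' eta : 0 < eta -> exists2 C, 0 < C & forall A n n', (n <= n')%N ->
  (forall i, (n <= i < n')%N -> (pin e A i).1%:num <= e'%:num) ->
  zrA e A n' <= C * expR ((n' - n)%:R * (rate_inf e' + eta)) * zrA e A n.
Proof.
move=> eta0; have [C C0 HC] := zr_upper e' eta0; exists C => // A n n' nn H.
have nE : n' = (n + (n' - n))%N by rewrite subnKC.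
have := @ZR_cat R half (pin e A) n (n' - n)%N (ltW half_gt0).
rewrite -nE !zrAE => h; rewrite -lee_fin; apply: le_trans h _.
rewrite EFinM muleC lee_wpmul2r ?lee_fin ?zrA_ge0//.
apply: le_trans (HC _); rewrite -lee_fin -(zrE e' (n' - n)%N) -zrAE /ZR; apply: Jop_mono => [v|i]; first exact: eR_ge0.
rewrite add0n => /andP[_ im]; split => //=.
by apply: (H (n + i)%N); lia.
Qed.

Lemma zrA_blocks e eta (M : nat) : 0 < eta -> exists2 C, 0 < C &
  forall A B (c : nat -> nat), c 0%N = 0%N ->
    (forall j, (j < M)%N -> (c j <= c j.+1)%N) ->
    (forall j i, (j < M)%N -> ~~ B j -> (c j <= i < c j.+1)%N -> ~~ A i) ->
  zrA e A (c M) <= C * expR ((c M)%:R * (rate_inf 0%:nng + eta) +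
    (rate_inf e - rate_inf 0%:nng) * \sum_(j < M) (B j)%:R * (c j.+1 - c j)%:R).
Proof.
move=> eta0; have [C0 C00 H0] := zrA_append e 0%:nng eta0.
have [C1 C10 H1] := zrA_append e e eta0.
move: (rate_inf e) (rate_inf 0%:nng) H0 H1 => r r0 H0 H1; set C := C0 + C1.
have CC : 0 < C by exact: addr_gt0.
exists (C ^+ M) => [|A B c c0 cc cA]; first exact: exprn_gt0.
suff X j : (j <= M)%N -> zrA e A (c j) <= C ^+ j * expR ((c j)%:R * (r0 + eta) +
    (r - r0) * \sum_(i < j) (B i)%:R * (c i.+1 - c i)%:R) by exact: X.
elim: j => [|j IH] jM.
  by rewrite c0 big_ord0 mul0r mulr0 addr0 expR0 expr0 mul1r zrA0.
have {}IH := IH (ltnW jM); set S := \sum_(i < j) _ in IH *.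
have step : zrA e A (c j.+1) <= C * expR ((c j.+1 - c j)%:R * (r0 + (B j)%:R * (r - r0) + eta))
    * zrA e A (c j).
  have [Bj|Bj] := boolP (B j).
    apply: le_trans (H1 A _ _ (cc j jM) _) _ => [i _|].
      by rewrite /pin/=; case: (A i) => //; exact: ge0.
    rewrite ler_wpM2r ?zrA_ge0// mul1r (_ : r0 + (r - r0) = r); last by ring.
    by rewrite ler_wpM2r ?expR_ge0// lerDr ltW.
  apply: le_trans (H0 A _ _ (cc j jM) _) _ => [i ij|].
    by rewrite /pin (negbTE (cA _ _ jM Bj ij)).
  by rewrite ler_wpM2r ?zrA_ge0// mul0r addr0 ler_wpM2r ?expR_ge0// lerDl ltW.
have X0 : 0 <= C * expR ((c j.+1 - c j)%:R * (r0 + (B j)%:R * (r - r0) + eta)).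
  by rewrite mulr_ge0 ?expR_ge0// ltW.
apply: le_trans step (le_trans (ler_wpM2l X0 IH) _).
rewrite mulrACA -exprS -expRD big_ord_recr/= -/S le_eqVlt; apply/orP; left; apply/eqP.
congr (_ * expR _); rewrite natrB ?cc//; move: (B j)%:R => y; clear; ring.
Qed.

Lemma endfactor_le free k e eta : 0 < k -> 0 < eta -> exists2 C, 0 < C &
  forall N, (0 < N)%N -> endfactor free k e N <= C * expR (N%:R * eta).
Proof.
move=> k0 eta0; have [C C0 HC] := poly_le_expR 6 eta0.
have e0 : 0 <= e%:num by [].
have p0 : 0 < 2 * pi / k by rewrite divr_gt0// mulr_gt0 ?pi_gt0.
pose D := (e%:num + 1 + 2 * pi / k) ^+ 2 * (C * expR (2 * eta)).
have D0 : 0 < D by rewrite mulr_gt0 ?exprn_gt0 ?mulr_gt0 ?expR_gt0//; lra.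
exists (D + 1) => [|N N0]; first by rewrite addr_gt0.
have E1 : 1 <= expR (N%:R * eta) by rewrite -expR0 ler_expR mulr_ge0// ltW.
rewrite /endfactor; case: free; last first.
  by rewrite -[leLHS]mul1r ler_pM// lerDr ltW.
apply: le_trans (end_weight_le e k0 (ltn0Sn N.+1)) _.
apply: (@le_trans _ _ (D * expR (N%:R * eta))); last by rewrite ler_wpM2r ?expR_ge0// lerDl.
rewrite /D -[leRHS]mulrA; apply: ler_wpM2l; first exact: sqr_ge0.
rewrite -mulrA -expRD; apply: le_trans (HC _) _.
by rewrite ler_pM2l// ler_expR -addn2 natrD; lra.
Qed.

Lemma endfactor_ge0 free k e N : 0 <= endfactor free k e N.
Proof. by rewrite /endfactor; case: free => //; exact: sqr_ge0. Qed.

Lemma Zpin_blocks free e eta (M : nat) : 0 < eta -> (0 < M)%N -> exists2 C, 0 < C &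
  forall N A B, (0 < N)%N ->
    (forall j i, (j < M)%N -> ~~ B j -> (i < N)%N ->
       (j * N <= i.+1 * M <= j.+1 * N)%N -> ~~ A i) ->
  fine (Zpin free half (pin e A) N) <= C * expR (N%:R * (rate_inf 0%:nng + eta +
    (rate_inf e - rate_inf 0%:nng) * (M%:R^-1 * \sum_(j < M) (B j)%:R))).
Proof.
move=> eta0 M0; have eta2 : 0 < eta / 2 by rewrite divr_gt0.
have [C C0 HC] := zrA_blocks e M eta2.
have [D D0 HD] := endfactor_le free e half_gt0 eta2.
have rr0 : 0 <= rate_inf e - rate_inf 0%:nng by rewrite subr_ge0 rate_inf_ge.
move: (rate_inf e) (rate_inf 0%:nng) rr0 HC => r r0 rr0 HC.
exists (C * D * expR (- (r0 + eta / 2)) * expR (M%:R * (r - r0))) => [|N A B N0 HA].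
  by rewrite !mulr_gt0 ?expR_gt0.
have pinle i : (pin e A i).1%:num <= e%:num /\ (pin e A i).2%:num <= 1.
  by rewrite /pin /=; case: (A i) => /=; split => //; exact: ge0.
apply: (@le_trans _ _ (zrA e A N.-1 * endfactor free half e N)).
  rewrite -lee_fin fineK ?(Zpin_fin_num _ _ _ pinle)//.
  by rewrite EFinM -zrAE; exact: Zpin_le.
(* Cut points of the [M] blocks; the cap is there because the chain has only [N.-1] sites. *)
pose c j := minn ((j * N) %/ M) N.-1.
have cM : c M = N.-1 by rewrite /c mulKn//; apply/minn_idPr; exact: leq_pred.
have cle j : (c j <= c j.+1)%N.
  by rewrite /c leq_min geq_minr andbT geq_min leq_div2r// leq_mul2r leqnSn orbT.
have H := HC A B c _ (fun j _ => cle j) _; rewrite cM in H.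
have {}H := H ltac:(by rewrite /c mul0n div0n min0n).
have {}H := H _.
(* Rounding adds at most one site per block. *)
have sumle : \sum_(j < M) (B j)%:R * (c j.+1 - c j)%:R <=
    N%:R * (M%:R^-1 * \sum_(j < M) (B j)%:R) + M%:R :> R.
  have MR : 0 < M%:R :> R by rewrite ltr0n.
  rewrite mulrA mulr_sumr [X in _ + X](_ : _ = \sum_(j < M) 1); last by rewrite sumr_const card_ord.
  rewrite -big_split/=; apply: ler_sum => j _.
  case: (B j); rewrite ?mul0r ?mulr0 ?add0r ?mulr1 ?mul1r//.
  have : (c j.+1 - c j <= N %/ M + 1)%N.
    have := leq_divDl M (j * N) N.
    rewrite /c (_ : j.+1 * N = j * N + N)%N; last by rewrite mulSn addnC.
    by move: ((_ + N) %/ M)%N ((_ * N) %/ M)%N (N %/ M)%N => x y z; lia.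
  rewrite -(ler_nat R) => /le_trans; apply; rewrite natrD lerD2r.
  rewrite ler_pdivlMr// -natrM ler_nat; exact: leq_divM.
apply: (@le_trans _ _ (C * expR (N.-1%:R * (r0 + eta / 2) + (r - r0) *
    (N%:R * (M%:R^-1 * \sum_(j < M) (B j)%:R) + M%:R)) * (D * expR (N%:R * (eta / 2))))).
  apply: ler_pM (HD N N0); [exact: zrA_ge0|exact: endfactor_ge0|].
  apply: le_trans (H _) _.
    move=> j i jM Bj /andP[h1 h2].
    have iN : (i < N.-1)%N by apply: leq_trans h2 _; exact: geq_minr.
    apply: (HA j i jM Bj); first by lia.
    have h1' : ((j * N) %/ M <= i)%N by move: h1; rewrite /c geq_min; case/orP => //; lia.
    have h2' : (i.+1 <= (j.+1 * N) %/ M)%N by move: h2; rewrite /c leq_min => /andP[].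
    apply/andP; split; last by rewrite -leq_divRL.
    by apply: ltnW; rewrite -ltn_divLR.
  by rewrite ler_pM2l// ler_expR lerD2l ler_wpM2l.
have NE : N.-1%:R = N%:R - 1 :> R by rewrite -[N in RHS]prednK// -natr1 addrK.
rewrite NE; set S := M%:R^-1 * _.
have -> : C * D * expR (- (r0 + eta / 2)) * expR (M%:R * (r - r0)) *
   expR (N%:R * (r0 + eta + (r - r0) * S)) = C * D *
   (expR (- (r0 + eta / 2)) * expR (M%:R * (r - r0)) *
    expR (N%:R * (r0 + eta + (r - r0) * S))) by ring.
rewrite mulrACA -!expRD ler_pM2l ?mulr_gt0// ler_expR.
by move: S => S; clear; lra.
Qed.

Lemma Zpin_quarter_le free e : exists C K, 0 < C /\ forall N, (0 < N)%N ->
  fine (Zpin free 4^-1 (pin e predT) N) <= C * expR (N%:R * K).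
Proof.
have q0 : 0 < 4^-1 :> R by [].
have [D D0 HD] := endfactor_le free e q0 (ltr01 : 0 < 1 :> R).
have e0 : 0 <= e%:num by [].
pose B := 1 + e%:num + Num.sqrt (pi / 4^-1) : R.
have B1 : 1 <= B by rewrite /B -addrA lerDl addr_ge0// sqrtr_ge0.
have B0 : 0 < B by lra.
exists D, (ln B + 1); split => // N N0.
have pinle i : (pin e predT i).1%:num <= e%:num /\ (pin e predT i).2%:num <= 1 by [].
apply: (@le_trans _ _ (B ^+ N * endfactor free 4^-1 e N)).
  rewrite -lee_fin fineK ?(Zpin_fin_num _ _ _ pinle)//.
  apply: le_trans (Zpin_le _ N0 q0 pinle) _.
  have F0 := endfactor_ge0 free 4^-1 e N.
  rewrite EFinM lee_wpmul2r ?lee_fin//.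
  apply: le_trans (_ : (ZR _ _ _ <= (B ^+ N.-1)%:E)%E) _.
    apply: ZR_le => // i _; rewrite /= mul1r /B; lra.
  by rewrite lee_fin ler_weXn2l// leq_pred.
apply: (@le_trans _ _ (B ^+ N * (D * expR (N%:R * 1)))).
  by rewrite ler_pM2l ?exprn_gt0// HD.
rewrite -[X in X ^+ N](lnK (_ : B \is Num.pos)) ?posrE// -expRM_natl mulrCA.
by rewrite ler_pM2l// -expRD ler_expR mulrDr mulr1.
Qed.

End Blocks.

(** * Calculus on the unit interval *)

Section UnitInterval.
Context {R : realType}.
Notation mu := (@lebesgue_measure R).
Notation mR := (measurableTypeR R).
Notation I01 := (@I01 R).
Implicit Types (f g h phi : R -> R) (s t x : R).

Definition Int f : R := Rintegral mu I01 f.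
Definition int1 f : Prop := mu.-integrable I01 (EFin \o f : mR -> \bar R).
Definition bmf phi : Prop := measurable_fun (I01 : set mR) (phi : mR -> R) /\
  exists M, forall x, 0 <= x <= 1 -> `|phi x| <= M.

Lemma I01E x : I01 x = (0 <= x <= 1).
Proof. by rewrite /Defs.I01 /= in_itv. Qed.

Lemma in_I01 x : (x \in I01) = (0 <= x <= 1).
Proof. by rewrite /Defs.I01 mem_setE in_itv. Qed.

Lemma measurable_I01 : measurable (I01 : set mR).
Proof. exact: measurable_itv. Qed.
Hint Resolve measurable_I01 : core.

Lemma mu_I01 : mu I01 = 1%E.
Proof. by rewrite /Defs.I01 lebesgue_measure_itv/= lte_fin ltr01 oppr0 adde0. Qed.

Lemma int1_measurable f : int1 f -> measurable_fun (I01 : set mR) (f : mR -> R).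
Proof. by move=> /integrableP[/measurable_EFinP]. Qed.

Lemma bmf_int1 phi : bmf phi -> int1 phi.
Proof.
move=> [mp [M HM]]; apply: measurable_bounded_integrable => //.
  by apply: (@eq_ind_r _ 1%E (fun y => (y < +oo)%E) _ _ mu_I01); rewrite ltry.
exists M; split; first exact: num_real.
move=> y My x /=; rewrite I01E => /HM h; exact: le_trans h (ltW My).
Qed.

Lemma int1M phi f : bmf phi -> int1 f -> int1 (fun x => phi x * f x).
Proof.
move=> [mp [M HM]] fi; have := integrableMr measurable_I01 mp _ fi; apply.
exists M; split; first exact: num_real.
move=> y My x /=; rewrite I01E => /HM h; exact: le_trans h (ltW My).
Qed.

Lemma int1D f g : int1 f -> int1 g -> int1 (fun x => f x + g x).
Proof. by move=> fi gi; exact: (integrableD measurable_I01 fi gi). Qed.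

Lemma int1B f g : int1 f -> int1 g -> int1 (fun x => f x - g x).
Proof. by move=> fi gi; exact: (integrableB measurable_I01 fi gi). Qed.

Lemma int1Z c f : int1 f -> int1 (fun x => c * f x).
Proof. by move=> fi; exact: (integrableZl measurable_I01 c fi). Qed.

Lemma eq_int1 f g : (forall x, 0 <= x <= 1 -> f x = g x) -> int1 f -> int1 g.
Proof.
move=> fg; apply: eq_integrable => // x; rewrite in_I01 => /fg h /=.
by rewrite h.
Qed.

Lemma int1_norm f : int1 f -> int1 (fun x => `|f x|).
Proof. by move=> fi; exact: (integrable_norm fi). Qed.

Lemma le_int1 f g : measurable_fun (I01 : set mR) (f : mR -> R) -> int1 g ->
  (forall x, 0 <= x <= 1 -> `|f x| <= g x) -> int1 f.
Proof.
move=> mf gi fg; apply: (le_integrable measurable_I01 _ _ gi).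
  exact/measurable_EFinP.
move=> x; rewrite /= I01E => x01; rewrite lee_fin; apply: le_trans (fg x x01) _.
exact: ler_norm.
Qed.

Lemma eq_Int f g : (forall x, 0 <= x <= 1 -> f x = g x) -> Int f = Int g.
Proof. by move=> fg; apply: eq_Rintegral => x; rewrite in_I01 => /fg. Qed.

Lemma IntD f g : int1 f -> int1 g -> Int (fun x => f x + g x) = Int f + Int g.
Proof. by move=> fi gi; exact: (RintegralD measurable_I01 fi gi). Qed.

Lemma IntB f g : int1 f -> int1 g -> Int (fun x => f x - g x) = Int f - Int g.
Proof. by move=> fi gi; exact: (RintegralB measurable_I01 fi gi). Qed.

Lemma IntZ c f : int1 f -> Int (fun x => c * f x) = c * Int f.
Proof. by move=> fi; exact: (RintegralZl c measurable_I01 fi). Qed.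

Lemma Int_cst c : Int (fun=> c) = c.
Proof. by transitivity (c * fine (mu I01)); [exact: Rintegral_cst|rewrite mu_I01 mulr1]. Qed.

Lemma int1_0 : int1 (fun=> 0).
Proof. exact: integrable0. Qed.

Lemma int1_sum (I : Type) (r : seq I) (F : I -> R -> R) : (forall i, int1 (F i)) ->
  int1 (fun x => \sum_(i <- r) F i x).
Proof.
move=> Fi; elim: r => [|i r IH].
  by under eq_fun do rewrite big_nil; exact: int1_0.
by under eq_fun do rewrite big_cons; exact: int1D.
Qed.

Lemma Int_sum (I : Type) (r : seq I) (F : I -> R -> R) : (forall i, int1 (F i)) ->
  Int (fun x => \sum_(i <- r) F i x) = \sum_(i <- r) Int (F i).
Proof.
move=> Fi; elim: r => [|i r IH].
  by under eq_fun do rewrite big_nil; rewrite big_nil Int_cst.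
under eq_fun do rewrite big_cons; rewrite big_cons -IH; apply: IntD => //.
exact: int1_sum.
Qed.

Lemma le_Int f g : int1 f -> int1 g -> (forall x, 0 <= x <= 1 -> f x <= g x) ->
  Int f <= Int g.
Proof.
move=> fi gi fg; apply: (le_Rintegral measurable_I01 fi gi) => x.
by rewrite /= I01E => /fg.
Qed.

Lemma Int_ge0 f : (forall x, 0 <= x <= 1 -> 0 <= f x) -> 0 <= Int f.
Proof. by move=> f0; apply: Rintegral_ge0 => x; rewrite /= I01E => /f0. Qed.

Lemma normr_Int f : int1 f -> `|Int f| <= Int (fun x => `|f x|).
Proof. by move=> fi; exact: (le_normr_Rintegral measurable_I01 fi). Qed.

Lemma bmfD f g : bmf f -> bmf g -> bmf (fun x => f x + g x).
Proof.
move=> [mf [M HM]] [mg [M' HM']]; split; first exact: measurable_funD.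
by exists (M + M') => x x01; apply: le_trans (ler_normD _ _) (lerD (HM x x01) (HM' x x01)).
Qed.

Lemma bmfM f g : bmf f -> bmf g -> bmf (fun x => f x * g x).
Proof.
move=> [mf [M HM]] [mg [M' HM']]; split; first exact: measurable_funM.
by exists (M * M') => x x01; rewrite normrM ler_pM ?HM ?HM'.
Qed.

Lemma bmf_cst c : bmf (fun=> c).
Proof. by split; [exact: measurable_cst|exists `|c|]. Qed.

Lemma bmfZ c f : bmf f -> bmf (fun x => c * f x).
Proof. exact: bmfM (bmf_cst c). Qed.

Lemma bmfB f g : bmf f -> bmf g -> bmf (fun x => f x - g x).
Proof.
move=> bf bg; under eq_fun do rewrite -[- g _]mulN1r.
exact: bmfD bf (bmfZ _ bg).
Qed.

Lemma bmf_id : bmf id.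
Proof.
split; first exact: measurable_id.
by exists 1 => x /andP[x0 x1]; rewrite ger0_norm.
Qed.

Lemma bmf_sum (I : Type) (r : seq I) (F : I -> R -> R) : (forall i, bmf (F i)) ->
  bmf (fun x => \sum_(i <- r) F i x).
Proof.
move=> Fi; elim: r => [|i r IH].
  by under eq_fun do rewrite big_nil; exact: bmf_cst.
by under eq_fun do rewrite big_cons; exact: bmfD.
Qed.

Definition step t x : R := (x <= t)%R%:R.

Lemma step01 t x : 0 <= step t x <= 1.
Proof. by rewrite /step; case: (x <= t); rewrite ?lexx ?ler01. Qed.

Lemma bmf_step t : bmf (step t).
Proof.
split; last by exists 1 => x _; have /andP[h0 h1] := step01 t x; rewrite ger0_norm.
have -> : step t = fun x => if x <= t then 1 else 0.
  by apply/funext => x; rewrite /step; case: ifP.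
apply: measurable_funTS; apply: measurable_fun_ifT => //; exact: measurable_fun_ler.
Qed.

Lemma rampE t x : ramp t x = step t x * (t - x).
Proof.
rewrite /ramp /step; case: (leP x t) => xt; rewrite ?mul1r ?mul0r.
  by rewrite max_l// subr_ge0.
by rewrite max_r// subr_le0 ltW.
Qed.

Lemma bmf_ramp t : bmf (ramp t).
Proof.
have -> : ramp t = fun x => step t x * (t - x) by apply/funext => x; exact: rampE.
apply: bmfM (bmf_step t) _; exact: bmfB (bmf_cst t) bmf_id.
Qed.

Lemma itv_step t f : 0 <= t <= 1 -> Rintegral mu `[0, t] f = Int (fun x => step t x * f x).
Proof.
move=> /andP[t0 t1].
have -> : `[0, t]%classic = I01 `&` [set x | x <= t] :> set R.
  apply/seteqP; split => x /=; rewrite /Defs.I01 /= !in_itv/=.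
    by move=> /andP[x0 xt]; rewrite x0 (le_trans xt).
  by move=> [/andP[x0 x1] xt]; rewrite x0.
rewrite Rintegral_mkcondr; apply: eq_Rintegral => x _.
rewrite /restrict /step; case: ifPn => [/set_mem/= ->|]; first by rewrite mul1r.
by move=> /negP H; case: leP => xt; rewrite ?mul0r//; exfalso; apply: H; exact/mem_set.
Qed.

Lemma Int_steps s t : 0 <= s <= 1 -> 0 <= t <= 1 ->
  Int (fun x => step t x * step s x) = Num.min s t.
Proof.
move=> /andP[s0 s1] /andP[t0 t1].
have m0 : 0 <= Num.min s t by rewrite le_min s0.
have -> : (fun x => step t x * step s x) = (fun x => step (Num.min s t) x * 1).
  apply/funext => x; rewrite /step le_min mulr1.
  by case: (x <= s); case: (x <= t); rewrite ?mulr1 ?mulr0 ?mul0r.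
rewrite -itv_step ?m0 ?ge_min ?s1// //.
have mI : measurable (`[0, Num.min s t]%classic : set mR) by exact: measurable_itv.
transitivity (1 * fine (mu `[0, Num.min s t])); first exact: Rintegral_cst.
rewrite lebesgue_measure_itv/= lte_fin mul1r.
by case: ltP => /= h; [rewrite subr0|apply/eqP; rewrite eq_le m0 h].
Qed.

End UnitInterval.

(** * Taylor's formula with the ramp kernel, and square integrable functions *)

Section Kernel.
Context {R : realType}.
Notation mu := (@lebesgue_measure R).
Notation mR := (measurableTypeR R).
Notation I01 := (@I01 R).
Implicit Types (f g h phi : R -> R) (s t x u : R).
Hint Resolve measurable_I01 : core.

Lemma IntE f : int1 f -> (Int f)%:E = (\int[mu]_(x in I01) (f x)%:E)%E.
Proof. by move=> fi; rewrite fineK//; exact: integrable_fin_num. Qed.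

Lemma integral_restrict_I01 f :
  (\int[mu]_x ((f \_ I01) x)%:E = \int[mu]_(x in I01) (f x)%:E)%E.
Proof.
rewrite [RHS]integral_mkcond; apply: eq_integral => x _.
exact: (esym (congr1 (fun F => F x) (restrict_EFin f I01))).
Qed.

Lemma Int_step_between u t : 0 <= u <= 1 -> 0 <= t <= 1 ->
  Int (fun s => step t s * step s u) = ramp t u.
Proof.
move=> /andP[u0 u1] /andP[t0 t1].
have mI : measurable (`[u, t]%classic : set mR) by exact: measurable_itv.
transitivity (Rintegral mu (I01 `&` `[u, t]) (cst 1)).
  rewrite Rintegral_mkcondr; apply: eq_Rintegral => s _.
  rewrite /restrict /step mem_setE in_itv/= andbC.
  by case: (s <= t); case: (u <= s); rewrite ?mulr1 ?mulr0 ?mul0r.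
have -> : I01 `&` `[u, t] = `[u, t]%classic.
  apply/setIidPr => s; rewrite /= I01E in_itv/= => /andP[us st].
  by rewrite (le_trans u0)// (le_trans st).
transitivity (1 * fine (mu `[u, t])); first exact: Rintegral_cst.
rewrite lebesgue_measure_itv/= lte_fin mul1r /ramp.
case: ltP => ut/=; first by rewrite max_l// subr_ge0 ltW.
by rewrite max_r// subr_le0.
Qed.

Section Fubini.
Variables (g : R -> R) (t : R).
Hypotheses (gi : int1 g) (t01 : 0 <= t <= 1).

Let A : mR -> R := (step t) \_ I01.
Let gR : mR -> R := g \_ I01.
Let f (z : mR * mR) : \bar R := (A z.1 * step z.1 z.2 * gR z.2)%:E.

Let mA : measurable_fun [set: mR] A.
Proof. by apply/(measurable_restrictT _ measurable_I01); case: (bmf_step t). Qed.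

Let mgR : measurable_fun [set: mR] gR.
Proof. by apply/(measurable_restrictT _ measurable_I01); exact: int1_measurable. Qed.

Let mf : measurable_fun [set: (mR * mR)%type] f.
Proof.
apply/measurable_EFinP; apply: measurable_funM.
  apply: measurable_funM; first exact: measurableT_comp mA measurable_fst.
  have -> : (fun z : mR * mR => step z.1 z.2) = fun z => if z.2 <= z.1 then 1 else 0.
    by apply/funext => z; rewrite /step; case: ifP.
  by apply: measurable_fun_ifT => //; apply: measurable_fun_ler;
    [exact: measurable_snd|exact: measurable_fst].
exact: measurableT_comp mgR measurable_snd.
Qed.

Let FE s : (\int[mu]_u f (s, u) =
  (((fun s => step t s * Int (fun u => step s u * g u)) \_ I01) s)%:E)%E.
Proof.
have gs := int1M (bmf_step s) gi.
transitivity ((A s * Int (fun u => step s u * g u))%:E).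
  rewrite -IntZ// IntE; last exact: int1Z.
  rewrite -integral_restrict_I01; apply: eq_integral => u _.
  rewrite /f /gR /restrict/=; case: ifP => _; last by rewrite mulr0.
  by rewrite mulrA.
by rewrite /A /restrict; case: ifP; rewrite ?mul0r.
Qed.

Let GE u : (\int[mu]_s f (s, u) = (((fun u => ramp t u * g u) \_ I01) u)%:E)%E.
Proof.
rewrite /f /gR /restrict/=; case: ifPn => [|_]; last first.
  by under eq_integral do rewrite mulr0; rewrite integral0.
rewrite in_I01 => u01; rewrite mulrC -(Int_step_between u01 t01).
have b1 : bmf (fun s => step t s * step s u).
  apply: bmfM; first exact: bmf_step.
  have -> : step ^~ u = fun s => if u <= s then 1 else 0.
    by apply/funext => x; rewrite /step; case: ifP.
  split; last by exists 1 => x _; case: ifP; rewrite ?normr1 ?normr0.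
  by apply: measurable_funTS; apply: measurable_fun_ifT => //; exact: measurable_fun_ler.
have b2 := bmf_int1 b1.
rewrite -IntZ// IntE; last exact: int1Z.
rewrite -integral_restrict_I01; apply: eq_integral => s _.
rewrite /A /restrict/=; case: ifP => _; last by rewrite !mul0r.
by rewrite mulrC.
Qed.

Let fi : (mu \x mu)%E.-integrable setT f.
Proof.
have [_] := @integrable12ltyP _ _ mR mR R mu mu f mf; apply.
have gn := int1_norm gi; have t01' := step01 t.
apply: (@le_lt_trans _ _ (\int[mu]_x (((fun=> Int (fun u => `|g u|)) \_ I01) x)%:E)%E).
  apply: nonmeasurable_le_integral => [s|s]; first exact: integral_ge0.
  rewrite [in leRHS]patchE; case: ifPn => [sI|sI].
    rewrite IntE// -integral_restrict_I01; apply: nonmeasurable_le_integral => u//.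
    rewrite lee_fin /restrict /gR /A/= /restrict sI; case: ifP => _; last first.
      by rewrite mulr0 normr0.
    rewrite !normrM -[leRHS]mul1r ler_wpM2r// mulr_ile1//.
      by rewrite ger0_norm; case/andP: (step01 t s).
    by rewrite ger0_norm; case/andP: (step01 s u).
  under eq_integral do rewrite /f /A /restrict/= (negbTE sI) !mul0r normr0.
  by rewrite integral0.
rewrite integral_restrict_I01 -IntE ?ltry//.
exact: bmf_int1 (bmf_cst _).
Qed.

Lemma int1_primitive_step : int1 (fun s => step t s * Int (fun u => step s u * g u)).
Proof.
have := integrable_fubini_F fi; rewrite /fubini_F.
under eq_fun do rewrite FE.
move=> h; apply/(integrable_mkcond _ measurable_I01).
apply: eq_integrable h => // x _.
exact: (esym (congr1 (fun F => F x) (restrict_EFin _ I01))).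
Qed.

(** Fubini's theorem on the triangle [u <= s <= t], whose section at [u] has length [ramp t u]. *)
Lemma Int_primitive : Int (fun s => step t s * Int (fun u => step s u * g u)) =
  Int (fun u => ramp t u * g u).
Proof.
have := Fubini fi; under eq_integral do rewrite FE.
rewrite integral_restrict_I01 => H.
have E : (\int[mu]_u \int[mu]_s f (s, u) = \int[mu]_(u in I01) (ramp t u * g u)%:E)%E.
  by under eq_integral do rewrite GE; rewrite integral_restrict_I01.
by congr fine; exact: etrans H E.
Qed.

End Fubini.

Lemma int1_primitive g : int1 g -> int1 (fun s => Int (fun u => step s u * g u)).
Proof.
move=> gi.
have h := @int1_primitive_step g 1 gi.
apply: eq_int1 h => x /andP[_ x1]; by rewrite {1}/step x1 mul1r.
Qed.

Lemma Int_step t : 0 <= t <= 1 -> Int (step t) = t.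
Proof.
move=> t01; transitivity (Int (fun x => step t x * step t x)).
  by apply: eq_Int => x _; rewrite /step; case: (x <= t); rewrite ?mulr1 ?mulr0.
by rewrite Int_steps// minxx.
Qed.

Lemma Int_ramp t : 0 <= t <= 1 -> Int (ramp t) = t ^+ 2 / 2.
Proof.
move=> t01; have i1 : int1 (fun=> 1 : R) := bmf_int1 (bmf_cst 1).
have := @Int_primitive (fun=> 1) t i1 t01.
have -> : Int (fun s => step t s * Int (fun u => step s u * 1)) = Int (fun s => step t s * s).
  apply: eq_Int => s s01; congr (step t s * _); rewrite -[RHS](Int_step s01).
  by apply: eq_Int => u _; rewrite mulr1.
have -> : Int (fun u => ramp t u * 1) = Int (ramp t) by apply: eq_Int => u _; rewrite mulr1.
(* Fubini's theorem identifies the integral of the ramp with that of [s] over [[0, t]]; by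
   definition the two add up to [t ^ 2]. *)
have -> : Int (ramp t) = t * t - Int (fun s => step t s * s).
  have s1 : int1 (fun x => t * step t x) by apply: int1Z; exact: bmf_int1 (bmf_step _).
  have s2 := bmf_int1 (bmfM (bmf_step t) bmf_id).
  rewrite -[X in t * X - _](Int_step t01) -(IntZ t (bmf_int1 (bmf_step t))).
  rewrite -(IntB s1 s2); apply: eq_Int => x _; rewrite rampE; ring.
by move=> h; have := h; lra.
Qed.

Lemma Int_ramp_ge1 t : 1 <= t -> Int (ramp t) = t - 1 / 2.
Proof.
move=> t1; have E u : 1 <= u -> Int (ramp u) = u - Int id.
  move=> u1; rewrite -[X in X - _](Int_cst u).
  rewrite -(IntB (bmf_int1 (bmf_cst u)) (bmf_int1 bmf_id)).
  by apply: eq_Int => x /andP[_ x1]; rewrite rampE /step (le_trans x1)// mul1r.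
have := @Int_ramp 1; rewrite ler01 lexx => /(_ isT).
by rewrite E// E//; lra.
Qed.

Lemma ramp_le0 t x : t <= 0 -> 0 <= x -> ramp t x = 0.
Proof. by move=> t0 x0; rewrite /ramp max_r// subr_le0 (le_trans t0). Qed.

Definition L2 g : Prop := measurable_fun (I01 : set mR) (g : mR -> R) /\
  (\int[mu]_(x in I01) ((g x) ^+ 2)%:E < +oo)%E.

Lemma L2_int1_sqr g : L2 g -> int1 (fun x => g x ^+ 2).
Proof.
move=> [mg fg]; apply/integrableP; split.
  by apply/measurable_EFinP; exact: measurable_funX.
apply: le_lt_trans fg; rewrite le_eqVlt; apply/orP; left; apply/eqP.
by apply: eq_integral => x _ /=; rewrite ger0_norm// sqr_ge0.
Qed.

Lemma L2_int1 g : L2 g -> int1 g.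
Proof.
move=> g2; have s2 := L2_int1_sqr g2; case: g2 => mg _.
apply: (le_int1 (g := fun x => 1 + g x ^+ 2)) => //.
  by apply: int1D => //; exact: bmf_int1 (bmf_cst 1).
by move=> x _; rewrite ler_norml; apply/andP; split; nra.
Qed.

Lemma L2_M phi g : bmf phi -> L2 g -> L2 (fun x => phi x * g x).
Proof.
move=> bp g2; have [mg _] := g2; have [mp _] := bp.
split; first exact: measurable_funM.
have h := int1M (bmfM bp bp) (L2_int1_sqr g2).
have := integrableP _ _ _ h => -[_]; apply: le_lt_trans.
rewrite le_eqVlt; apply/orP; left; apply/eqP.
apply: eq_integral => x _ /=; rewrite ger0_norm; first by congr EFin; ring.
by rewrite mulr_ge0 ?sqr_ge0// -expr2 sqr_ge0.
Qed.

Lemma L2D f g : L2 f -> L2 g -> L2 (fun x => f x + g x).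
Proof.
move=> f2 g2; have [mf _] := f2; have [mg _] := g2.
split; first exact: measurable_funD.
have h : int1 (fun x => 2 * f x ^+ 2 + 2 * g x ^+ 2).
  by apply: int1D; apply: int1Z; exact: L2_int1_sqr.
have /integrableP[_] : int1 (fun x => (f x + g x) ^+ 2).
  apply: le_int1 h _; first by apply: measurable_funX; exact: measurable_funD.
  by move=> x _; rewrite ger0_norm ?sqr_ge0//; have := sqr_ge0 (f x - g x); nra.
apply: le_lt_trans; rewrite le_eqVlt; apply/orP; left; apply/eqP.
by apply: eq_integral => x _ /=; rewrite ger0_norm// sqr_ge0.
Qed.

Lemma bmf_L2 phi : bmf phi -> L2 phi.
Proof.
move=> bp; have [mp _] := bp; split=> //.
have /integrableP[_] := bmf_int1 (bmfM bp bp).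
apply: le_lt_trans; rewrite le_eqVlt; apply/orP; left; apply/eqP.
by apply: eq_integral => x _ /=; rewrite ger0_norm// -expr2 sqr_ge0.
Qed.

Lemma L2_int1M f g : L2 f -> L2 g -> int1 (fun x => f x * g x).
Proof.
move=> f2 g2; have [mf _] := f2; have [mg _] := g2.
have h : int1 (fun x => f x ^+ 2 + g x ^+ 2) by apply: int1D; exact: L2_int1_sqr.
apply: le_int1 h _; first exact: measurable_funM.
move=> x _; rewrite ler_norml; have := sqr_ge0 (f x - g x); have := sqr_ge0 (f x + g x).
by move=> *; apply/andP; split; nra.
Qed.

Lemma quadratic_discr (m b c : R) : 0 <= m -> (forall l, 0 <= c - 2 * l * b + l ^+ 2 * m) ->
  b ^+ 2 <= m * c.
Proof.
rewrite le_eqVlt => /predU1P[<-|m0] H.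
  have [->|b0] := eqVneq b 0; first by rewrite expr0n mul0r.
  have := H ((c + 1) / (2 * b)); rewrite mulr0 addr0.
  have -> : 2 * ((c + 1) / (2 * b)) * b = c + 1 by field.
  by lra.
have := H (b / m).
have -> : c - 2 * (b / m) * b + (b / m) ^+ 2 * m = (m * c - b ^+ 2) / m.
  by field; rewrite gt_eqF.
by rewrite pmulr_lge0 ?invr_gt0// subr_ge0.
Qed.

Lemma Int_CauchySchwarz K g : bmf K -> (forall x, 0 <= x <= 1 -> 0 <= K x) -> L2 g ->
  (Int (fun x => K x * g x)) ^+ 2 <= Int K * Int (fun x => K x * g x ^+ 2).
Proof.
move=> bK K0 g2; apply: quadratic_discr => [|l]; first exact: Int_ge0.
have g1 := int1M bK (L2_int1 g2); have gg := int1M bK (L2_int1_sqr g2).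
have k1 := bmf_int1 bK.
rewrite -IntZ// -IntZ// -IntB//; last exact: int1Z.
rewrite -IntD; last 2 first.
- by apply: int1B => //; exact: int1Z.
- exact: int1Z.
apply: Int_ge0 => x x01.
rewrite (_ : _ + _ = K x * (g x - l) ^+ 2); last by ring.
by rewrite mulr_ge0 ?sqr_ge0 ?K0.
Qed.

Section H2rep.
Variables (h h1 g : R -> R).
Hypothesis H : H2rep h h1 g.

Lemma H2rep_L2 : L2 g. Proof. by case: H => mg [fg _]. Qed.

Lemma H2rep_h1 t : 0 <= t <= 1 -> h1 t = h1 0 + Int (fun x => step t x * g x).
Proof.
move=> t01; case: H => _ [_ /(_ t)]; rewrite in_I01 => /(_ t01)[-> _].
by rewrite itv_step.
Qed.

Lemma H2rep_int1_h1 : int1 h1.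
Proof.
apply: (eq_int1 (f := fun t => h1 0 + Int (fun x => step t x * g x))).
  by move=> x x01; rewrite -H2rep_h1.
apply: int1D; first exact: bmf_int1 (bmf_cst _).
exact: int1_primitive (L2_int1 H2rep_L2).
Qed.

Lemma H2rep_h t : 0 <= t <= 1 -> h t = h 0 + Int (fun x => step t x * h1 x).
Proof.
move=> t01; case: H => _ [_ /(_ t)]; rewrite in_I01 => /(_ t01)[_ ->].
by rewrite itv_step.
Qed.

Lemma H2rep_kernel t : 0 <= t <= 1 ->
  h t = h 0 + h1 0 * t + Int (fun x => ramp t x * g x).
Proof.
move=> t01; have gi := L2_int1 H2rep_L2; rewrite H2rep_h// -addrA; congr (_ + _).
have -> : Int (fun x => step t x * h1 x) =
    Int (fun x => h1 0 * step t x + step t x * Int (fun u => step x u * g u)).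
  by apply: eq_Int => x x01; rewrite H2rep_h1//; ring.
rewrite IntD ?IntZ ?Int_step ?Int_primitive//.
- exact: bmf_int1 (bmf_step _).
- by apply: int1Z; exact: bmf_int1 (bmf_step _).
- exact: int1M (bmf_step _) (int1_primitive gi).
Qed.

End H2rep.

Lemma kernel_H2rep a al f g : L2 g ->
  (forall t, 0 <= t <= 1 -> f t = a + al * t + Int (fun x => ramp t x * g x)) ->
  let f1 t := al + Int (fun x => step t x * g x) in
  [/\ H2rep f f1 g, f 0 = a & f1 0 = al].
Proof.
move=> g2 fE f1; have gi := L2_int1 g2.
have z01 : 0 <= (0 : R) <= 1 by rewrite lexx ler01.
have f10 : f1 0 = al.
  rewrite /f1 -itv_step// set_itv1 Rintegral_set1; exact: addr0.
have f0 : f 0 = a.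
  rewrite fE// mulr0 addr0 (_ : Int _ = 0) ?addr0// -[RHS](Int_cst 0).
  by apply: eq_Int => x /andP[x0 _]; rewrite ramp_le0// mul0r.
split => //; case: (g2) => mg fg; split=> //; split => // t.
rewrite in_I01 => t01; rewrite f10 f0 !itv_step//; split => //.
rewrite fE// -addrA; congr (_ + _).
have -> : Int (fun x => step t x * f1 x) =
    Int (fun x => al * step t x + step t x * Int (fun u => step x u * g u)).
  by apply: eq_Int => x x01; rewrite /f1; ring.
rewrite IntD ?IntZ ?Int_step ?Int_primitive//.
- exact: bmf_int1 (bmf_step _).
- by apply: int1Z; exact: bmf_int1 (bmf_step _).
- exact: int1M (bmf_step _) (int1_primitive gi).
Qed.

(** The interval is half-open so that its indicator is exactly [step t - step s]. *)
Definition cutf s t f : R -> R := fun x => if s < x <= t then 0 else f x.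

Lemma cutfE s t f x : s <= t -> cutf s t f x = (1 - (step t x - step s x)) * f x.
Proof.
move=> st; rewrite /cutf /step; case: (leP x s) => xs/=.
  by rewrite (le_trans xs st) subrr subr0 mul1r.
by case: (x <= t); rewrite ?subr0 ?subrr ?mul0r// mul1r.
Qed.

Lemma bmf_cutf s t : bmf (fun x => 1 - (step t x - step s x)).
Proof. exact: bmfB (bmf_cst 1) (bmfB (bmf_step t) (bmf_step s)). Qed.

(** Removing the density between two zeros of its primitive removes a total increment 0, so the
    primitive is unchanged outside. Applied to the derivative and then to the function, this keeps
    the result in H^2. *)
Lemma cutf_primitive c F f s t' : int1 f ->
  (forall t, 0 <= t <= 1 -> F t = c + Int (fun x => step t x * f x)) ->
  0 <= s -> s <= t' -> t' <= 1 -> F s = 0 -> F t' = 0 ->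
  forall t, 0 <= t <= 1 ->
    cutf s t' F t = c + Int (fun x => step t x * cutf s t' f x).
Proof.
move=> fi FE s0 st t1 Fs Ft t t01.
have s01 : 0 <= s <= 1 by rewrite s0 (le_trans st).
have t01' : 0 <= t' <= 1 by rewrite (le_trans s0 st).
have fs u := int1M (bmf_step u) fi.
rewrite {1}/cutf; case: (leP t s) => ts /=.
  rewrite FE//; congr (_ + _); apply: eq_Int => x _; rewrite /step /cutf.
  by case: (leP x t) => xt; rewrite ?mul0r// ltNge (le_trans xt ts).
case: (leP t t') => tt.
  rewrite -Fs FE//; congr (_ + _); apply: eq_Int => x _; rewrite /step /cutf.
  case: (leP x s) => xs; first by rewrite (le_trans xs (ltW ts)).
  case: (leP x t) => xt /=; last by rewrite !mul0r.
  by rewrite (le_trans xt tt) mulr0 mul0r.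
transitivity (c + (Int (fun x => step t x * f x) - Int (fun x => step t' x * f x)
    + Int (fun x => step s x * f x))).
  have := FE _ t01'; have := FE _ s01; have := FE _ t01; rewrite Fs Ft.
  by move=> -> h2 h3; lra.
rewrite -IntB// -IntD//; last exact: int1B.
congr (_ + _); apply: eq_Int => x _; rewrite cutfE// /step.
case: (leP x s) => xs.
  by rewrite (le_trans xs st) (le_trans xs (ltW ts)); ring.
have f0 : false%:R = 0 :> R by [].
have tt1 : true%:R = 1 :> R by [].
case: (leP x t') => xt; first by rewrite (le_trans xt (ltW tt)) !f0 !tt1; ring.
by rewrite !f0; ring.
Qed.

Lemma H2rep_cut h h1 g s t : H2rep h h1 g -> 0 <= s -> s <= t -> t <= 1 ->
  (s < t -> [/\ h s = 0, h1 s = 0, h t = 0 & h1 t = 0]) ->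
  H2rep (cutf s t h) (cutf s t h1) (cutf s t g).
Proof.
move=> H s0; rewrite le_eqVlt => /predU1P[<- _ _|st t1 /(_ st)[hs h1s ht h1t]].
  have E f : cutf s s f = f.
    by apply/funext => x; rewrite /cutf; case: ltP => // sx; rewrite leNgt sx.
  by rewrite !E.
have g2 := H2rep_L2 H; have gi := L2_int1 g2.
have z01 : 0 <= (0 : R) <= 1 by rewrite lexx ler01.
have c0 f : cutf s t f 0 = f 0 by rewrite /cutf ltNge s0.
have -> : cutf s t g = fun x => (1 - (step t x - step s x)) * g x.
  by apply/funext => x; rewrite cutfE// ltW.
have [mg fg] := L2_M (bmf_cutf s t) g2.
split => //; split => // u; rewrite in_I01 => u01; rewrite !itv_step// !c0; split.
  rewrite (cutf_primitive gi (fun v => H2rep_h1 H (t := v)) s0 (ltW st) t1)//.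
  by congr (_ + _); apply: eq_Int => x _; rewrite cutfE// ltW.
by rewrite (cutf_primitive (H2rep_int1_h1 H) (fun v => H2rep_h H (t := v)) s0 (ltW st) t1).
Qed.

End Kernel.

(** * Discretized profiles *)

Section Discretization.
Context {R : realType}.
Implicit Types (f g F : R -> R) (a al s t u x d : R).

Lemma hat_ge0 x d u : 0 <= d -> 0 <= ramp (x - d) u - 2 * ramp x u + ramp (x + d) u.
Proof.
move=> d0; rewrite /ramp.
by case: (leP (x - d - u) 0); case: (leP (x - u) 0); case: (leP (x + d - u) 0); lra.
Qed.

(** The formula is used outside [[0, 1]] too, where it is affine: its values at [-1/N] and [1 + 1/N]
    are exactly the outer boundary values of the model. *)
Definition taylor a al g t : R := a + al * t + Int (fun u => ramp t u * g u).

Lemma taylor_lipschitz a al g t t' : int1 g ->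
  `|taylor a al g t - taylor a al g t'| <= (`|al| + Int (fun u => `|g u|)) * `|t - t'|.
Proof.
move=> gi; have ri s := int1M (bmf_ramp s) gi.
have -> : taylor a al g t - taylor a al g t' =
    al * (t - t') + Int (fun u => ramp t u * g u - ramp t' u * g u).
  by rewrite IntB// /taylor; ring.
apply: le_trans (ler_normD _ _) _; rewrite normrM mulrDl lerD2l.
apply: le_trans (normr_Int (int1B (ri t) (ri t'))) _.
rewrite mulrC -IntZ; last exact: int1_norm.
apply: le_Int; first exact: int1_norm (int1B (ri t) (ri t')).
  by apply: int1Z; exact: int1_norm.
by move=> u _; rewrite -mulrBl normrM ler_wpM2r// ramp_lip.
Qed.

(** The Peano kernel of the second difference with step [1/N], a tent around [j / N]. *)
Definition hat N j u : R := ramp ((j%:R - 1) / N%:R) u - 2 * ramp (j%:R / N%:R) u +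
  ramp ((j%:R + 1) / N%:R) u.

Lemma bmf_hat N j : bmf (hat N j).
Proof.
by apply: bmfD (bmf_ramp _); apply: bmfB (bmf_ramp _) _; exact: bmfZ (bmf_ramp _).
Qed.

Lemma hat_pos N j u : 0 <= hat N j u.
Proof.
rewrite /hat (_ : (j%:R - 1) / N%:R = j%:R / N%:R - N%:R^-1); last by rewrite mulrBl mul1r.
rewrite (_ : (j%:R + 1) / N%:R = j%:R / N%:R + N%:R^-1); last by rewrite mulrDl mul1r.
by apply: hat_ge0; rewrite invr_ge0.
Qed.

(** Interior tents have exactly this mass; the tents at 0 and [N] are cut by the ends of the
    interval and have half of it. *)
Lemma Int_hat N j : (0 < N)%N -> (j <= N)%N -> Int (hat N j) <= N%:R^-1 ^+ 2.
Proof.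
move=> N0 jN; have N0' : 0 < N%:R :> R by rewrite ltr0n.
set d := N%:R^-1 : R; have d0 : 0 < d by rewrite invr_gt0.
have d1 : d <= 1 by rewrite invf_le1// ler1n.
have Nd : N%:R * d = 1 :> R by rewrite divff ?gt_eqF.
have ri t := bmf_int1 (bmf_ramp t).
have E : Int (hat N j) = Int (ramp ((j%:R - 1) * d)) - 2 * Int (ramp (j%:R * d)) +
    Int (ramp ((j%:R + 1) * d)).
  by rewrite -IntZ// -IntB// -?IntD//; [apply: int1B => //|]; exact: int1Z.
have r0 t : t <= 0 -> Int (ramp t) = 0.
  move=> t0; rewrite -[RHS](Int_cst 0); apply: eq_Int => x /andP[x0 _].
  exact: ramp_le0.
rewrite E; have [->|j0] := posnP j.
  rewrite (r0 ((0 - 1) * d)); last by lra.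
  rewrite (r0 (0 * d)); last by rewrite mul0r.
  by rewrite Int_ramp; [nra|rewrite add0r mul1r ltW].
have j0' : 1 <= j%:R :> R by rewrite ler1n.
have jNR : j%:R <= N%:R :> R by rewrite ler_nat.
have jd : (j%:R - 1) * d <= 1 by rewrite -[leRHS]Nd ler_pM2r//; lra.
have jd0 : 0 <= (j%:R - 1) * d by rewrite mulr_ge0 ?(ltW d0)// subr_ge0.
have [->|jN'] := eqVneq j N.
  have -> : (N%:R - 1) * d = 1 - d by rewrite mulrBl Nd mul1r.
  have -> : (N%:R + 1) * d = 1 + d by rewrite mulrDl Nd mul1r.
  rewrite Nd Int_ramp; last by apply/andP; split; lra.
  rewrite Int_ramp ?ler01 ?lexx//.
  by rewrite Int_ramp_ge1; nra.
have jd1 : (j%:R + 1) * d <= 1.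
  by rewrite -[leRHS]Nd ler_pM2r// natr1 ler_nat ltn_neqAle jN'.
rewrite !Int_ramp; first by nra.
- by apply/andP; split; nra.
- by apply/andP; split; nra.
- by rewrite jd0.
Qed.

Lemma sum_hat N u : (0 < N)%N -> 0 <= u <= 1 -> \sum_(j < N.+1) hat N j u = N%:R^-1.
Proof.
move=> N0 /andP[u0 u1]; have N0' : 0 < N%:R :> R by rewrite ltr0n.
have H m : \sum_(j < m) hat N j u = ramp (m%:R / N%:R) u - ramp ((m%:R - 1) / N%:R) u.
  elim: m => [|m IH].
    have a1 : (0 - 1) / N%:R <= 0 :> R by rewrite sub0r mulN1r oppr_le0 invr_ge0.
    by rewrite big_ord0 mul0r (ramp_le0 (lexx 0) u0) (ramp_le0 a1 u0) subrr.
  have E1 : m.+1%:R - 1 = m%:R :> R by rewrite -natr1 addrK.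
  by rewrite big_ord_recr/= IH /hat E1 natr1; ring.
rewrite H -natr1 addrK divff ?gt_eqF// !rampE /step.
have -> : (u <= (N%:R + 1) / N%:R).
  by rewrite mulrDl divff ?gt_eqF// ler_wpDr// mul1r invr_ge0.
by rewrite u1 !mul1r; field; rewrite gt_eqF.
Qed.

Definition dfield a al g N : nat -> R :=
  fun i => N%:R ^+ 2 * taylor a al g ((i%:R - 1) / N%:R).

Lemma rho_dfield a al g N j : (0 < N)%N -> int1 g ->
  rho (dfield a al g N) j = N%:R ^+ 2 * Int (fun u => hat N j u * g u).
Proof.
move=> N0 gi; have N0' : N%:R != 0 :> R by rewrite pnatr_eq0 -lt0n.
have ri t := int1M (bmf_ramp t) gi.
have -> : Int (fun u => hat N j u * g u) = Int (fun u => ramp ((j%:R - 1) / N%:R) u * g u)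
   - 2 * Int (fun u => ramp (j%:R / N%:R) u * g u) +
   Int (fun u => ramp ((j%:R + 1) / N%:R) u * g u).
  rewrite -IntZ// -IntB//; last exact: int1Z.
  rewrite -IntD//; last by apply: int1B => //; exact: int1Z.
  by apply: eq_Int => u _; rewrite /hat; ring.
rewrite /rho /dfield /taylor.
have -> : (j.+1%:R - 1 : R) = j%:R by rewrite -natr1; ring.
have -> : (j.+2%:R - 1 : R) = j%:R + 1 by rewrite -natr1 -natr1; ring.
move: (Int _) (Int _) (Int _) => x y z.
by field.
Qed.

(** Sampling does not increase the energy: Cauchy-Schwarz with the tents as weights, which add up to
    the constant [1/N]. *)
Lemma qR_dfield a al g N : (0 < N)%N -> L2 g ->
  qR N.+1 (dfield a al g N) <= N%:R * Int (fun u => g u ^+ 2).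
Proof.
move=> N0 g2; have gi := L2_int1 g2; have gg := L2_int1_sqr g2.
have N0' : 0 < N%:R :> R by rewrite ltr0n.
have hi j := int1M (bmf_hat N j) gg.
apply: (@le_trans _ _ (\sum_(j < N.+1) N%:R ^+ 2 * Int (fun u => hat N j u * g u ^+ 2))).
  apply: ler_sum => j _; rewrite rho_dfield// exprMn.
  have CS := Int_CauchySchwarz (bmf_hat N j) (fun u _ => hat_pos N j u) g2.
  have Hh := Int_hat N0 (_ : (j <= N)%N); have {Hh} := Hh ltac:(by rewrite -ltnS).
  have I0 : 0 <= Int (fun u => hat N j u * g u ^+ 2).
    by apply: Int_ge0 => u _; rewrite mulr_ge0 ?hat_pos ?sqr_ge0.
  move=> Hh; have {}CS := le_trans CS (ler_wpM2r I0 Hh).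
  apply: (le_trans (ler_wpM2l _ CS)); first by rewrite !exprn_ge0.
  rewrite mulrA ler_wpM2r// exprVn le_eqVlt; apply/orP; left; apply/eqP.
  by field; rewrite gt_eqF.
rewrite -mulr_sumr -Int_sum//.
have -> : Int (fun u => \sum_(j < N.+1) hat N j u * g u ^+ 2) =
    N%:R^-1 * Int (fun u => g u ^+ 2).
  by rewrite -IntZ//; apply: eq_Int => u u01; rewrite -mulr_suml sum_hat.
rewrite mulrA le_eqVlt; apply/orP; left; apply/eqP.
by congr (_ * _); field; rewrite gt_eqF.
Qed.

Lemma profile_near N (f : nat -> R) F c (L : R) t : (0 < N)%N -> 0 <= t <= 1 ->
  (forall s t, 0 <= s <= 1 -> 0 <= t <= 1 -> `|F s - F t| <= L * `|s - t|) -> 0 <= L ->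
  (forall k, (k <= N)%N -> `|f k.+1 / N%:R ^+ 2 - F (k%:R / N%:R)| <= c) ->
  `|profile N f t - F t| <= c + L / N%:R.
Proof.
move=> N0 t01 FL L0 fc; have N0' : 0 < N%:R :> R by rewrite ltr0n.
have [k kN [/andP[k1 k2] ->]] := profile_cell f N0 t01.
set s := N%:R * t in k1 k2 *.
have X j : (j <= N)%N -> `|s - j%:R| <= 1 -> `|f j.+1 / N%:R ^+ 2 - F t| <= c + L / N%:R.
  move=> jN sj; apply: le_trans (ler_distD (F (j%:R / N%:R)) _ _) _.
  apply: lerD (fc _ jN) _; apply: le_trans (FL _ _ _ t01) _.
    by rewrite divr_ge0 ?(ltW N0')// ler_pdivrMr// mul1r ler_nat.
  apply: ler_wpM2l => //.
  have -> : j%:R / N%:R - t = (j%:R - s) / N%:R by rewrite /s; field; rewrite gt_eqF.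
  rewrite normrM distrC [`|_^-1|]ger0_norm ?invr_ge0//.
  by rewrite ler_piMl// invr_ge0.
have := X k (ltnW kN); have := X k.+1 kN.
rewrite !ler_norml -natr1; set A := f k.+1 / _; set B := f k.+2 / _.
have -> : ((k%:R + 1 - s) * f k.+1 + (s - k%:R) * f k.+2) / N%:R ^+ 2 =
  (k%:R + 1 - s) * A + (s - k%:R) * B by rewrite /A /B; field; rewrite gt_eqF.
rewrite -natr1 in k2; move: (c + _) => C; move: (F t) => y h1 h2.
have /andP[h11 h12] := h1 ltac:(by apply/andP; split; lra).
have /andP[h21 h22] := h2 ltac:(by apply/andP; split; lra).
by apply/andP; split; nra.
Qed.

End Discretization.

(** * Variational representation of the energy *)

Section L2limit.
Context {R : realType}.
Notation mu := (@lebesgue_measure R).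
Notation mR := (measurableTypeR R).
Notation I01 := (@I01 R).
Implicit Types (f g : R -> R) (x : R).
Hint Resolve measurable_I01 : core.

Let pw (i : nat) : R := 2^-1 ^+ i.
Let pw_gt0 i : 0 < pw i. Proof. by rewrite exprn_gt0. Qed.

(** Cauchy-Schwarz with the weights [2 ^ -i], whose sum over the range is the factor in front. *)
Lemma telescope_sqr_le (p : nat -> R) n m :
  (p (n + m)%N - p n) ^+ 2 <= 2 * (pw n - pw (n + m)) *
    \sum_(n <= i < n + m) (pw i)^-1 * (p i.+1 - p i) ^+ 2.
Proof.
elim: m => [|m IH]; first by rewrite addn0 big_geq// subrr expr0n mulr0.
rewrite addnS big_nat_recr ?leq_addr//=; set W := \sum_(_ <= _ < _) _ in IH *.
set d := p (n + m).+1 - p (n + m)%N.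
have -> : p (n + m).+1 - p n = (p (n + m)%N - p n) + d by rewrite /d; ring.
set S := p (n + m)%N - p n in IH *.
have hm : pw (n + m).+1 = pw (n + m) / 2 by rewrite /pw exprSr.
have c0 := pw_gt0 (n + m); set c := pw (n + m) in IH hm c0 *.
set A := 2 * (pw n - c) in IH *.
have A0 : 0 <= A.
  rewrite mulr_ge0// subr_ge0 /c /pw exprD ler_piMr ?exprn_ge0// exprn_ile1//.
  by rewrite invf_le1// ler1n.
have W0 : 0 <= W by apply: sumr_ge0 => i _; rewrite mulr_ge0 ?sqr_ge0 ?invr_ge0// ltW.
have -> : 2 * (pw n - pw (n + m).+1) = A + c by rewrite hm /A; field.
have h1 : c * c^-1 = 1 by rewrite divff ?gt_eqF.
have ci : 0 < c^-1 by rewrite invr_gt0.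
set x := A * (c^-1 * d ^+ 2); set y := c * W.
have x0 : 0 <= x by rewrite mulr_ge0// mulr_ge0 ?sqr_ge0// ltW.
have y0 : 0 <= y by rewrite mulr_ge0// ltW.
have xy : (S * d) ^+ 2 <= x * y.
  rewrite (_ : x * y = (A * W) * d ^+ 2); last first.
    by rewrite /x /y -[RHS]mulr1 -h1; ring.
  by rewrite exprMn ler_wpM2r ?sqr_ge0.
have key : 2 * (S * d) <= x + y.
  have [sd|sd] := leP (S * d) 0; first by lra.
  rewrite -(@ler_pXn2r _ 2) ?nnegrE//; try lra.
  by have := sqr_ge0 (x - y); nra.
rewrite (_ : (A + c) * (W + c^-1 * d ^+ 2) = A * W + x + y + d ^+ 2); last first.
  transitivity (A * W + A * (c^-1 * d ^+ 2) + c * W + c / c * d ^+ 2); first by ring.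
  by rewrite h1 mul1r.
by nra.
Qed.

Variable phi : nat -> R -> R.
Hypothesis phib : forall n, bmf (phi n).
Hypothesis phid : forall n, Int (fun x => (phi n.+1 x - phi n x) ^+ 2) <= 4^-1 ^+ n.

Let term (i : nat) x : \bar R := (2 * (pw i)^-1 * (phi i.+1 x - phi i x) ^+ 2)%:E.
Let U x : \bar R := (\sum_(0 <= i <oo) term i x)%E.

Let term_ge0 i x : (0 <= term i x)%E.
Proof. by rewrite lee_fin mulr_ge0 ?sqr_ge0// mulr_ge0// invr_ge0 ltW. Qed.

Let diffb i : bmf (fun x => 2 * (pw i)^-1 * (phi i.+1 x - phi i x) ^+ 2).
Proof.
by apply: bmfZ; exact: bmfM (bmfB (phib _) (phib _)) (bmfB (phib _) (phib _)).
Qed.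

Let mterm i : measurable_fun (I01 : set mR) (term i).
Proof. by apply/measurable_EFinP; case: (diffb i). Qed.

Let mU : measurable_fun (I01 : set mR) U.
Proof. by apply: ge0_emeasurable_sum => // i x _ _; exact: term_ge0. Qed.

Let intU : (\int[mu]_(x in I01) U x <= 4%:E)%E.
Proof.
rewrite integral_nneseries//.
apply: (@le_trans _ _ (\sum_(0 <= i <oo) (2 * pw i)%:E)%E).
  apply: lee_nneseries => i _; first by move=> *; apply: integral_ge0.
  rewrite -IntE; last exact: bmf_int1 (diffb i).
  rewrite lee_fin IntZ ?bmf_int1//; last first.
    by apply: bmf_int1; exact: bmfM (bmfB (phib _) (phib _)) (bmfB (phib _) (phib _)).
  have c0 : 0 <= 2 * (pw i)^-1 by rewrite mulr_ge0 ?invr_ge0// ltW.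
  apply: le_trans (ler_wpM2l c0 (phid i)) _.
  rewrite -mulrA ler_pM2l// ler_pdivrMl// -exprMn.
  by have -> : 2^-1 / 2 = 4^-1 :> R by field.
have S n : \sum_(0 <= i < n) 2 * pw i = 4 * (1 - pw n).
  elim: n => [|n IH]; first by rewrite big_geq// /pw expr0 subrr mulr0.
  by rewrite big_nat_recr//= IH /pw exprSr; field.
apply: lime_le; first by apply: is_cvg_nneseries => i _ _; rewrite lee_fin mulr_ge0// ltW.
apply: nearW => n; rewrite sumEFin S lee_fin.
by have := pw_gt0 n; lra.
Qed.

Let cvgU x : (U x < +oo)%E -> exists l : R, phi ^~ x @ \oo --> l /\
  forall n, (((l - phi n x) ^+ 2)%:E <= (pw n)%:E * U x)%E.
Proof.
move=> Ux; have U0 : (0 <= U x)%E by apply: nneseries_ge0 => i _ _; exact: term_ge0.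
have Ufin : U x \is a fin_num by rewrite ge0_fin_numE.
rewrite -(fineK Ufin); set u := fine (U x).
have u0 : 0 <= u by rewrite fine_ge0.
have W n m : 2 * \sum_(n <= i < n + m) (pw i)^-1 * (phi i.+1 x - phi i x) ^+ 2 <= u.
  have h := @nneseries_lim_ge R (term ^~ x) xpredT 0 (n + m)%N (fun i _ _ => term_ge0 i x).
  rewrite -lee_fin /u fineK//; apply: le_trans h.
  rewrite sumEFin lee_fin mulr_sumr [leRHS](big_cat_nat (n := n))//= ?leq_addr//.
  rewrite (eq_bigr (fun i => 2 / pw i * (phi i.+1 x - phi i x) ^+ 2)); last first.
    by move=> i _; rewrite mulrA.
  rewrite lerDr sumr_ge0// => i _.
  by have := term_ge0 i x; rewrite lee_fin.
have D n m : (phi (n + m)%N x - phi n x) ^+ 2 <= pw n * u.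
  have := @telescope_sqr_le (fun i => phi i x) n m; have := W n m.
  set w := \sum_(_ <= _ < _) _ => wu H; apply: le_trans H _.
  have w0 : 0 <= w.
    by apply: sumr_ge0 => i _; rewrite mulr_ge0 ?sqr_ge0 ?invr_ge0// ltW.
  rewrite (_ : 2 * (pw n - pw (n + m)) * w = (pw n - pw (n + m)) * (2 * w)); last by ring.
  apply: ler_pM => //; last by rewrite lerBlDr lerDl ltW.
    rewrite subr_ge0 /pw exprD ler_piMr ?exprn_ge0// exprn_ile1//.
    by rewrite invf_le1// ler1n.
  by rewrite mulr_ge0.
have pw0 : pw @ \oo --> 0.
  by apply: cvg_expr; rewrite ger0_norm// invf_lt1// ltr1n.
have cv : cvg (phi ^~ x @ \oo).
  apply/cauchy_cvgP/cauchy_exP => e e0.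
  have e2 : 0 < e ^+ 2 / (u + 1) by rewrite divr_gt0 ?exprn_gt0//; lra.
  have /cvgrPdist_lt/(_ _ e2)[n0 _ Hn0] := pw0.
  have {Hn0} := Hn0 n0 (leqnn n0); rewrite /= sub0r normrN gtr0_norm// => Hn0.
  exists (phi n0 x), n0 => // m /= nm; rewrite -ball_normE /ball_/=.
  rewrite -(@ltr_pXn2r _ 2) ?nnegrE ?(ltW e0)// real_normK ?num_real//.
  rewrite -sqrrN opprB -{1}(subnKC nm); apply: le_lt_trans (D _ _) _.
  have : pw n0 * (u + 1) < e ^+ 2 by rewrite -ltr_pdivlMr//; lra.
  by have := pw_gt0 n0; nra.
exists (lim (phi ^~ x @ \oo)); split => // n.
rewrite -EFinM lee_fin.
have C : (fun m => (phi (n + m)%N x - phi n x) ^+ 2) @ \oo -->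
    (lim (phi ^~ x @ \oo) - phi n x) ^+ 2.
  have C1 : (fun m => phi (n + m)%N x - phi n x) @ \oo --> lim (phi ^~ x @ \oo) - phi n x.
    apply: cvgB; last exact: cvg_cst.
    have -> : (fun m => phi (n + m)%N x) = [sequence (phi ^~ x) (m + n)%N]_m.
      by apply/funext => m; rewrite addnC.
    apply: (@cvg_comp _ _ _ (fun m => (m + n)%N) (phi ^~ x) _ \oo); last exact: cv.
    exact: cvg_addnr.
  by under eq_fun do rewrite expr2; rewrite expr2; exact: cvgM.
rewrite -(cvg_lim (@Rhausdorff R) C); apply: limr_le; first by apply/cvg_ex; eexists; exact: C.
exact: nearW.
Qed.

(** Completeness of L^2 along a fast sequence. The weighted sum [U] of squared increments has
    integral at most 4; where it is finite the sequence converges pointwise with squared error at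
    most [2 ^ -n * U], and elsewhere the limit is set to 0. *)
Lemma L2_limit : exists2 g, L2 g & forall n, Int (fun x => (g x - phi n x) ^+ 2) <= 4 * pw n.
Proof.
have /choice[g Hg] : forall x, exists l, ((U x < +oo)%E -> phi ^~ x @ \oo --> l /\
  forall n, ((l - phi n x) ^+ 2)%:E <= (pw n)%:E * U x)%E /\ (~~ (U x < +oo)%E -> l = 0).
  move=> x; have [Ux|Ux] := boolP (U x < +oo)%E; last by exists 0.
  by have [l Hl] := cvgU Ux; exists l.
have mg : measurable_fun (I01 : set mR) g.
  apply: (@measurable_fun_cvg _ _ _ _ (fun n x => if (U x < +oo)%E then phi n x else 0)).
    move=> n; apply: measurable_fun_if => //.
    - exact: measurable_I01.
    - by apply: measurable_fun_lte => //; exact: measurable_cst.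
    - by apply: measurable_funS (phib n).1 => //; exact: subIsetl.
  move=> x Dx; have [h1 h2] := Hg x; have [Ux|Ux] := boolP (U x < +oo)%E.
    by case: (h1 Ux).
  by rewrite h2//; exact: cvg_cst.
have gU n x : (((g x - phi n x) ^+ 2)%:E <= (pw n)%:E * U x)%E.
  have [h1 h2] := Hg x; have [Ux|] := boolP (U x < +oo)%E; first by case: (h1 Ux).
  by rewrite ltey negbK => /eqP ->; rewrite gt0_muley ?leey// lte_fin.
have iU n : (\int[mu]_(x in I01) ((g x - phi n x) ^+ 2)%:E <= (4 * pw n)%:E)%E.
  apply: (@le_trans _ _ (\int[mu]_(x in I01) ((pw n)%:E * U x))%E).
    apply: ge0_le_integral => //.
    - by move=> x _; rewrite lee_fin sqr_ge0.
    - apply/measurable_EFinP; apply: measurable_funX; apply: measurable_funB => //.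
      by case: (phib n).
    - by apply: measurable_funeM.
  rewrite ge0_integralZl//; last by rewrite lee_fin ltW.
    rewrite mulrC EFinM; apply: lee_wpmul2l; [by rewrite lee_fin ltW|exact: intU].
  by move=> x _; exact: nneseries_ge0.
have gn n : L2 (fun x => g x - phi n x).
  split; first by apply: measurable_funB => //; case: (phib n).
  by apply: le_lt_trans (iU n) _; rewrite ltry.
exists g => [|n].
  have := L2D (gn 0%N) (bmf_L2 (phib 0%N)).
  by under eq_fun do rewrite subrK.
by rewrite -lee_fin IntE ?iU//; exact: L2_int1_sqr (gn n).
Qed.

End L2limit.

(** * From bounded tilts to an H^2 function *)

Section Representation.
Context {R : realType}.
Implicit Types (f g : R -> R) (x t : R).
Variables (a al b be : R) (free : bool).
Notation test := (@test R).
Notation Lam := (Lam a al b be).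
Notation ok := (test_ok free).
Implicit Types (k : test).

Lemma bmf_kern k : bmf (kern k).
Proof.
apply: bmfD; first apply: bmfD.
- exact: bmf_cst.
- by apply: bmfZ; exact: bmfB (bmf_cst 1) bmf_id.
- by apply: bmf_sum => p; apply: bmfZ; exact: bmf_ramp.
Qed.

Lemma ramp_lipr t x y : `|ramp t x - ramp t y| <= `|x - y|.
Proof.
rewrite /ramp; have := ler_norm (x - y); have := ler_norm (y - x).
rewrite -(distrC x y); case: (leP (t - x) 0); case: (leP (t - y) 0) => h1 h2 h3 h4.
- by rewrite subrr normr0.
- by rewrite ler_norml; apply/andP; split; lra.
- by rewrite ler_norml; apply/andP; split; lra.
- by rewrite ler_norml; apply/andP; split; lra.
Qed.

Lemma kern_lip k : exists2 L, 0 <= L & forall x y, `|kern k x - kern k y| <= L * `|x - y|.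
Proof.
exists (`|tc1 k| + tnorm k) => [|x y].
  by rewrite addr_ge0// sumr_ge0.
have -> : kern k x - kern k y = tc1 k * (y - x) +
    \sum_(p <- tcs k) p.1 * (ramp p.2 x - ramp p.2 y).
  under eq_bigr do rewrite mulrBr; rewrite sumrB /kern; ring.
apply: le_trans (ler_normD _ _) _; rewrite mulrDl normrM [`|y - x|]distrC lerD2l.
rewrite /tnorm mulr_suml; apply: le_trans (ler_norm_sum _ _ _) _.
by apply: ler_sum => p _; rewrite normrM ler_wpM2l// ramp_lipr.
Qed.

Lemma riemann_sum_le F L N : (0 < N)%N -> bmf F -> (forall x, 0 <= x <= 1 -> 0 <= F x) ->
  0 <= L ->
  (forall x y, 0 <= x <= 1 -> 0 <= y <= 1 -> `|F x - F y| <= L * `|x - y|) ->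
  N%:R^-1 * \sum_(j < N.+1) F (j%:R / N%:R) <= Int F + N%:R^-1 * (L + F 1).
Proof.
move=> N0 bF F0 L0 FL; have N0' : 0 < N%:R :> R by rewrite ltr0n.
set d := N%:R^-1 : R; have d0 : 0 < d by rewrite invr_gt0.
have Nd : N%:R * d = 1 :> R by rewrite divff ?gt_eqF.
pose s (j : nat) : R := j%:R * d.
have s01 j : (j <= N)%N -> 0 <= s j <= 1.
  move=> jN; rewrite /s mulr_ge0 ?(ltW d0)//= -[leRHS]Nd ler_pM2r// ler_nat.
  exact: jN.
pose chi j x : R := step (s j.+1) x - step (s j) x.
have bchi j : bmf (chi j) by exact: bmfB (bmf_step _) (bmf_step _).
have sj j : s j.+1 = s j + d by rewrite /s -natr1; ring.
have chi_in j x : chi j x = (s j < x <= s j.+1)%R%:R.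
  rewrite /chi /step; case: (leP x (s j)) => h /=; last by rewrite subr0.
  by rewrite (le_trans h) ?subrr// sj lerDl ltW.
have chi0 j x : 0 <= chi j x by rewrite chi_in ler0n.
have Ic j : (j < N)%N -> Int (chi j) = d.
  move=> jN; rewrite IntB ?bmf_int1//; [|exact: bmf_int1 (bmf_step _)|exact: bmf_int1 (bmf_step _)].
  by rewrite !Int_step ?s01 ?(ltnW jN)// sj; ring.
have bcF j := bmf_int1 (bmfM (bchi j) bF).
have low j : (j < N)%N -> d * (F (s j) - L * d) <= Int (fun x => chi j x * F x).
  move=> jN; rewrite mulrC -[X in _ * X <= _](Ic j jN) -IntZ; last exact: bmf_int1 (bchi j).
  apply: le_Int => //; first by apply: int1Z; exact: bmf_int1 (bchi j).
  move=> x x01; rewrite mulrC chi_in.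
  have [/andP[sx xs]|_] := boolP (s j < x <= s j.+1); last by rewrite /= !mul0r.
  rewrite !mul1r lerBlDr -lerBlDl.
  apply: le_trans (ler_norm _) _; apply: le_trans (FL _ _ (s01 _ (ltnW jN)) x01) _.
  apply: ler_wpM2l => //; rewrite distrC gtr0_norm ?subr_gt0// lerBlDl.
  by rewrite -sj.
have sumchi m x : \sum_(j < m) chi j x = step (s m) x - step (s 0%N) x.
  elim: m => [|m IH]; first by rewrite big_ord0 subrr.
  by rewrite big_ord_recr/= IH /chi; ring.
have up : \sum_(j < N) Int (fun x => chi j x * F x) <= Int F.
  rewrite -Int_sum//; apply: le_Int; [exact: int1_sum|exact: bmf_int1|move=> x x01].
  rewrite -mulr_suml sumchi ler_piMl ?F0//.
  have /andP[_ h1] := step01 (s N) x; have /andP[h0 _] := step01 (s 0%N) x.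
  by lra.
(* The node [j = N] has no cell to its right; it accounts for the term [F 1]. *)
rewrite big_ord_recr/= divff ?gt_eqF// mulrDr [d * (L + _)]mulrDr addrA lerD2r.
apply: le_trans (lerD up (lexx (d * L))).
rewrite mulr_sumr -lerBlDr.
have -> : d * L = \sum_(j < N) d * (L * d).
  rewrite sumr_const card_ord -mulr_natl; transitivity (N%:R * d * (L * d)).
    by rewrite Nd mul1r mulrC.
  by rewrite mulrA.
rewrite -sumrB; apply: ler_sum => j _.
by rewrite -mulrBr; exact: low.
Qed.

Lemma ksq_le k B : Int (fun x => kern k x ^+ 2) < B -> \forall N \near \oo, ksq k N <= B.
Proof.
move=> kB; have [L L0 HL] := kern_lip k; have bk := bmf_kern k; have [_ [M HM]] := bk.
have M0 : 0 <= M by apply: le_trans (HM 0 _) => //; rewrite lexx ler01.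
pose F x := kern k x ^+ 2.
have bF : bmf F by exact: bmfM.
have FL x y : 0 <= x <= 1 -> 0 <= y <= 1 -> `|F x - F y| <= 2 * M * L * `|x - y|.
  move=> x01 y01; rewrite /F subr_sqr normrM mulrC -mulrA; apply: ler_pM => //.
  apply: le_trans (ler_normD _ _) _; have := HM _ x01; have := HM _ y01; lra.
have e0 : 0 < B - Int F by rewrite subr_gt0.
near=> N; have N0 : (0 < N)%N by near: N; exact: nbhs_infty_gt.
have C0 : 0 <= 2 * M * L by rewrite !mulr_ge0.
apply: le_trans (riemann_sum_le N0 bF (fun x _ => sqr_ge0 _) C0 FL) _.
rewrite -lerBrDl; near: N; exact: near_inv_mul_le.
Unshelve. all: by end_near. Qed.

Lemma Int_CauchySchwarz2 f g : L2 f -> L2 g ->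
  (Int (fun x => f x * g x)) ^+ 2 <= Int (fun x => f x ^+ 2) * Int (fun x => g x ^+ 2).
Proof.
move=> f2 g2; have ff := L2_int1_sqr f2; have gg := L2_int1_sqr g2.
have fg := L2_int1M f2 g2.
apply: quadratic_discr => [|l]; first by apply: Int_ge0 => x _; exact: sqr_ge0.
rewrite -IntZ// -IntZ// -IntB//; last exact: int1Z.
rewrite -IntD; [|by apply: int1B => //; exact: int1Z|exact: int1Z].
apply: Int_ge0 => x _.
by rewrite (_ : _ + _ = (g x - l * f x) ^+ 2) ?sqr_ge0//; ring.
Qed.

Definition tadd (s : R) k1 k2 : test := Test (tc0 k1 + s * tc0 k2) (tc1 k1 + s * tc1 k2)
  (tcs k1 ++ [seq (s * p.1, p.2) | p <- tcs k2]).

Lemma kern_tadd s k1 k2 x : kern (tadd s k1 k2) x = kern k1 x + s * kern k2 x.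
Proof.
rewrite /kern/= big_cat/= big_map/=; under [X in _ + (_ + X) = _]eq_bigr do rewrite -mulrA.
by rewrite -mulr_sumr; ring.
Qed.

Lemma Lam_tadd s k1 k2 f : Lam (tadd s k1 k2) f = Lam k1 f + s * Lam k2 f.
Proof.
rewrite /Lam/= big_cat/= big_map/=; under [X in _ + (_ + X) = _]eq_bigr do rewrite -mulrA.
by rewrite -mulr_sumr; ring.
Qed.

Lemma ok_tadd s k1 k2 : ok k1 -> ok k2 -> ok (tadd s k1 k2).
Proof.
move=> [f1 a1] [f2 a2]; split => [fr|] /=.
  by have [-> ->] := f1 fr; have [-> ->] := f2 fr; rewrite !mulr0 !addr0.
by rewrite all_cat a1/= all_map.
Qed.

Lemma bmf_sqr F : bmf F -> bmf (fun x => F x ^+ 2).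
Proof. by move=> bF; exact: bmfM. Qed.

(* The kernels of almost maximal tests are a Cauchy sequence in L^2; their limit
   represents the functional [Lam] by the Euler-Lagrange equation. *)
Lemma Lam_representation f E :
  (forall k, ok k -> Lam k f - 2^-1 * Int (fun x => kern k x ^+ 2) <= E) ->
  exists g, [/\ L2 g, 2^-1 * Int (fun x => g x ^+ 2) <= E &
    forall k, ok k -> Lam k f = Int (fun x => g x * kern k x)].
Proof.
move=> HE; pose J k := Lam k f - 2^-1 * Int (fun x => kern k x ^+ 2).
have ok0 : ok (Test 0 0 [::] : test) by [].
pose A := [set J k | k in ok].
have supA : has_sup A.
  by split; [exists (J (Test 0 0 [::])), (Test 0 0 [::])|exists E => _ [k okk <-]; exact: HE].
set S := sup A.
have JS k : ok k -> J k <= S by move=> okk; apply: ub_le_sup; [case: supA|exists k].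
(* With the factor 1/8 the squared distance of consecutive kernels is at most [4 ^ -n], as
   [L2_limit] requires. *)
pose ep (n : nat) : R := 8^-1 * 4^-1 ^+ n.
have ep0 n : 0 < ep n by rewrite mulr_gt0// exprn_gt0.
have /choice[K HK] : forall n, exists k, ok k /\ S - ep n < J k.
  by move=> n; have [_ [k okk <-] h] := sup_adherent (ep0 n) supA; exists k.
have okK n : ok (K n) by case: (HK n).
have ik k : int1 (fun x => kern k x ^+ 2) := bmf_int1 (bmf_sqr (bmf_kern k)).
have ikk k k' : int1 (fun x => kern k x * kern k' x).
  by exact: bmf_int1 (bmfM (bmf_kern k) (bmf_kern k')).
(* Approximate Euler-Lagrange equation: moving by [l] in the direction [k] gains at most [ep n], a
   quadratic inequality in [l] whose discriminant gives the claim. *)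
have EL n k : ok k -> (Lam k f - Int (fun x => kern (K n) x * kern k x)) ^+ 2 <=
    2 * ep n * Int (fun x => kern k x ^+ 2).
  move=> okk; set d := _ - _; set m := Int _.
  have m0 : 0 <= m by apply: Int_ge0 => x _; exact: sqr_ge0.
  have Q := @quadratic_discr _ m d (2 * ep n) m0; rewrite [leRHS]mulrC; apply: Q => l.
  have := JS _ (ok_tadd l (okK n) okk); have [_] := HK n; rewrite /J Lam_tadd.
  have -> : Int (fun x => kern (tadd l (K n) k) x ^+ 2) = Int (fun x => kern (K n) x ^+ 2) +
      2 * l * Int (fun x => kern (K n) x * kern k x) + l ^+ 2 * m.
    rewrite -!IntZ// -!IntD//; [|by apply: int1D => //; exact: int1Z|exact: int1Z|exact: int1Z].
    by apply: eq_Int => x _; rewrite kern_tadd; ring.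
  rewrite /d; move: (Int _) (Int _) (Lam _ _) (Lam _ _) m {m0} => p q u v m; lra.
have CD n : Int (fun x => (kern (K n.+1) x - kern (K n) x) ^+ 2) <= 4^-1 ^+ n.
  pose D := tadd (-1) (K n.+1) (K n).
  have okD : ok D by exact: ok_tadd.
  have kD x : kern D x = kern (K n.+1) x - kern (K n) x by rewrite kern_tadd mulN1r.
  have := EL n D okD; have := EL n.+1 D okD.
  have -> : Int (fun x => (kern (K n.+1) x - kern (K n) x) ^+ 2) = Int (fun x => kern D x ^+ 2).
    by apply: eq_Int => x _; rewrite kD.
  have dE : Int (fun x => kern D x ^+ 2) = Int (fun x => kern (K n.+1) x * kern D x) -
     Int (fun x => kern (K n) x * kern D x).
    by rewrite -IntB//; apply: eq_Int => x _; rewrite -mulrBl -kD.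
  have d0 : 0 <= Int (fun x => kern D x ^+ 2) by apply: Int_ge0 => x _; exact: sqr_ge0.
  have en : ep n.+1 <= ep n.
    by rewrite /ep exprS ler_wpM2l// ler_piMl ?exprn_ge0// invf_le1// ler1n.
  have e8 : 4^-1 ^+ n = 8 * ep n by rewrite /ep; field.
  rewrite e8; move: dE d0 (ep0 n) (ep0 n.+1) en; move: (ep n) (ep n.+1) (Lam D f).
  move: (Int _) (Int _) (Int _) => q p d e e' l dE d0 e0 e'0 ee h1 h2.
  have [->|dn0] := eqVneq d 0; first by lra.
  have dp : 0 < d by rewrite lt_neqAle eq_sym dn0.
  rewrite -(ler_pM2r dp); have : d * d <= 2 * ((l - p) ^+ 2 + (l - q) ^+ 2).
    by rewrite {1 2}dE; have := sqr_ge0 (l - p + (l - q)); nra.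
  nra.
have [g g2 Hg] := L2_limit (fun n => bmf_kern (K n)) CD.
have gn n : L2 (fun x => g x - kern (K n) x).
  have := L2D g2 (bmf_L2 (bmfZ (-1) (bmf_kern (K n)))).
  by under eq_fun do rewrite mulN1r.
have pw0 (c : R) e : 0 < e -> exists n, c * 2^-1 ^+ n <= e.
  move=> e0; have /cvgrPdist_le/(_ e e0)[n _ /(_ n (leqnn n))] :
      (fun n => c * 2^-1 ^+ n) @ \oo --> (0 : R).
    rewrite -[X in _ --> X](mulr0 c); apply: cvgM; first exact: cvg_cst.
    by apply: cvg_expr; rewrite ger0_norm// invf_lt1// ltr1n.
  by rewrite sub0r normrN => h; exists n; exact: le_trans (ler_norm _) h.
have rep k : ok k -> Lam k f = Int (fun x => g x * kern k x).
  move=> okk; apply/eqP; rewrite -subr_eq0 -sqrf_eq0 eq_le sqr_ge0 andbT.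
  set m := Int (fun x => kern k x ^+ 2).
  have m0 : 0 <= m by apply: Int_ge0 => x _; exact: sqr_ge0.
  apply/ler_addgt0Pl => e e0; rewrite addr0; have [n] := pw0 (9 * m) e e0; apply: le_trans.
  have CS := Int_CauchySchwarz2 (gn n) (bmf_L2 (bmf_kern k)).
  have {}CS := le_trans CS (ler_wpM2r m0 (Hg n)); have e1 := EL n k okk.
  have ikg : int1 (fun x => g x * kern k x) := L2_int1M g2 (bmf_L2 (bmf_kern k)).
  have E1 : Int (fun x => (g x - kern (K n) x) * kern k x) =
     Int (fun x => g x * kern k x) - Int (fun x => kern (K n) x * kern k x).
    by rewrite -IntB//; apply: eq_Int => x _; rewrite mulrBl.
  rewrite E1 in CS; have p2 : ep n <= 8^-1 * 2^-1 ^+ n.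
    by rewrite /ep ler_wpM2l// lerXn2r ?nnegrE//; lra.
  have p0 : 0 < 2^-1 ^+ n :> R by rewrite exprn_gt0.
  rewrite -/m in e1; move: CS e1 p2 p0 m0 (ep0 n); move: (ep n) (2^-1 ^+ n) => ee p.
  move: (Int _) (Int _) (Lam _ _) m => u v w m CS e1 p2 p0 m0 ee0.
  have : ee * m <= 8^-1 * p * m by exact: ler_wpM2r.
  have := sqr_ge0 (w - v - (v - u)); have := sqr_ge0 (w - v - (u - v)); nra.
(* By the representation, the functional at [K n] is half the squared norm of [g] minus half the
   squared distance from [g] to [K n], and that distance tends to 0. *)
exists g; split => //; apply/ler_addgt0Pl => e e0; have [n hn] := pw0 2 e e0.
have okn := okK n; have := JS _ okn; have := HE _ okn; rewrite /J rep//.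
have := Hg n.
have -> : Int (fun x => (g x - kern (K n) x) ^+ 2) = Int (fun x => g x ^+ 2) -
    2 * Int (fun x => g x * kern (K n) x) + Int (fun x => kern (K n) x ^+ 2).
  have ikg : int1 (fun x => g x * kern (K n) x) := L2_int1M g2 (bmf_L2 (bmf_kern _)).
  have gg := L2_int1_sqr g2; have i2 := int1Z 2 ikg.
  rewrite -IntZ// -IntB// -IntD//; last exact: int1B.
  by apply: eq_Int => x _; ring.
by move: (2^-1 ^+ n) hn => p; lra.
Qed.

(** A single ramp at [t] recovers Taylor's formula for [f t]; the kernels [1 - x] and 1 recover
    position and velocity at time 1 when the end is clamped. *)
Lemma rate_representation f E :
  (forall k B, ok k -> (\forall N \near \oo, ksq k N <= B) -> Lam k f - 2^-1 * B <= E) ->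
  exists h1 g, [/\ H2rep f h1 g, 2^-1 * Int (fun x => g x ^+ 2) <= E, f 0 = a, h1 0 = al &
    ~~ free -> f 1 = b /\ h1 1 = be].
Proof.
move=> HE.
have {}HE k : ok k -> Lam k f - 2^-1 * Int (fun x => kern k x ^+ 2) <= E.
  move=> okk; apply/ler_addgt0Pl => e e0.
  have h := HE k (Int (fun x => kern k x ^+ 2) + e) okk _.
  have {}h := h (ksq_le (_ : _ < _ + e)).
  by have := h ltac:(by rewrite ltrDl); lra.
have [g [g2 gE rep]] := Lam_representation HE; have gi := L2_int1 g2.
have fE t : 0 <= t <= 1 -> f t = a + al * t + Int (fun x => ramp t x * g x).
  move=> t01; have := rep (Test 0 0 [:: (1, t)]).
  rewrite /Lam/= big_seq1 !mul0r !add0r mul1r => h.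
  have {}h : f t - a - al * t = _ := h ltac:(by split => //=; rewrite t01).
  have -> : Int (fun x => ramp t x * g x) = f t - a - al * t.
    rewrite h; apply: eq_Int => x _; rewrite /kern/= big_seq1 !mul0r !add0r mul1r; ring.
  by ring.
have o01 : 0 <= (1 : R) <= 1 by rewrite ler01 lexx.
have [H f0 h10] := kernel_H2rep g2 fE.
set h1 := (fun t => al + _) in H h10; exists h1, g; split => // nf.
have okc (c0 c1 : R) : ok (Test c0 c1 [::]) by split => //= fr; move: nf; rewrite fr.
have r0 := rep _ (okc 1 0); have r1 := rep _ (okc 0 1).
rewrite /Lam/= !big_nil !mul0r !mul1r !addr0 ?add0r in r0 r1.
split.
  rewrite fE//; have -> : Int (fun x => ramp 1 x * g x) = b - a - al.
    rewrite r1; apply: eq_Int => x /andP[_ x1]; rewrite /kern/= big_nil rampE /step x1.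
    by rewrite (_ : true%:R = 1)//; ring.
  by ring.
rewrite /h1; have -> : Int (fun x => step 1 x * g x) = be - al.
  rewrite r0; apply: eq_Int => x /andP[_ x1]; rewrite /kern/= big_nil /step x1.
  by rewrite (_ : true%:R = 1)//; ring.
by ring.
Qed.

End Representation.

(** * Zero sets and contact intervals *)

Section ZeroSets.
Context {R : realType}.
Notation mu := (@lebesgue_measure R).
Notation mR := (measurableTypeR R).
Notation I01 := (@I01 R).
Implicit Types (f g h : R -> R) (x y s t d eta : R).
Hint Resolve measurable_I01 : core.

Lemma C01P f : C01 f <-> forall x, 0 <= x <= 1 -> forall eta, 0 < eta ->
  exists2 d, 0 < d & forall y, 0 <= y <= 1 -> `|x - y| < d -> `|f x - f y| < eta.
Proof.
rewrite /C01/= subspace_continuousP; split => [H x x01 eta eta0|H x].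
  have Ix : I01 x by rewrite I01E.
  have /cvgrPdist_lt/(_ eta eta0) := H x Ix; rewrite near_withinE => /nbhs_ballP[d /= d0 Hd].
  exists d => // y y01 xy; apply: Hd => //; rewrite ?I01E//.
rewrite I01E => x01; apply/cvgrPdist_lt => eta eta0; rewrite near_withinE.
have [d d0 Hd] := H x x01 eta eta0; apply/nbhs_ballP; exists d => //= y xy.
by rewrite I01E => y01; exact: Hd.
Qed.

Lemma lipschitz_C01 f (L : R) :
  (forall s t, 0 <= s <= 1 -> 0 <= t <= 1 -> `|f s - f t| <= L * `|s - t|) -> C01 f.
Proof.
move=> fL; apply/C01P => x x01 eta eta0.
have L0 : 0 < `|L| + 1 by rewrite ltr_wpDl.
exists (eta / (`|L| + 1)) => [|y y01]; first by rewrite divr_gt0.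
rewrite ltr_pdivlMr// => xy; apply: le_lt_trans (fL _ _ x01 y01) _.
apply: le_lt_trans xy; rewrite mulrC ler_wpM2l//.
by have := ler_norm L; lra.
Qed.

Definition zeros f : set R := [set t | t \in I01 /\ f t = 0].

Lemma measurable_zeros f : C01 f -> measurable (zeros f : set mR).
Proof.
move=> cf; have mf : measurable_fun (I01 : set mR) (f : mR -> R).
  by apply: subspace_continuous_measurable_fun; [exact: measurable_I01|exact: cf].
have := mf measurable_I01 [set 0] (measurable_set1 0).
suff -> : zeros f = I01 `&` f @^-1` [set 0] by [].
by apply/seteqP; split => x [xI fx]; split => //; [exact: set_mem|exact: mem_set].
Qed.

Lemma zeros_lt_pinfty f : C01 f -> (mu (zeros f) < +oo)%E.
Proof.
move=> cf; apply: (@le_lt_trans _ _ (mu I01)); last by rewrite mu_I01 ltry.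
apply: le_measure; rewrite ?inE//; first exact: measurable_zeros.
by move=> x [] /set_mem.
Qed.

Definition cell (M j : nat) : set R := `]j%:R / M%:R, j.+1%:R / M%:R]%classic.

Lemma cellE (M j : nat) x : (0 < M)%N -> cell M j x = (j%:R < M%:R * x <= j.+1%:R).
Proof.
move=> M0; have M0' : 0 < M%:R :> R by rewrite ltr0n.
by rewrite /cell /= in_itv/= ltr_pdivrMr// ler_pdivlMr// mulrC.
Qed.

Lemma mu_cell (M j : nat) : (0 < M)%N -> mu (cell M j) = (M%:R^-1)%:E.
Proof.
move=> M0; have M0' : 0 < M%:R :> R by rewrite ltr0n.
rewrite /cell lebesgue_measure_itv/= lte_fin ltr_pM2r ?invr_gt0// ltr_nat ltnSn.
by rewrite -EFinB -mulrBl -natr1 addrC addKr mul1r.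
Qed.

Lemma mu_cells (M : nat) (B : pred nat) : (0 < M)%N ->
  ((M%:R^-1 * \sum_(j < M) (B j)%:R)%:E <=
     mu (\bigcup_(j in [set j | (j < M)%N && B j]) cell M j))%E.
Proof.
move=> M0; set D := [set j | _].
have mc j : D j -> measurable (cell M j : set mR) by move=> _; exact: measurable_itv.
have tI : trivIset D (cell M).
  move=> i j _ _ [x []]; rewrite !cellE// => /andP[h1 h2] /andP[h3 h4].
  have : (i < j.+1)%N by rewrite -(ltr_nat R) (lt_le_trans h1).
  have : (j < i.+1)%N by rewrite -(ltr_nat R) (lt_le_trans h3).
  by rewrite !ltnS => ? ?; apply/eqP; rewrite eqn_leq; apply/andP.
have -> := measure_bigcup mu D (cell M) mc tI.
apply: le_trans (nneseries_lim_ge M _) => [|i _ _]; last exact: measure_ge0.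
rewrite [leRHS]big_mkcond/= big_mkord mulr_sumr -sumEFin; apply: lee_sum => j _.
case: ifPn => [_|/negP jD].
  by rewrite mu_cell// lee_fin; case: (B j); rewrite ?mulr1 ?mulr0 ?invr_ge0.
suff -> : B j = false by rewrite mulr0.
by apply/negP => Bj; apply: jD; apply/mem_set; rewrite /D /= ltn_ord.
Qed.

(** At mesh [1/(m+1)] the selected blocks are those where [|f|] falls below [1/(m+1)]. By
    continuity, a point in infinitely many of these unions is a zero, and the measures of the tails
    decrease to that of the limit set. *)
Lemma zero_blocks f eta : C01 f -> 0 < eta ->
  exists M (B : pred nat) d, [/\ (0 < M)%N, 0 < d,
    M%:R^-1 * \sum_(j < M) (B j)%:R <= fine (mu (zeros f)) + eta &
    forall j t, (j < M)%N -> ~~ B j -> j%:R <= M%:R * t <= j.+1%:R -> d <= `|f t|].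
Proof.
move=> cf eta0.
pose B m j := `[< exists2 t, j%:R <= m.+1%:R * t <= j.+1%:R & `|f t| < m.+1%:R^-1 >].
pose D m := \bigcup_(j in [set j | (j < m.+1)%N && B m j]) cell m.+1 j.
pose E m := \bigcup_(l in [set l | (m <= l)%N]) D l.
have mD m : measurable (D m : set mR) by apply: bigcup_measurable => j _; exact: measurable_itv.
have mE m : measurable (E m : set mR) by exact: bigcup_measurable.
have DI m x : D m x -> 0 <= x <= 1.
  move=> [j /= /andP[jm _]]; rewrite cellE// => /andP[h1 h2].
  have m0 : 0 < m.+1%:R :> R by rewrite ltr0n.
  apply/andP; split.
    by rewrite -(pmulr_rge0 _ m0); apply: le_trans (ltW h1).
  by rewrite -(ler_pM2l m0) mulr1; apply: le_trans h2 _; rewrite ler_nat.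
have nE : nonincreasing_seq E.
  move=> m n mn; apply/subsetPset => x [l /= nl Dx]; exists l => //=.
  exact: leq_trans mn nl.
have capE : \bigcap_m E m `<=` zeros f.
  move=> x Ex; have [l _ /DI x01] := Ex 0%N I; split; first by rewrite in_I01.
  apply/eqP; apply/negPn/negP => fx0.
  have fx : 0 < `|f x| / 2 by rewrite divr_gt0 ?normr_gt0.
  have [dl dl0 Hd] := (C01P f).1 cf x x01 _ fx.
  have [m mdl] : exists m : nat, m.+1%:R^-1 < Num.min dl (`|f x| / 2).
    exists (Num.truncn (Num.min dl (`|f x| / 2))^-1).
    have p : 0 < Num.min dl (`|f x| / 2) by rewrite lt_min dl0.
    by rewrite invf_plt ?posrE// truncnS_gt.
  have [n /= mn [j /= /andP[jn /asboolP[t tj ft]]]] := Ex m I.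
  rewrite cellE// => /andP[h1 h2].
  have n0 : 0 < n.+1%:R :> R by rewrite ltr0n.
  have nm : n.+1%:R^-1 <= m.+1%:R^-1 :> R by rewrite lef_pV2 ?posrE// ler_nat.
  case/andP: tj => t1 t2.
  have t01 : 0 <= t <= 1.
    apply/andP; split; first by rewrite -(pmulr_rge0 _ n0); exact: le_trans t1.
    by rewrite -(ler_pM2l n0) mulr1; apply: le_trans t2 _; rewrite ler_nat.
  have xt : `|x - t| <= n.+1%:R^-1.
    rewrite -(ler_pM2l n0) divff ?gt_eqF// -{1}(gtr0_norm n0) -normrM mulrBr.
    by rewrite -natr1 in h2 t2; rewrite ler_norml; apply/andP; split; lra.
  move: mdl; rewrite lt_min => /andP[md mf].
  have := Hd t t01 (le_lt_trans xt (le_lt_trans nm md)).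
  move=> dft; have ftm := lt_trans (lt_le_trans ft nm) mf.
  have := ler_normD (f t) (f x - f t); rewrite (_ : f t + (f x - f t) = f x); last by ring.
  by rewrite leNgt; case/negP; rewrite [ltRHS]splitr; exact: ltrD.
have cE : mu \o E @ \oo --> mu (\bigcap_n E n).
  apply: nonincreasing_cvg_mu => //; last exact: bigcapT_measurable.
  apply: (@le_lt_trans _ _ (mu I01)); last by rewrite mu_I01 ltry.
  apply: le_measure; rewrite ?inE// => x [l _ /DI]; by rewrite I01E.
have muZ : mu (zeros f) \is a fin_num.
  by rewrite ge0_fin_numE ?measure_ge0 ?zeros_lt_pinfty.
have capZ : (mu (\bigcap_n E n) <= mu (zeros f))%E.
  apply: le_measure; rewrite ?inE//; first exact: bigcapT_measurable.
  exact: measurable_zeros.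
have capfin : mu (\bigcap_n E n) \is a fin_num.
  by rewrite ge0_fin_numE ?measure_ge0//; apply: le_lt_trans capZ _; exact: zeros_lt_pinfty.
have [m Hm] : exists m, (mu (E m) < (fine (mu (zeros f)) + eta)%:E)%E.
  have lt : (mu (\bigcap_n E n) < (fine (mu (zeros f)) + eta)%:E)%E.
    apply: le_lt_trans capZ _; rewrite EFinD fineK//.
    by rewrite lteDl// lte_fin.
  apply: contrapT => Hn; move: lt; rewrite ltNge; case/negP.
  rewrite -(cvg_lim _ cE)//; apply: lime_ge; first by apply/cvg_ex; eexists; exact: cE.
  by apply: nearW => m; rewrite leNgt; apply/negP => h; apply: Hn; exists m.
exists m.+1, (B m), m.+1%:R^-1; split => //.
  rewrite -lee_fin; apply: le_trans (mu_cells (B m) (ltn0Sn m)) _.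
  apply: le_trans (ltW Hm); apply: le_measure; rewrite ?inE//; first exact: mD.
  by move=> x Dx; exists m => /=.
move=> j t jm /asboolP nB tj; rewrite leNgt; apply/negP => ft.
by apply: nB; exists t.
Qed.

End ZeroSets.

(** * The contact set of an H^2 function *)

Section Contact.
Context {R : realType}.
Notation mu := (@lebesgue_measure R).
Notation mR := (measurableTypeR R).
Notation I01 := (@I01 R).
Variables (h h1 g : R -> R).
Hypothesis H : H2rep h h1 g.
Implicit Types (x y s t d eta : R).

Let g2 := H2rep_L2 H.
Let gi := L2_int1 g2.
Let hi := H2rep_int1_h1 H.

Lemma H2rep_C01 : C01 h.
Proof.
apply: (@lipschitz_C01 _ _ (`|h1 0| + Int (fun u => `|g u|))) => s t s01 t01.
rewrite (H2rep_kernel H s01) (H2rep_kernel H t01); exact: (@taylor_lipschitz R (h 0) (h1 0) g s t gi).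
Qed.

Lemma H2rep_h1_diff x y : 0 <= x <= 1 -> 0 <= y <= 1 ->
  h1 x - h1 y = Int (fun u => (step x u - step y u) * g u).
Proof.
move=> x01 y01; rewrite (H2rep_h1 H x01) (H2rep_h1 H y01).
transitivity (Int (fun u => step x u * g u) - Int (fun u => step y u * g u)); first by ring.
rewrite -(IntB (int1M (bmf_step x) gi) (int1M (bmf_step y) gi)).
by apply: eq_Int => u _; rewrite mulrBl.
Qed.

Lemma Int_step_diff s t : 0 <= s <= 1 -> 0 <= t <= 1 ->
  Int (fun u => step t u - step s u) = t - s.
Proof.
move=> s01 t01; rewrite (IntB (bmf_int1 (bmf_step t)) (bmf_int1 (bmf_step s))).
by rewrite !Int_step.
Qed.

Lemma Int_step_sqr x y : 0 <= x <= 1 -> 0 <= y <= 1 ->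
  Int (fun u => (step x u - step y u) ^+ 2) = `|x - y|.
Proof.
have W s t : s <= t -> 0 <= s <= 1 -> 0 <= t <= 1 ->
    Int (fun u => (step t u - step s u) ^+ 2) = t - s.
  move=> st s01 t01; rewrite -Int_step_diff//.
  apply: eq_Int => u _; rewrite /step; case: (leP u s) => us.
    by rewrite (le_trans us st) subrr expr0n.
  by case: (u <= t); rewrite subr0 ?expr1n ?expr0n.
move=> x01 y01; have [xy|/ltW yx] := leP x y; last by rewrite W// ger0_norm ?subr_ge0.
rewrite distrC ger0_norm ?subr_ge0// -W//.
by apply: eq_Int => u _; rewrite -sqrrN opprB.
Qed.

Lemma H2rep_C01_h1 : C01 h1.
Proof.
apply/C01P => x x01 eta eta0; pose G := Int (fun u => g u ^+ 2).
have G0 : 0 <= G by apply: Int_ge0 => u _; exact: sqr_ge0.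
exists (eta ^+ 2 / (G + 1)) => [|y y01]; first by rewrite divr_gt0 ?exprn_gt0//; lra.
rewrite ltr_pdivlMr; last by lra.
move=> xy; rewrite -(@ltr_pXn2r _ 2) ?nnegrE ?(ltW eta0)// real_normK ?num_real//.
apply: le_lt_trans xy.
have bs := bmfB (bmf_step x) (bmf_step y).
rewrite H2rep_h1_diff//; apply: le_trans (Int_CauchySchwarz2 (bmf_L2 bs) g2) _.
rewrite Int_step_sqr// ler_wpM2l// -/G; lra.
Qed.

(** A zero with nonzero slope is isolated. In [P n i] the slope varies by less than half within
    distance [1/(n+1)] and the point lies in the cell [i] of that mesh; a second zero there would
    contradict the vanishing of the integral of [h1] in between. *)
Lemma contact_countable : countable [set t | [/\ t \in I01, h t = 0 & h1 t != 0]].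
Proof.
set N := [set t | _].
pose P n i := [set t | [/\ N t, forall y, 0 <= y <= 1 -> `|t - y| < n.+1%:R^-1 ->
  `|h1 t - h1 y| < `|h1 t| / 2 & i%:R <= n.+1%:R * t < i.+1%:R]].
have P1 n i t t' : P n i t -> P n i t' -> t = t'.
  wlog tt : t t' / t <= t'.
    by move=> Hw; have [tt|/ltW tt] := leP t t'; [exact: Hw|move=> ? ?; apply/esym/Hw].
  move=> [[It ht h1t] Ht /andP[a1 a2]] [[It' ht' _] _ /andP[b1 b2]].
  apply/eqP; rewrite eq_le tt/= leNgt; apply/negP => lt.
  rewrite in_I01 in It; rewrite in_I01 in It'.
  have n0 : 0 < n.+1%:R :> R by rewrite ltr0n.
  have close y : t <= y <= t' -> `|h1 t - h1 y| < `|h1 t| / 2.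
    move=> /andP[y1 y2]; case/andP: It => t0 t1; case/andP: It' => t'0 t'1.
    apply: Ht; first by rewrite (le_trans t0)// (le_trans y2).
    rewrite distrC ger0_norm ?subr_ge0//; apply: le_lt_trans (lerD y2 (lexx _)) _.
    rewrite -(ltr_pM2l n0) mulrBr divff ?gt_eqF//.
    by rewrite -natr1 in a2 b2; lra.
  have bs := bmfB (bmf_step t') (bmf_step t).
  have E0 : Int (fun u => (step t' u - step t u) * h1 u) = 0.
    have := H2rep_h H It'; rewrite (H2rep_h H It) in ht; rewrite ht' => e'.
    transitivity (Int (fun u => step t' u * h1 u) - Int (fun u => step t u * h1 u)).
      rewrite -(IntB (int1M (bmf_step t') hi) (int1M (bmf_step t) hi)).
      by apply: eq_Int => u _; rewrite mulrBl.
    by lra.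
  have E1 : Int (fun u => (step t' u - step t u) * h1 t) = (t' - t) * h1 t.
    rewrite mulrC -Int_step_diff// -IntZ; last exact: bmf_int1.
    by apply: eq_Int => u _; rewrite mulrC.
  have bc := int1M bs (bmf_int1 (bmf_cst (h1 t))).
  have bh := int1M bs hi.
  have le1 : `|(t' - t) * h1 t| <= (t' - t) * (`|h1 t| / 2).
    rewrite -E1 -[X in `|X|](subr0) -E0 -IntB//.
    apply: le_trans (normr_Int (int1B bc bh)) _.
    rewrite [leRHS]mulrC -Int_step_diff// -IntZ; last exact: bmf_int1.
    apply: le_Int; [exact: int1_norm (int1B bc bh)|by apply: int1Z; exact: bmf_int1|].
    move=> u u01; rewrite -mulrBr normrM mulrC /step.
    case: (leP u t) => ut; first by rewrite (le_trans ut tt) subrr normr0 !mulr0.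
    case: (leP u t') => ut'; last by rewrite subrr normr0 !mulr0.
    by rewrite subr0 normr1 !mulr1 ltW// close// (ltW ut).
  have d0 : 0 < t' - t by rewrite subr_gt0.
  move: le1; rewrite normrM (gtr0_norm d0) ler_pM2l//.
  have : 0 < `|h1 t| by rewrite normr_gt0.
  by lra.
apply: (@sub_countable _ _ _ (\bigcup_n \bigcup_i P n i)); last first.
  apply: bigcup_countable => // n _; apply: bigcup_countable => // i _.
  have [->|/set0P[t0 Pt0]] := eqVneq (P n i) set0; first exact: countable0.
  apply: (@sub_countable _ _ _ [set t0]); last exact: countable1.
  by apply: subset_card_le => t Pt; exact: P1 Pt Pt0.
apply: subset_card_le => t [It ht h1t].
have t01 : 0 <= t <= 1 by rewrite -in_I01.
have e0 : 0 < `|h1 t| / 2 by rewrite divr_gt0 ?normr_gt0.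
have [d d0 Hd] := (C01P h1).1 H2rep_C01_h1 t t01 _ e0.
exists (Num.truncn d^-1) => //; exists (Num.truncn ((Num.truncn d^-1).+1%:R * t)) => //.
split => // [y y01 ty|].
  by apply: Hd => //; apply: lt_trans ty _; rewrite invf_plt ?posrE// truncnS_gt.
case/andP: t01 => t0 _.
by rewrite truncnS_gt truncn_le mulr_ge0.
Qed.

Lemma zero_at_sup (F : R -> R) (K : set R) : C01 F -> K !=set0 ->
  (forall x, K x -> 0 <= x <= 1 /\ F x = 0) -> F (sup K) = 0.
Proof.
move=> cF K0 KF; have supK : has_sup K.
  by split => //; exists 1 => x /KF[/andP[_ ?] _].
have c01 : 0 <= sup K <= 1.
  have [x Kx] := K0; have [/andP[x0 _] _] := KF x Kx; apply/andP; split.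
    by apply: le_trans x0 _; apply: ub_le_sup => //; case: supK.
  by apply: ge_sup => // y /KF[/andP[_ ?] _].
apply/eqP/negPn/negP => Fc; have e0 : 0 < `|F (sup K)| by rewrite normr_gt0.
have [d d0 Hd] := (C01P F).1 cF _ c01 _ e0.
have [x Kx xd] := sup_adherent d0 supK; have [x01 Fx] := KF x Kx.
have xs : x <= sup K by apply: ub_le_sup => //; case: supK.
have := Hd x x01; rewrite Fx subr0 ltxx ger0_norm ?subr_ge0// ltrBlDl -ltrBlDr.
by move=> /(_ xd).
Qed.

Lemma zero_at_inf (F : R -> R) (K : set R) : C01 F -> K !=set0 ->
  (forall x, K x -> 0 <= x <= 1 /\ F x = 0) -> F (inf K) = 0.
Proof.
move=> cF K0 KF; have infK : has_inf K.
  by split => //; exists 0 => x /KF[/andP[? _] _].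
have c01 : 0 <= inf K <= 1.
  have [x Kx] := K0; have [/andP[_ x1] _] := KF x Kx; apply/andP; split.
    by apply: lb_le_inf => // y /KF[/andP[? _] _].
  by apply: le_trans x1; apply: ge_inf => //; case: infK.
apply/eqP/negPn/negP => Fc; have e0 : 0 < `|F (inf K)| by rewrite normr_gt0.
have [d d0 Hd] := (C01P F).1 cF _ c01 _ e0.
have [x Kx xd] := inf_adherent d0 infK; have [x01 Fx] := KF x Kx.
have xs : inf K <= x by apply: ge_inf => //; case: infK.
have := Hd x x01; rewrite Fx subr0 ltxx distrC ger0_norm ?subr_ge0// ltrBlDl.
by move=> /(_ xd).
Qed.

(* On each cell the common zeros of [h] and [h1] are replaced by their convex hull. *)
Lemma contact_hulls (M : nat) : (0 < M)%N -> exists s t : nat -> R,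
  [/\ forall j, (j < M)%N -> j%:R / M%:R <= s j /\ s j <= t j /\ t j <= j.+1%:R / M%:R,
     forall j, (j < M)%N -> s j < t j -> [/\ h (s j) = 0, h1 (s j) = 0, h (t j) = 0 & h1 (t j) = 0] &
     fine (mu (zeros h)) <= \sum_(j < M) (t j - s j)].
Proof.
move=> M0; have M0' : 0 < M%:R :> R by rewrite ltr0n.
have ch0 := H2rep_C01; have ch1 := H2rep_C01_h1.
have /choice[s /choice[t st]] : forall j, exists s, exists t, (j < M)%N ->
    [/\ j%:R / M%:R <= s, s <= t, t <= j.+1%:R / M%:R,
       s < t -> [/\ h s = 0, h1 s = 0, h t = 0 & h1 t = 0] &
       forall x, j%:R / M%:R <= x <= j.+1%:R / M%:R -> h x = 0 -> h1 x = 0 -> s <= x <= t].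
  move=> j; pose K := [set x | [/\ j%:R / M%:R <= x <= j.+1%:R / M%:R, h x = 0 & h1 x = 0]].
  have jj : j%:R / M%:R <= j.+1%:R / M%:R :> R by rewrite ler_pM2r ?invr_gt0// ler_nat.
  have [K0|/set0P K0] := eqVneq K set0.
    (* A cell without contact gets a degenerate interval, which cuts nothing. *)
    exists (j%:R / M%:R), (j%:R / M%:R) => jM; split => //; first by rewrite ltxx.
    by move=> x xj hx h1x; have : K x by []; rewrite K0.
  exists (inf K), (sup K) => jM.
  have KI x : K x -> 0 <= x <= 1.
    move=> [/andP[x1 x2] _ _]; rewrite (le_trans _ x1) ?divr_ge0//=.
    by apply: le_trans x2 _; rewrite ler_pdivrMr// mul1r ler_nat.
  have hs : has_sup K by split => //; exists 1 => x /KI/andP[].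
  have hi' : has_inf K by split => //; exists 0 => x /KI/andP[].
  have lo x : K x -> inf K <= x by move=> Kx; apply: ge_inf => //; case: hi'.
  have up x : K x -> x <= sup K by move=> Kx; apply: ub_le_sup => //; case: hs.
  split.
  - by apply: lb_le_inf => // x [/andP[]].
  - by have [x Kx] := K0; apply: le_trans (lo x Kx) (up x Kx).
  - by apply: ge_sup => // x [/andP[]].
  - move=> _; split.
    + by apply: zero_at_inf => // x Kx; split; [exact: KI|case: Kx].
    + by apply: zero_at_inf => // x Kx; split; [exact: KI|case: Kx].
    + by apply: zero_at_sup => // x Kx; split; [exact: KI|case: Kx].
    + by apply: zero_at_sup => // x Kx; split; [exact: KI|case: Kx].
  - by move=> x xj hx h1x; have Kx : K x by []; rewrite lo// up.
exists s, t; split => [j /st[]//|j /st[]//|].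
set N := [set t | [/\ t \in I01, h t = 0 & h1 t != 0]].
pose A := \big[setU/set0]_(j < M) (`[s j, t j]%classic : set R).
have mA : measurable (A : set mR) by apply: bigsetU_measurable => j _; exact: measurable_itv.
have cN : countable N by exact: contact_countable.
have mN : measurable (N : set mR) by exact: countable_measurable.
(* Zeros with nonzero slope form a countable, hence null, set; all others lie in a hull. *)
have sub : zeros h `<=` N `|` A.
  move=> x [xI hx]; have [h1x|h1x] := eqVneq (h1 x) 0; last by left.
  right; rewrite /A -(bigcup_mkord M (fun j => `[s j, t j]%classic)); have x01 : 0 <= x <= 1 by rewrite -in_I01.
  have [j jM [/andP[j1 j2] _]] := profile_cell (fun=> 0 : R) M0 x01.
  exists j => //=; have [_ _ _ _ H5] := st j jM; rewrite in_itv/=; apply: H5 => //.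
  by rewrite ler_pdivrMr// ler_pdivlMr// mulrC j1.
have muA : (mu A <= (\sum_(j < M) (t j - s j))%:E)%E.
  apply: le_trans (Boole_inequality mu (A := fun j => `[s j, t j]%classic) _) _.
    by move=> i _; exact: measurable_itv.
  rewrite -sumEFin; apply: lee_sum => j _; have [_ st' _ _ _] := st j (ltn_ord j).
  have : (mu `[s j, t j]%classic <= (t j - s j)%:E)%E.
    rewrite lebesgue_measure_itv/= lte_fin; case: ltP => _; first by rewrite EFinB.
    by rewrite lee_fin subr_ge0.
  exact.
have mZ := measurable_zeros ch0.
rewrite -lee_fin fineK; last by rewrite ge0_fin_numE ?measure_ge0 ?zeros_lt_pinfty.
apply: (@le_trans _ _ (mu (N `|` A))).
  by apply: le_measure; rewrite ?inE//; exact: measurableU.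
apply: le_trans (measureU2 _ _ _) _ => //.
have N0 : (mu N <= 0)%E by rewrite (countable_lebesgue_measure0 cN).
by rewrite -[leRHS]add0e; exact: leeD.
Qed.

End Contact.

(** * Upper bounds on balls and tightness *)

Section UpperBounds.
Context {R : realType}.
Notation mu := (@lebesgue_measure R).
Notation half := (2^-1 : R).
Implicit Types (e : {nonneg R}) (f g : R -> R) (x t d eta : R).
Variables (a al b be : R) (free : bool).
Notation nf := (nfree free).
Notation bs := (base b be).
Notation ubd := (ubd a al b be free).
Notation Lam := (Lam a al b be).

(** This is the free energy [tau e], as [tau_excess] shows. *)
Definition excess e : R := rate_inf e - rate_inf 0%:nng.

Lemma excess_ge0 e : 0 <= excess e.
Proof. by rewrite subr_ge0 rate_inf_ge. Qed.

Lemma eventually_prefactor (C eta : R) : 0 < C -> 0 < eta ->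
  \forall N \near \oo, C <= expR (N%:R * eta).
Proof.
move=> C0 eta0; near=> N.
have N0 : 0 < N%:R :> R by rewrite ltr0n; near: N; exact: nbhs_infty_gt.
rewrite -[leLHS]lnK ?posrE// ler_expR mulrC -ler_pdivrMr// mulrC.
by near: N; exact: near_inv_mul_le.
Unshelve. all: by end_near. Qed.

Lemma ball_ubd e k f (B x : R) : C01 f -> test_ok free k ->
  (\forall N \near \oo, ksq k N <= B) ->
  x < Lam k f - half * B - excess e * fine (mu (zeros f)) ->
  exists2 d, 0 < d & \forall N \near \oo,
    ubd e N (uball f d) (expR (N%:R * (rate_inf 0%:nng - x))).
Proof.
move=> cf ok kB; set Z := fine _; set r0 := rate_inf _ => xlt.
pose gap := Lam k f - half * B - excess e * Z - x.
have gap0 : 0 < gap by rewrite subr_gt0.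
have ex0 := excess_ge0 e; have tn0 : 0 <= tnorm k by apply: sumr_ge0.
(* The gap is shared out: an eighth for the blocks and the free energy, an eighth for the radius, a
   quarter for the constant [C]. *)
pose eta := gap / (8 * (excess e + 1)).
have eta0 : 0 < eta by rewrite divr_gt0// mulr_gt0//; lra.
have etaE : (excess e + 1) * eta = gap / 8 by rewrite /eta; field; lra.
have [M [P [d0 [M0 d00 Pd HP]]]] := zero_blocks cf eta0.
have [C C0 HC] := Zpin_blocks free e eta0 M0.
pose d := Num.min d0 (gap / (8 * (tnorm k + 1))).
have d0' : 0 < d by rewrite lt_min d00 divr_gt0// mulr_gt0//; lra.
have dt : d * tnorm k <= gap / 8.
  apply: (@le_trans _ _ (gap / (8 * (tnorm k + 1)) * tnorm k)).
    by rewrite ler_wpM2r// ge_min lexx orbT.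
  rewrite mulrAC ler_pdivrMr; last by rewrite mulr_gt0//; lra.
  by move: (gap) gap0 => G G0; nra.
exists d => //; near=> N.
have N0 : (0 < N)%N by near: N; exact: nbhs_infty_gt.
have N0' : 0 < N%:R :> R by rewrite ltr0n.
pose A i := (N <= i)%N || (`|f (i.+1%:R / N%:R)| < d).
apply: ubd_le (@ubd_tilt _ a al b be free e k N f d A N0 ok _ _).
- have AP j i : (j < M)%N -> ~~ P j -> (i < N)%N ->
      (j * N <= i.+1 * M <= j.+1 * N)%N -> ~~ A i.
    move=> jM Pj iN /andP[h1 h2]; rewrite /A negb_or -ltnNge iN /= -leNgt.
    apply: (@le_trans _ _ d0); first by rewrite ge_min lexx.
    apply: (HP j _ jM Pj); rewrite mulrA ler_pdivlMr// ler_pdivrMr// -!natrM !ler_nat.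
    by rewrite [(M * _)%N]mulnC h1 h2.
  have Z' := HC N A P N0 AP.
  apply: le_trans (ler_wpM2l (expR_ge0 _) Z') _.
  have CN : C <= expR (N%:R * (gap / 4)).
    by near: N; apply: eventually_prefactor => //; rewrite divr_gt0.
  rewrite mulrCA; apply: le_trans (ler_wpM2r _ CN) _.
    by rewrite mulr_ge0 ?expR_ge0.
  rewrite -!expRD ler_expR -mulrN -!mulrDr ler_pM2l//.
  have kN : ksq k N <= B by near: N.
  rewrite -/r0 -/(excess e).
  have : excess e * (M%:R^-1 * \sum_(j < M) (P j)%:R) <= excess e * (Z + eta).
    by rewrite ler_wpM2l.
  move: (excess e * (_ * _)) (ksq k N) kN etaE dt (gap0); rewrite /gap.
  by move: (excess e) (d * tnorm k) (Lam k f) r0 => ex dt L r0 s q qB; lra.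
- by move=> i _ iN fd; rewrite /A fd orbT.
- by move=> i Ni; rewrite /A Ni.
Unshelve. all: by end_near. Qed.

Definition lipset (L : R) : set (R -> R) := [set g | g 0 = a /\
  forall s t, 0 <= s <= 1 -> 0 <= t <= 1 -> `|g s - g t| <= L * `|s - t|].

(** The slope is at most [|al|] plus the average of the second differences, which Cauchy-Schwarz
    bounds by [sqrt (2 L) <= 1 + 2 L]. *)
Lemma profile_lipset N (v : nat -> R) L : (0 < N)%N -> 0 <= L ->
  qR N.+1 (fld_a a al N v) <= L * N%:R ->
  lipset (`|al| + 1 + 2 * L) (profile N (fld_a a al N v)).
Proof.
move=> N0 L0 qL; have N0' : 0 < N%:R :> R by rewrite ltr0n.
set f := fld_a a al N v in qL *; split.
  have := profile_grid f N0 (leq0n N); rewrite mul0r => ->.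
  by rewrite /f /fld_a/= mulfK// gt_eqF// exprn_gt0.
move=> s t s01 t01; apply: le_trans (profile_lipschitz f N0 s01 t01) _.
apply: ler_wpM2r => //.
have -> : `|f 1%N - f 0%N| / N%:R = `|al|.
  rewrite /f /fld_a/= (_ : _ - _ = al * N%:R); last by ring.
  by rewrite normrM [`|N%:R|]ger0_norm// mulfK// gt_eqF.
rewrite -addrA lerD2l; set S := \sum_(j < _) _.
have S0 : 0 <= S by exact: sumr_ge0.
have S2 : S ^+ 2 <= N.+1%:R * qR N.+1 f.
  apply: le_trans (sqr_sum_le N.+1 (fun j => `|rho f j|)) _.
  by rewrite ler_wpM2l// le_eqVlt; apply/orP; left; apply/eqP; apply: eq_bigr => j _;
    rewrite real_normK ?num_real.
rewrite ler_pdivrMl// -(@ler_pXn2r _ 2) ?nnegrE//; last first.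
  by rewrite mulr_ge0//; lra.
apply: le_trans S2 _; apply: le_trans (ler_wpM2l _ qL) _; first by [].
have N1 : N.+1%:R <= 2 * N%:R :> R.
  have N1' : 1 <= N%:R :> R by rewrite ler1n.
  by rewrite -natr1; lra.
rewrite exprMn; move: N0' N1; set n := N%:R => n0 n1.
have : N.+1%:R * (L * n) <= 2 * n * (L * n).
  by rewrite ler_wpM2r// mulr_ge0// ltW.
move/le_trans; apply; have : 0 <= n ^+ 2 * (1 + 2 * L + 4 * L ^+ 2).
  by rewrite mulr_ge0 ?sqr_ge0//; have := sqr_ge0 L; lra.
by move=> ?; nra.
Qed.

Lemma tight_ubd e (L0 : R) : exists2 L, 0 <= L & \forall N \near \oo,
  ubd e N (~` lipset L) (expR (N%:R * (rate_inf 0%:nng - L0))).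
Proof.
have [C [K [C0 HC]]] := Zpin_quarter_le free e.
(* A quarter of [L] has to beat the growth rate [K] and the target exponent; the summand 1 absorbs
   the prefactor [C]. *)
move: (rate_inf _) => r; pose L : R := `|4 * (K - r + L0 + 1)|.
have L0' : 0 <= L by exact: normr_ge0.
exists (`|al| + 1 + 2 * L); first by have := normr_ge0 al; lra.
near=> N; have N0 : (0 < N)%N by near: N; exact: nbhs_infty_gt.
have N0' : 0 < N%:R :> R by rewrite ltr0n.
apply: ubdS (ubd_le _ (@ubd_energy _ a al b be free e N L N0)).
  by move=> g gL /=; case=> v [vb qL] gE; apply: gL; rewrite gE; exact: profile_lipset.
apply: le_trans (ler_wpM2l (expR_ge0 _) (HC N N0)) _.
have CN : C <= expR (N%:R * 1) by near: N; exact: eventually_prefactor.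
rewrite mulrCA; apply: le_trans (ler_wpM2r _ CN) _.
  by rewrite mulr_ge0 ?expR_ge0.
rewrite -!expRD ler_expR.
have : 4 * (K - r + L0 + 1) <= L by exact: ler_norm.
move: (L) {CN} => L' h; have : N%:R * (4 * (K - r + L0 + 1)) <= N%:R * L'.
  by rewrite ler_pM2l.
by clear; lra.
Unshelve. all: by end_near. Qed.

Lemma lipset_C01 L : lipset L `<=` @C01 R.
Proof. by move=> g [_ gL]; exact: lipschitz_C01 gL. Qed.

End UpperBounds.

(** * Lower bounds on balls *)

Section Cuts.
Context {R : realType}.
Notation mu := (@lebesgue_measure R).
Implicit Types (h g f s t : nat -> R).

Fixpoint cuts s t m (f : R -> R) : R -> R :=
  if m is m'.+1 then cutf (s m') (t m') (cuts s t m' f) else f.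

Lemma cutsE s t m (f : R -> R) x :
  cuts s t m f x = if has (fun j => s j < x <= t j) (iota 0 m) then 0 else f x.
Proof.
elim: m => // m IH; rewrite -addn1 iotaD has_cat/= add0n orbF addn1/= {1}/cutf IH.
by case: (s m < x <= t m); rewrite ?orbT ?orbF.
Qed.

Lemma H2rep_cuts (h h1 g : R -> R) s t m : H2rep h h1 g ->
  (forall j, (j < m)%N -> [/\ 0 <= s j, s j <= t j, t j <= 1 &
     s j < t j -> [/\ h (s j) = 0, h1 (s j) = 0, h (t j) = 0 & h1 (t j) = 0]]) ->
  H2rep (cuts s t m h) (cuts s t m h1) (cuts s t m g).
Proof.
move=> H; elim: m => // m IH st; have [s0 st' t1 z] := st m (ltnSn m).
apply: (@H2rep_cut _ (cuts s t m h) (cuts s t m h1) (cuts s t m g) (s m) (t m)) => //; first by apply: IH => j jm; apply: st; rewrite ltnS ltnW.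
by move=> /z[z1 z2 z3 z4]; rewrite !cutsE z1 z2 z3 z4; split; case: ifP.
Qed.

(** Each removed interval starts at a zero of [h] and is no longer than a cell, so the Lipschitz
    bound keeps [F] close to [h]; setting [g] to 0 there can only lower its norm. *)
Lemma contact_cut (h h1 g : R -> R) M Lh : H2rep h h1 g -> (0 < M)%N ->
  (forall x y, 0 <= x <= 1 -> 0 <= y <= 1 -> `|h x - h y| <= Lh * `|x - y|) -> 0 <= Lh ->
  exists s t F F1 G, [/\ H2rep F F1 G, F 0 = h 0 /\ F1 0 = h1 0, F 1 = h 1 /\ F1 1 = h1 1,
    Int (fun x => G x ^+ 2) <= Int (fun x => g x ^+ 2) /\
      (forall x, 0 <= x <= 1 -> `|h x - F x| <= Lh / M%:R) &
    [/\ forall j, (j < M)%N -> j%:R / M%:R <= s j /\ s j <= t j /\ t j <= j.+1%:R / M%:R,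
      forall j x, (j < M)%N -> s j < x <= t j -> F x = 0 &
      fine (mu (zeros h)) <= \sum_(j < M) (t j - s j)]].
Proof.
move=> H M0 hL L0; have M0' : 0 < M%:R :> R by rewrite ltr0n.
have [s [t [st z sumst]]] := contact_hulls H M0.
have st1 j : (j < M)%N -> [/\ 0 <= s j, s j <= t j & t j <= 1].
  move=> jM; have [h1' [h2 h3]] := st j jM; split => //.
    by apply: le_trans h1'; rewrite divr_ge0.
  by apply: le_trans h3 _; rewrite ler_pdivrMr// mul1r ler_nat.
have HF : H2rep (cuts s t M h) (cuts s t M h1) (cuts s t M g).
  apply: H2rep_cuts => // j jM; have [? ? ?] := st1 j jM.
  by split => //; exact: z.
have inP x (P : Prop) : (forall j, (j < M)%N -> s j < x <= t j -> P) ->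
    has (fun j => s j < x <= t j) (iota 0 M) -> P.
  by move=> HP /hasP[j]; rewrite mem_iota/= => jM; exact: HP.
have F00 (f : R -> R) : cuts s t M f 0 = f 0.
  rewrite cutsE; case: ifP => //; apply: inP => j jM /andP[sj _].
  by have [s0 _ _] := st1 j jM; rewrite ltNge s0 in sj.
(* The removed intervals contain their right end; if it is 1, then [h] and [h1] vanish there
   anyway. *)
have F11 : cuts s t M h 1 = h 1 /\ cuts s t M h1 1 = h1 1.
  rewrite !cutsE; case: ifP => //; apply: inP => j jM /andP[sj tj].
  have [_ _ t1] := st1 j jM; have tE : t j = 1 by apply/eqP; rewrite eq_le t1.
  by have [] := z j jM ltac:(by rewrite tE); rewrite tE => _ _ -> ->.
exists s, t, (cuts s t M h), (cuts s t M h1), (cuts s t M g); split => //.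
- split.
    apply: le_Int; [exact: L2_int1_sqr (H2rep_L2 HF)|exact: L2_int1_sqr (H2rep_L2 H)|].
    by move=> x _; rewrite cutsE; case: ifP => // _; rewrite expr0n sqr_ge0.
  move=> x x01; rewrite cutsE; case: ifP => [|_]; last first.
    by rewrite subrr normr0 divr_ge0// ltW.
  apply: inP => j jM /andP[sx xt]; have [h1' [h2 h3]] := st j jM.
  have [s0 _ t1] := st1 j jM.
  have [hs _ _ _] := z j jM (lt_le_trans sx xt).
  rewrite subr0 -[h x]subr0 -hs; apply: le_trans (hL _ _ x01 _) _.
    by rewrite s0 (le_trans h2 t1).
  rewrite ler_wpM2l// gtr0_norm ?subr_gt0//.
  have -> : M%:R^-1 = j.+1%:R / M%:R - j%:R / M%:R :> R by rewrite -natr1; field; lra.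
  by lra.
- split => // j x jM sxt; rewrite cutsE ifT//.
  by apply/hasP; exists j; rewrite ?mem_iota.
Qed.

End Cuts.

(** * A Chernoff bound under Gaussian weights *)

Section Chernoff.
Context {R : realType}.
Notation V := (nat -> R).
Notation half := (2^-1 : R).
Implicit Types (F G : V -> \bar R) (w v u psi : V).

Lemma JopD_sum_le Q m n F p (G : nat -> V -> \bar R) w :
  (forall v, 0 <= F v)%E -> (forall l, GS (Q l) (G l)) ->
  (Jop m 0 n (fun v => F v + \sum_(l < p) G l v) w <=
   Jop m 0 n F w + \sum_(l < p) Jop m 0 n (G l) w)%E.
Proof.
move=> F0 GG; elim: p => [|p IH].
  rewrite big_ord0 adde0; apply: le_Jop => v; rewrite big_ord0 adde0//.
rewrite big_ord_recr/= addeA; apply: le_trans (leeD2r _ IH).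
apply: le_trans (JopD_le _ _ _ _ _ (GG p)); last first.
  by move=> v; rewrite adde_ge0// sume_ge0// => l _; exact: GS_ge0 (GG l).
apply: le_Jop => v; last by rewrite big_ord_recr/= addeA.
by rewrite adde_ge0// sume_ge0// => l _; exact: GS_ge0 (GG l).
Qed.

(* A Chernoff bound under the Gaussian weight [q], uniform in the pinning:
   each linear [L l] with [L l ^ 2 <= K l * q] exceeds [T l] with relative
   weight at most [expR (- s)], by lemma [GS_le0] applied to the exponentially
   tilted weight, the coordinate [t] (which equals 1) carrying the tilt. *)
Lemma chernoff_lower m n t psi w q p (L : nat -> V -> R) (K T : nat -> R) (s X : R) F :
  nnq q -> (n <= t)%N -> w t = 1 -> psi t = 0 ->
  (forall u v, (forall k, (k < n)%N -> u k = v k) ->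
     (forall k, (n <= k)%N -> u k = 0 /\ v k = w k - psi k) -> q v = q u) ->
  (forall k, (k < n)%N -> psi k = 0 \/ (m k).1%:num = 0) ->
  Jop m 0 n (fun v => (expR (- (half * q v)))%:E) 0%R \is a fin_num ->
  (forall l, lin (L l)) -> (forall l, 0 < K l) -> (forall l, 0 <= T l) ->
  (forall l u, L l u ^+ 2 <= K l * q u) ->
  (forall l, 2 * s * K l <= T l ^+ 2) -> 0 <= X ->
  (forall v, 0 <= F v)%E ->
  (forall u, u t = 1 -> (forall k, (n <= k)%N -> u k = w k - psi k) ->
     (forall l, (l < p)%N -> L l u <= T l) ->
     ((X * expR (- (half * q u)))%:E <= F (psi + u)%R)%E) ->
  (((X * (1 - p%:R * expR (- s)))%:E * Jop m 0 n (fun v => (expR (- (half * q v)))%:E) 0%R)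
   <= Jop m 0 n F w)%E.
Proof.
move=> nq nt wt psit qw hpsi fZ linL K0 T0 LK sT X0 F0 HF.
have [qq q0] := nq.
have nh : nnq (fun u => half * q u).
  by split; [exact: qformZ|move=> u; rewrite mulr_ge0 ?invr_ge0].
set Z := Jop m 0 n _ 0%R in fZ *.
have Z0 : (0 <= Z)%E by apply: Jop_ge0 => v; rewrite lee_fin expR_ge0.
(* This equals [(q - L ^ 2 / K) / 2 + (L - T * u t) ^ 2 / (2 * K)], hence is nonnegative, and it
   reduces to [q / 2] when [u t = 0]. *)
pose ql l u := half * q u - T l / K l * (u t * L l u) + half * (T l ^+ 2 / K l) * u t ^+ 2.
have nql l : nnq (ql l).
  split.
    apply: qformD; last by apply: qformZ; apply: qform_sq; exact: lin_coord.
    apply: qformB; first exact: qformZ.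
    by apply: qformZ; apply: qform_mul => //; exact: lin_coord.
  move=> u; have K0' := K0 l; have := LK l u.
  rewrite mulrC -ler_pdivrMr// /ql => h.
  have -> : half * q u - T l / K l * (u t * L l u) + half * (T l ^+ 2 / K l) * u t ^+ 2 =
    half * (q u - L l u ^+ 2 / K l) + half * ((L l u - T l * u t) ^+ 2 / K l).
    by field; rewrite gt_eqF.
  by rewrite addr_ge0// mulr_ge0 ?invr_ge0// ?subr_ge0// divr_ge0 ?sqr_ge0// ltW.
pose H l u : \bar R := ((X * expR (- s))%:E * (expR (- ql l u))%:E)%E.
have GH l : GS (ql l) (H l).
  by apply: GS_scale; [rewrite lee_fin mulr_ge0 ?expR_ge0|exact: GS_expR].
pose M0 u : \bar R := (X%:E * (expR (- (half * q u)))%:E)%E.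
have GM : GS (fun u => half * q u) M0.
  by apply: GS_scale; [rewrite lee_fin|exact: GS_expR].
(* Subtraction of [psi] when [v t = 1], written as a linear map so that Gaussian sums are
   preserved. *)
pose sh (v : V) : V := v t *: (- psi) + v.
have tn : ~~ (0 <= t < 0 + n)%N by rewrite add0n /= -leqNgt.
have tr Q G : GS Q G -> Jop m 0 n (fun v => G (sh v)) w = Jop m 0 n G (w - psi).
  move=> GG; rewrite (@Jop_translate _ Q m 0 n G (- psi) t w GG tn)//.
  - by rewrite wt scale1r addrC.
  - by change (- psi t = 0); rewrite psit oppr0.
  - move=> k kn; have [h|h] := hpsi k kn; last by right.
    by left; change (- psi k = 0); rewrite h oppr0.
have GHs l : GS (fun v => ql l (sh v)) (fun v => H l (sh v)).
  apply: GS_scale; first by rewrite lee_fin mulr_ge0 ?expR_ge0.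
  apply: (GS_expR (q := fun v => ql l (sh v))); split; last by move=> u; case: (nql l).
  apply: (qform_comp (L := sh)); last by case: (nql l).
  by move=> c u v; apply/funext => i; rewrite /sh !fE; ring.
have HJ l : (Jop m 0 n (fun v => H l (sh v)) w <= (X * expR (- s))%:E * Z)%E.
  rewrite (tr _ _ (GH l)); apply: le_trans (GS_le0 _ (GS_Jop m 0 n (GH l))) _.
  rewrite /Z -(JopZl _ _ _ _ (GS_expR nh)); last by rewrite lee_fin mulr_ge0 ?expR_ge0.
  apply: le_Jop2 => [v|v v' h1 h2]; first exact: GS_ge0 (GH l).
  have vv : v = v'.
    apply/funext => i; have [/h1//|/h2[-> ->]//] := boolP (0 <= i < 0 + n)%N.
  have v0 : v' t = 0 by have [_ ->] := h2 t tn.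
  by rewrite vv /H /ql v0 mul0r mulr0 expr0n mulr0 subr0 addr0.
have MJ : (X%:E * Z <= Jop m 0 n (fun v => M0 (sh v)) w)%E.
  rewrite (tr _ _ GM) (JopZl _ _ _ _ (GS_expR nh)) ?lee_fin// lee_wpmul2l ?lee_fin//.
  apply: le_Jop2 => [v|u v h1 h2]; first by rewrite lee_fin expR_ge0.
  rewrite (qw u v)// => k kn; last first.
    by have [] := h2 k ltac:(by rewrite add0n /= -leqNgt).
have : (Jop m 0 n (fun v => M0 (sh v)) w <=
    Jop m 0 n F w + \sum_(l < p) Jop m 0 n (fun v => H l (sh v)) w)%E.
  apply: le_trans (JopD_sum_le _ _ _ _ F0 GHs).
  apply: le_Jop2 => [v|v v' h1 h2]; first exact: GS_ge0 GM.
  have vv : v = v'.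
    apply/funext => i; have [/h1//|/h2[-> ->]//] := boolP (0 <= i < 0 + n)%N.
  rewrite -vv; have vt : v t = 1 by have [->] := h2 t tn.
  set u := sh v; have uE : u = v - psi by rewrite /u /sh vt scale1r addrC.
  have uv : v = psi + u by rewrite uE addrC subrK.
  have ut : u t = 1 by rewrite uE; change (v t - psi t = 1); rewrite vt psit subr0.
  have uk k : (n <= k)%N -> u k = w k - psi k.
    move=> nk; rewrite uE; change (v k - psi k = w k - psi k).
    by have [->] := h2 k ltac:(by rewrite add0n /= -leqNgt).
  have HS : (0 <= \sum_(l < p) H l u)%E.
    by apply: sume_ge0 => l _; exact: GS_ge0 (GH l).
  (* Either all deviations are small and [F] is bounded below, or the tilted weight of one bad
     functional already dominates. *)
  have [good|] := pselect (forall l, (l < p)%N -> L l u <= T l).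
    apply: (@le_trans _ _ (F v)); last by rewrite leeDl.
    by rewrite uv /M0 -EFinM; exact: HF.
  move=> /existsNP[l /not_implyP[lp /negP]]; rewrite -ltNge => Tl.
  apply: (@le_trans _ _ (\sum_(l < p) H l u)%E); last by rewrite leeDr.
  rewrite (bigD1 (Ordinal lp))//=.
  apply: (@le_trans _ _ (H l u)); last first.
    by rewrite leeDl// sume_ge0// => i _; exact: GS_ge0 (GH i).
  rewrite /M0 /H -!EFinM lee_fin -mulrA ler_wpM2l// -expRD ler_expR /ql ut mul1r expr1n mulr1.
  have : T l * T l / K l <= T l / K l * L l u.
    by rewrite mulrAC ler_wpM2l ?divr_ge0// ltW.
  have := sT l; rewrite -ler_pdivlMr// expr2; move: (_ / K l) (_ * L l u) => y z.
  by lra.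
move=> /(le_trans MJ) hh.
have Zf : (\sum_(l < p) Jop m 0 n (fun v => H l (sh v)) w <= (p%:R * (X * expR (- s)))%:E * Z)%E.
  apply: (@le_trans _ _ (\sum_(l < p) (X * expR (- s))%:E * Z)%E).
    by apply: lee_sum => l _; exact: HJ.
  rewrite -(fineK fZ) -EFinM sumEFin sumr_const card_ord lee_fin.
  by rewrite -[(_ * _) *+ p]mulr_natl mulrA.
have {Zf}hh := le_trans hh (leeD2l _ Zf).
move: hh; rewrite -(fineK fZ) -!EFinM; set J := Jop m 0 n F w.
have : (0 <= J)%E by exact: Jop_ge0.
case: J => [r _|_ _|//]; last by rewrite leey.
by rewrite -EFinD !lee_fin; move: (fine Z) => z hz; move: hz; rewrite mulrBr mulrBl mulr1; lra.
Qed.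

End Chernoff.

(** * Fluctuations around a discretized profile *)

Section LowerBound.
Context {R : realType}.
Notation V := (nat -> R).
Notation half := (2^-1 : R).
Implicit Types (e : {nonneg R}) (u v w : V).
Variables (a al b be : R) (free : bool).
Notation nf := (nfree free).
Notation bs := (base b be).

(** Variable [i] is field coordinate [i + 2]. Beyond [N] the value is 0, so that the coordinate
    [N.+1] remains 1 under the translation. *)
Definition center (G : R -> R) N : V :=
  fun i => if (i <= N)%N then dfield a al G N i.+2 else 0.

Lemma taylor_nonpos (G : R -> R) t : t <= 0 -> taylor a al G t = a + al * t.
Proof.
move=> t0; rewrite /taylor (_ : Int _ = 0) ?addr0// -[RHS](@Int_cst R 0).
by apply: eq_Int => x /andP[x0 _]; rewrite ramp_le0// mul0r.
Qed.

Lemma center_fld (G : R -> R) N u i : (0 < N)%N -> (i < N.+3)%N ->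
  fld_a a al N (center G N + u) i = dfield a al G N i + pad u i.
Proof.
move=> N0 iN; have N0' : N%:R != 0 :> R by rewrite pnatr_eq0 -lt0n.
case: i iN => [|[|i]] iN; rewrite /fld_a /pad/=.
- rewrite /dfield taylor_nonpos; first by field.
  by rewrite sub0r mulNr oppr_le0 mul1r invr_ge0.
- by rewrite /dfield subrr mul0r taylor_nonpos//; ring.
- rewrite subn2/=; change (center G N i + u i = dfield a al G N i.+2 + u i).
  by rewrite /center ifT//; lia.
Qed.

Lemma centerE (F F1 G : R -> R) N i : (0 < N)%N -> H2rep F F1 G -> F 0 = a -> F1 0 = al ->
  (i < N)%N -> center G N i = N%:R ^+ 2 * F (i.+1%:R / N%:R).
Proof.
move=> N0 H Fa Fal iN; rewrite /center ifT; last by lia.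
rewrite /dfield; congr (_ * _); rewrite /taylor -Fa -Fal.
have -> : (i.+2%:R - 1) / N%:R = i.+1%:R / N%:R :> R by rewrite -natr1 addrK.
rewrite [RHS](H2rep_kernel H)// divr_ge0//= ler_pdivrMr ?ltr0n// mul1r ler_nat//.
Qed.

Lemma center_base (F F1 G : R -> R) N k : (1 < N)%N -> H2rep F F1 G -> F 0 = a -> F1 0 = al ->
  F 1 = b -> F1 1 = be -> (N.-1 <= k <= N)%N -> bs N k = center G N k.
Proof.
move=> N1 H Fa Fal Fb Fbe /andP[h1 h2]; have N0 : (0 < N)%N by lia.
have N0' : 0 < N%:R :> R by rewrite ltr0n.
have := h2; rewrite leq_eqVlt => /orP[/eqP kN|kN]; last first.
  have kE : k = N.-1 by lia.
  rewrite kE (centerE N0 H Fa Fal); last by lia.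
  by rewrite prednK// divff ?gt_eqF// Fb /base eqxx mulrC.
rewrite kN /base eqxx ifF; last by lia.
rewrite /center leqnn /dfield.
set t := _ / _; have tE : t = 1 + N%:R^-1.
  by rewrite /t -natr1 -natr1 addrK mulrDl divff ?gt_eqF// mul1r.
have int1G : int1 G by exact: L2_int1 (H2rep_L2 H).
have -> : taylor a al G t = b + be / N%:R.
  rewrite /taylor -Fb -Fbe (H2rep_kernel H (t := 1)) ?lexx ?ler01//.
  rewrite (H2rep_h1 H (t := 1)) ?lexx ?ler01// Fa Fal.
  have -> : Int (fun u : R => ramp t u * G u) =
      Int (fun u : R => ramp 1 u * G u) + N%:R^-1 * Int (fun u : R => step 1 u * G u).
    rewrite -IntZ; last by apply: int1M => //; exact: bmf_step.
    rewrite -IntD; first last.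
    - by apply: int1Z; apply: int1M => //; exact: bmf_step.
    - by apply: int1M => //; exact: bmf_ramp.
    apply: eq_Int => u /andP[u0 u1]; have N1' : 0 < N%:R^-1 :> R by rewrite invr_gt0.
    have -> : step 1 u = 1 by rewrite /step u1.
    have tu : 0 <= t - u by rewrite tE; lra.
    have -> : ramp t u = t - u by rewrite /ramp max_l.
    have -> : ramp 1 u = 1 - u by rewrite /ramp max_l ?subr_ge0.
    by rewrite tE; ring.
  by rewrite tE; field; rewrite gt_eqF.
by field; rewrite gt_eqF.
Qed.

Lemma rho_pair_sqr_le n (x y : V) :
  (\sum_(j < n) rho x j * rho y j) ^+ 2 <= qR n x * qR n y.
Proof.
apply: quadratic_discr => [|l]; first exact: qR_ge0.
have -> : qR n y - 2 * l * (\sum_(j < n) rho x j * rho y j) + l ^+ 2 * qR n x =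
    \sum_(j < n) (rho y j - l * rho x j) ^+ 2.
  rewrite /qR !mulr_sumr -sumrB -big_split/=; apply: eq_bigr => j _; ring.
by apply: sumr_ge0 => j _; exact: sqr_ge0.
Qed.

(** The field is [center] plus a fluctuation. The Chernoff bound controls both signs of every
    coordinate of the fluctuation and of its cross term with the center, [2 * N.+2] functionals in
    all. The three errors [c] are the distance from [F] to [h], the fluctuation and the
    interpolation. *)
Lemma wgt_lower e N (F F1 G h : R -> R) (c d s eta : R) : (1 < N)%N -> H2rep F F1 G ->
  F 0 = a -> F1 0 = al -> (~~ free -> F 1 = b /\ F1 1 = be) ->
  0 <= c -> 0 <= eta -> 3 * c < d ->
  (forall x, 0 <= x <= 1 -> `|h x - F x| <= c) ->
  (`|al| + Int (fun x => `|G x|)) / N%:R <= c ->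
  2 * s * N.+2%:R ^+ 3 <= (c * N%:R ^+ 2) ^+ 2 ->
  2 * s * (N%:R * (Int (fun x => G x ^+ 2) + 1)) <= (eta * N%:R) ^+ 2 ->
  ((expR (- (N%:R * (half * Int (fun x => G x ^+ 2) + eta))) *
     (1 - (2 * N.+2)%:R * expR (- s)))%:E *
     Zpin free half (pin e (fun i => center G N i == 0%R)) N
   <= wgt a al b be free e N (uball h d))%E.
Proof.
move=> N1 H Fa Fal Fb c0 eta0 cd hF Lc sc se.
have N0 : (0 < N)%N by lia.
have N0' : 0 < N%:R :> R by rewrite ltr0n.
set E := Int _ in se *; have E0 : 0 <= E by apply: Int_ge0 => x _; exact: sqr_ge0.
set A := fun i => _; set X := expR _.
have LG := H2rep_L2 H; have int1G := L2_int1 LG.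
have FT x : 0 <= x <= 1 -> F x = taylor a al G x.
  by move=> x01; rewrite (H2rep_kernel H)// Fa Fal.
have D0 v := dens_ge0 a al N (uball h d) v.
rewrite wgtE//; apply: le_trans (Jop_le_Jm _ _ _ D0).
apply: (@le_trans _ _ (Jop (pin e A) 0 (nf N) (dens a al N (uball h d)) (bs N))); last first.
  apply: Jop_mono => // k _; rewrite /pin /full/=; split => //.
  by case: ifP => _ //=.
pose bb u := \sum_(j < N.+1) rho (dfield a al G N) j * rho (pad u) j.
pose B l u := if (l <= N)%N then u l else bb u.
pose L l u := if (l < N.+2)%N then B l u else - B (l - N.+2)%N u.
pose ix l := if (l < N.+2)%N then l else (l - N.+2)%N.
(* The variance bound is the Poincare inequality for a coordinate and Cauchy-Schwarz with the energy
   of the center for the cross term; [E + 1] keeps it positive. *)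
pose K l : R := if (ix l <= N)%N then N.+2%:R ^+ 3 else N%:R * (E + 1).
pose T l : R := if (ix l <= N)%N then c * N%:R ^+ 2 else eta * N%:R.
pose q u := qR N.+1 (pad u).
have linB l : lin (B l).
  rewrite (_ : B l = if (l <= N)%N then fun u => u l else bb); last first.
    by apply/funext => u; rewrite /B; case: ifP.
  case: ifP => _; first exact: lin_coord.
  apply: (@lin_sum _ N.+1 (fun j u => rho (dfield a al G N) j * rho (pad u) j)).
  by move=> j x u v; rewrite pad_linear (lin_rho j); ring.
have LB l u : L l u = B (ix l) u \/ L l u = - B (ix l) u.
  by rewrite /L /ix; case: ifP => _; [left|right].
have nq : nnq q.
  by have := @nnq_qRpad R 1 N.+1 ler01; under eq_fun do rewrite mul1r.
apply: (@chernoff_lower R (pin e A) (nf N) N.+1 (center G N) (bs N) q (2 * N.+2)%N L K T s X) => //.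
- exact: nfree_le.
- exact: base1.
- by rewrite /center ifF//; clear; lia.
- move=> u v h1 h2; apply: qR_ext => i iN; rewrite /pad; case: ifP => // i2.
  have [h3|h3] := ltnP (i - 2) (nf N); first by rewrite h1.
  have [-> ->] := h2 _ h3; move: h3; rewrite /nfree.
  case: ifPn => [_|fr]; first by move: iN i2; clear; lia.
  have [Fb1 Fbe] := Fb fr => h3.
  rewrite (center_base N1 H Fa Fal Fb1 Fbe) ?subrr//.
  by move: h3 iN i2; clear; lia.
- by move=> k _; have [->|/negbTE kA] := eqVneq (center G N k) 0; [left|right; rewrite /pin /A kA].
- apply: (@Zpin_fin_num R free half e (pin e A) N N0) => // i.
  by rewrite /pin/=; split => //; case: ifP => _ //=.
- by move=> l x u v; rewrite /L; case: ifP => _; rewrite linB//; ring.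
- by move=> l; rewrite /K; case: ifP => _; [rewrite exprn_gt0|rewrite mulr_gt0//; lra].
- by move=> l; rewrite /T; case: ifP => _; rewrite mulr_ge0// exprn_ge0// ltW.
- move=> l u; have -> : L l u ^+ 2 = B (ix l) u ^+ 2.
    by have [->|->] := LB l u; rewrite ?sqrrN.
  rewrite /B /K; case: ifP => lN.
    have := @sqr_le_qR _ N.+1 (pad u) (ix l).+2 erefl erefl lN.
    by rewrite /pad/= subn2.
  apply: le_trans (rho_pair_sqr_le _ _ _) _; rewrite ler_wpM2r ?qR_ge0//.
  by apply: le_trans (qR_dfield a al N0 LG) _; rewrite -/E ler_pM2l//; lra.
- by move=> l; rewrite /K /T; case: ifP.
- exact: expR_ge0.
move=> u u1 _ good.
have lt2 l : (l < N.+2)%N -> (l < 2 * N.+2)%N /\ (l + N.+2 < 2 * N.+2)%N.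
  by clear; lia.
have good' l : (l < N.+2)%N -> `|B l u| <= T l.
  move=> lN; have [l1 l2] := lt2 l lN; have h1 := good _ l1; have h2 := good _ l2.
  have nlt : (l + N.+2 < N.+2)%N = false by rewrite ltnNge leq_addl.
  rewrite /L lN in h1; rewrite /L nlt addnK in h2.
  have TE : T (l + N.+2)%N = T l by rewrite /T /ix nlt addnK lN.
  by rewrite TE in h2; rewrite ler_norml h1 andbT lerNl.
have goodu k : (k <= N)%N -> `|u k| <= c * N%:R ^+ 2.
  move=> kN; have kN2 : (k < N.+2)%N by rewrite ltnW.
  by have := good' k kN2; rewrite /T /B /ix kN2 kN.
have goodb : `|bb u| <= eta * N%:R.
  by have := good' N.+1 (ltnSn _); rewrite /T /B /ix ltnSn ltnn.
set f := fld_a a al N (center G N + u).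
have fE i : (i < N.+3)%N -> f i = dfield a al G N i + pad u i by exact: center_fld.
have inE : uball h d (profile N f).
  split.
    apply: lipschitz_C01 => x y x01 y01; exact: profile_lipschitz.
  move=> t; rewrite in_I01 => t01.
  have pn : `|profile N f t - F t| <= c + (`|al| + Int (fun x => `|G x|)) / N%:R.
    rewrite FT//; apply: profile_near => //.
    - by move=> x y _ _; exact: taylor_lipschitz.
    - by rewrite addr_ge0// Int_ge0.
    move=> k kN; rewrite fE; last by rewrite !ltnS; exact: leqW.
    have -> : dfield a al G N k.+1 = N%:R ^+ 2 * taylor a al G (k%:R / N%:R).
      by rewrite /dfield -natr1 addrK.
    have -> : (N%:R ^+ 2 * taylor a al G (k%:R / N%:R) + pad u k.+1) / N%:R ^+ 2 -
      taylor a al G (k%:R / N%:R) = pad u k.+1 / N%:R ^+ 2 by field; rewrite gt_eqF.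
    rewrite normrM [`|_^-1|]ger0_norm ?invr_ge0 ?exprn_ge0 ?(ltW N0')//.
    rewrite ler_pdivrMr ?exprn_gt0// /pad; case: ifP => k2.
      by rewrite normr0 mulr_ge0 ?exprn_ge0 ?(ltW N0').
    by apply: goodu; move: kN; clear; lia.
  have := hF t t01.
  have -> : h t - profile N f t = (h t - F t) - (profile N f t - F t) by ring.
  move=> hF'; apply: le_lt_trans (ler_normB _ _) _.
  by apply: le_lt_trans (lerD hF' pn) _; lra.
rewrite /dens -/f lee_fin indicE (mem_set (inE : ev N (uball h d) f)) mulr1 /X -expRD ler_expR.
rewrite HamE.
have -> : qR N.+1 f = qR N.+1 (dfield a al G N) + 2 * bb u + q u.
  rewrite /q /bb /qR mulr_sumr -!big_split/=; apply: eq_bigr => j _.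
  have jN := ltn_ord j.
  have -> : rho f j = rho (dfield a al G N) j + rho (pad u) j.
    by rewrite /rho !fE; [ring|rewrite !ltnS ?(ltnW jN)//..]; move: jN; clear; lia.
  by ring.
move: goodb => /ler_normlP[_ bN]; have := qR_dfield a al N0 LG; rewrite -/E.
move: bN; move: (qR N.+1 (dfield a al G N)) (q u) (bb u) => x y z; clear.
by move=> bN xE; lra.
Qed.

End LowerBound.

(** * Lower bounds with the sharp exponent *)

Section BallLower.
Context {R : realType}.
Notation V := (nat -> R).
Notation mu := (@lebesgue_measure R).
Notation half := (2^-1 : R).
Implicit Types (e : {nonneg R}) (A : pred nat).
Variables (a al b be : R) (free : bool).

Lemma Zpin_ge_zpA e : exists2 C, 0 < C & forall N A, (0 < N)%N ->
  ((C * zpA e A N.-1)%:E <= Zpin free half (pin e A) N)%E.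
Proof.
have h0 : 0 < half by rewrite invr_gt0.
pose k := (kap half)%:num; have k0 : 0 < k by exact: kap_gt0.
exists (if free then k ^+ 2 else 1); first by case: free; rewrite ?exprn_gt0.
move=> N A N0; have NE : N.+1 = N.-1.+2 by rewrite prednK.
rewrite EFinM -zpAE /Zpin /nfree; case: free; last by rewrite mul1e /ZP /eP NE.
have s1 := @ZP_succ _ half (pin e A) N.-1 h0 erefl.
have s2 := @ZP_succ _ half (pin e A) N.-1.+1 h0 erefl.
apply: (@le_trans _ _ (ZP half (pin e A) N.-1.+2)).
  apply: le_trans s2; rewrite expr2 EFinM -muleA.
  by apply: lee_wpmul2l => //; rewrite lee_fin ltW.
rewrite -NE; apply: le_Jop => v; first by rewrite lee_fin expR_ge0.
rewrite lee_fin ler_expR lerN2 ler_pM2l// -[N.+3]addn2 qR_cat lerDl; exact: qR_ge0.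
Qed.

Lemma truncn_bounds (x : R) : 0 <= x -> (Num.truncn x)%:R <= x < (Num.truncn x)%:R + 1.
Proof.
by move=> x0; rewrite natr1 truncnS_gt andbT truncn_le.
Qed.

Lemma zpA_contact e (eta : R) (M : nat) : 0 < eta -> exists2 C, 0 < C &
  forall N A (s t : nat -> R), (0 < N)%N ->
    (forall j, (j < M)%N -> [/\ 0 <= s j, s j <= t j & t j <= 1]) ->
    (forall j, (j.+1 < M)%N -> t j <= s j.+1) ->
    (forall j i, (j < M)%N -> (i < N)%N -> s j < i.+1%:R / N%:R <= t j -> A i) ->
  expR (N%:R * (rate_inf 0%:nng - eta + excess e * \sum_(j < M) (t j - s j))) <=
    C * zpA e A N.-1.
Proof.
move=> eta0; have [D D0 HD] := zpA_intervals e M eta0.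
rewrite -/(excess e) in HD; have ex0 := excess_ge0 e.
move: (rate_inf _) (excess e) HD ex0 => r ex HD ex0.
exists (D * expR (`|r - eta| + ex * M%:R)); first by rewrite mulr_gt0 ?expR_gt0.
move=> N A s t N0 st ts sA; have N0' : 0 < N%:R :> R by rewrite ltr0n.
(* Site [i] sits at time [(i+1)/N], so the sites with time in []s, t]] are those with
   [fl s <= i < fl t], up to the cap at the length of the chain. *)
pose fl (x : R) := minn (Num.truncn (N%:R * x)) N.-1.
have fl_mono x y : 0 <= x -> x <= y -> (fl x <= fl y)%N.
  move=> x0 xy; rewrite /fl leq_min geq_minr andbT; apply: leq_trans (geq_minl _ _) _.
  apply: le_truncn; exact: ler_wpM2l (ltW N0') _ _ xy.
have flle x : 0 <= x -> (fl x)%:R <= N%:R * x.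
  move=> x0; have := @truncn_bounds (N%:R * x) (mulr_ge0 (ltW N0') x0).
  by move=> /andP[h _]; apply: le_trans h; rewrite ler_nat geq_minl.
have flge x : 0 <= x -> x <= 1 -> N%:R * x - 1 <= (fl x)%:R.
  move=> x0 x1; have := @truncn_bounds (N%:R * x) (mulr_ge0 (ltW N0') x0).
  move=> /andP[_ h]; rewrite /fl /minn; case: ifP => _; first by lra.
  have -> : N.-1%:R = N%:R - 1 :> R by rewrite -[in RHS](prednK N0) -natr1 addrK.
  by rewrite lerB// ler_piMr// ltW.
have P1 j : (j < M)%N -> (fl (s j) <= fl (t j) <= N.-1)%N.
  by move=> jM; have [s0 st' t1] := st j jM; rewrite fl_mono//= geq_minr.
have P2 j : (j.+1 < M)%N -> (fl (t j) <= fl (s j.+1))%N.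
  move=> jM; have [s0 st' t1] := st j (ltnW jM); apply: fl_mono (ts j jM).
  exact: le_trans st'.
have P3 j i : (j < M)%N -> (fl (s j) <= i < fl (t j))%N -> A i.
  move=> jM /andP[pi iq]; have [s0 st' t1] := st j jM.
  have iN : (i < N.-1)%N by apply: leq_trans iq (geq_minr _ _).
  have t0 : 0 <= t j by exact: le_trans st'.
  apply: (sA j i jM); first by move: iN; clear; lia.
  rewrite ltr_pdivlMr// ler_pdivrMr// ![_ * N%:R]mulrC; apply/andP; split.
    have /andP[_ h] := @truncn_bounds (N%:R * s j) (mulr_ge0 (ltW N0') s0).
    apply: lt_le_trans h _; rewrite natr1 ler_nat ltnS.
    by move: pi iN; rewrite /fl; move: (Num.truncn _); clear; lia.
  by apply: le_trans (flle _ t0); rewrite ler_nat.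
have := HD A _ _ N.-1 P1 P2 P3.
move=> h; rewrite mulrAC; apply: le_trans (ler_wpM2r (expR_ge0 _) h) => {h}.
rewrite -expRD ler_expR.
have -> : N.-1%:R = N%:R - 1 :> R by rewrite -[in RHS](prednK N0) -natr1 addrK.
have S : N%:R * \sum_(j < M) (t j - s j) - M%:R <= \sum_(j < M) (fl (t j) - fl (s j))%:R.
  rewrite mulr_sumr -[M%:R]/(_ *+ M) -[M in X in _ - X]card_ord -sumr_const -sumrB.
  apply: ler_sum => j _; have [s0 st' t1] := st j (ltn_ord j).
  have t0 : 0 <= t j by exact: le_trans st'.
  rewrite natrB ?fl_mono//; have := flle _ s0; have := flge _ t0 t1; lra.
have := ler_wpM2l ex0 S; have := ler_norm (r - eta).
by move: (\sum_(j < M) (t j - s j)) (\sum_(j < M) _%:R) => x y; lra.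
Qed.

Lemma eventually_half (kappa : R) : 0 < kappa ->
  \forall N \near \oo, half <= 1 - (2 * N.+2)%:R * expR (- (kappa * N%:R)).
Proof.
move=> k0; have k2 : 0 < kappa / 2 by rewrite divr_gt0.
have [C C0 HC] := poly_le_expR 1 k2.
near=> N; have N1 : 1 <= N%:R :> R by rewrite ler1n; near: N; exact: nbhs_infty_gt.
have CN : 12 * C <= expR (N%:R * (kappa / 2)).
  by near: N; apply: eventually_prefactor => //; rewrite mulr_gt0.
suff : (2 * N.+2)%:R * expR (- (kappa * N%:R)) <= half by lra.
rewrite expRN ler_pdivrMr ?expR_gt0//.
have -> : kappa * N%:R = N%:R * (kappa / 2) + N%:R * (kappa / 2) by field.
rewrite expRD; have := HC N; rewrite expr1.
have -> : (2 * N.+2)%:R = 2 * (N%:R + 2) :> R by rewrite natrM -!natr1; ring.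
move: (expR _) (expR_gt0 (N%:R * (kappa / 2))) CN => x x0 CN CN'.
by have := ler_wpM2r (ltW x0) CN; lra.
Unshelve. all: by end_near. Qed.

Lemma ball_lower e (h h1 g : R -> R) (d eta : R) : H2rep h h1 g ->
  h 0 = a -> h1 0 = al -> (~~ free -> h 1 = b /\ h1 1 = be) -> 0 < d -> 0 < eta ->
  \forall N \near \oo, ((expR (N%:R * (rate_inf 0%:nng -
      (half * Int (fun x => g x ^+ 2) - excess e * fine (mu (zeros h))) - eta)))%:E
    <= wgt a al b be free e N (uball h d))%E.
Proof.
move=> H ha hal hb d0 eta0.
pose Lh := `|al| + Int (fun x => `|g x|).
have L0 : 0 <= Lh by rewrite addr_ge0// Int_ge0.
have hL x y : 0 <= x <= 1 -> 0 <= y <= 1 -> `|h x - h y| <= Lh * `|x - y|.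
  move=> x01 y01; rewrite (H2rep_kernel H x01) (H2rep_kernel H y01) hal.
  exact: (@taylor_lipschitz R (h 0) al g x y (L2_int1 (H2rep_L2 H))).
pose c := d / 4; have c0 : 0 < c by rewrite divr_gt0.
pose M := (Num.truncn (Lh / c)).+1.
have M0 : 0 < M%:R :> R by rewrite ltr0n.
have LM : Lh / M%:R <= c.
  rewrite ler_pdivrMr// -ler_pdivrMl// mulrC; apply/ltW.
  have := @truncn_bounds (Lh / c) (divr_ge0 L0 (ltW c0)); rewrite /M -natr1.
  by move=> /andP[].
have [s [t [F [F1 [G [HF [F0a F10] [F1b F11] [GE hF] [st FA Z]]]]]]] :=
  contact_cut H (ltn0Sn _ : (0 < M)%N) hL L0.
pose eta' := eta / 4; have eta0' : 0 < eta' by rewrite divr_gt0.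
have [C0 C00 HC0] := Zpin_ge_zpA e.
have [D D0 HD] := zpA_contact e M eta0'.
set E := Int (fun x => g x ^+ 2); set E' := Int _ in GE.
have E0 : 0 <= E' by apply: Int_ge0 => x _; exact: sqr_ge0.
(* The Chernoff exponent is [kappa * N]. Since [N.+2 <= 3 * N], coordinates require
   [2 * 3 ^ 3 * kappa <= c ^ 2]; the second entry comes from the cross term. *)
pose kappa := Num.min (c ^+ 2 / 54) (eta' ^+ 2 / (2 * (E' + 1))).
have E1 : 0 < 2 * (E' + 1) by lra.
have k0 : 0 < kappa by rewrite lt_min !divr_gt0 ?exprn_gt0.
have k1 : kappa * 54 <= c ^+ 2 by rewrite -ler_pdivlMr// ge_min lexx.
have k2 : kappa * (2 * (E' + 1)) <= eta' ^+ 2.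
  by rewrite -ler_pdivlMr// ge_min lexx orbT.
near=> N; have N1 : (1 < N)%N by near: N; exact: nbhs_infty_gt.
have N0 : (0 < N)%N by exact: ltnW.
have N0' : 1 <= N%:R :> R by rewrite ler1n.
pose A i := center a al G N i == 0.
have Fa : F 0 = a by rewrite F0a.
have Fal : F1 0 = al by rewrite F10.
have wl := @wgt_lower R a al b be free e N F F1 G h c d (kappa * N%:R) eta' N1 HF Fa Fal.
have {}wl := wl _ (ltW c0) (ltW eta0') _ _ _ _ _.
have st1 j : (j < M)%N -> [/\ 0 <= s j, s j <= t j & t j <= 1].
  move=> jM; have [h1' [h2 h3]] := st j jM; split => //.
    by apply: le_trans h1'; rewrite divr_ge0.
  by apply: le_trans h3 _; rewrite ler_pdivrMr// mul1r ler_nat.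
have zA := HD N A s t N0 st1 _ _.
have {}zA : expR (N%:R * (rate_inf 0%:nng - eta' + excess e * \sum_(j < M) (t j - s j))) <=
    D * zpA e A N.-1.
  apply: zA => [j jM|j i jM iN sit].
    have [_ [_ tj]] := st j (ltnW jM); have [sj _] := st j.+1 jM.
    exact: le_trans sj.
  by rewrite /A (centerE N0 HF Fa Fal iN) (FA j _ jM sit) mulr0.
apply: le_trans (wl _ _ _ _ _ _) => {wl}; first last.
- have -> : (eta' * N%:R) ^+ 2 = eta' ^+ 2 * (N%:R * N%:R) by ring.
  have -> : 2 * (kappa * N%:R) * (N%:R * (E' + 1)) = kappa * (2 * (E' + 1)) * (N%:R * N%:R) by ring.
  by rewrite ler_wpM2r ?mulr_ge0.
- have N3 : N.+2%:R <= 3 * N%:R :> R by rewrite -!natr1; lra.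
  have N33 : N.+2%:R ^+ 3 <= (3 * N%:R) ^+ 3 :> R by rewrite lerXn2r ?nnegrE ?mulr_ge0.
  have kN : 0 <= 2 * (kappa * N%:R) by rewrite !mulr_ge0// ltW.
  apply: le_trans (ler_wpM2l kN N33) _.
  have -> : 2 * (kappa * N%:R) * (3 * N%:R) ^+ 3 = kappa * 54 * N%:R ^+ 4 by ring.
  have -> : (c * N%:R ^+ 2) ^+ 2 = c ^+ 2 * N%:R ^+ 4 by ring.
  by rewrite ler_wpM2r ?exprn_ge0.
- rewrite mulrC; near: N; exact: near_inv_mul_le.
- by move=> x x01; apply: le_trans (hF x x01) LM.
- by rewrite /c; lra.
- by rewrite F1b F11.
rewrite -/E' -/A; have Zh := HC0 N A N0.
have hN : half <= 1 - (2 * N.+2)%:R * expR (- (kappa * N%:R)).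
  by near: N; exact: eventually_half.
have CN : 2 * D / C0 <= expR (N%:R * (2 * eta')).
  by near: N; apply: eventually_prefactor; rewrite ?divr_gt0 ?mulr_gt0.
apply: (@le_trans _ _ ((expR (- (N%:R * (half * E' + eta'))) * half)%:E * (C0 * zpA e A N.-1)%:E)%E); last first.
  apply: lee_pmul => //; rewrite ?lee_fin ?mulr_ge0 ?expR_ge0 ?invr_ge0 ?(ltW C00) ?zpA_ge0//.
  by rewrite ler_wpM2l ?expR_ge0.
rewrite -EFinM lee_fin; move: (zpA e A N.-1) zA CN => z zA CN.
set T := expR _; have T0 : 0 <= T by exact: expR_ge0.
suff : T * (2 * D / C0) <= expR (- (N%:R * (half * E' + eta'))) * (D * z).
  rewrite -ler_pdivlMr ?divr_gt0 ?mulr_gt0//; congr (_ <= _); field.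
  by rewrite !gt_eqF.
apply: le_trans (ler_wpM2l T0 CN) _; apply: le_trans (ler_wpM2l (expR_ge0 _) zA).
rewrite /T -!expRD ler_expR.
have ex0 := excess_ge0 e; have := ler_wpM2l ex0 Z.
have -> : eta = 4 * eta' by rewrite /eta'; field.
have N00 : 0 <= N%:R :> R by [].
move: GE; rewrite -/E; move: (rate_inf _) (excess e) (fine _) (\sum_(j < M) _) => r ex z' S.
move: (E) (E') (eta') (N%:R) N00 => x x' y n n0 xx zS.
have : r - (half * x - ex * z') - 4 * y + 2 * y <= - (half * x' + y) + (r - y + ex * S) by lra.
by move=> /(ler_wpM2l n0); lra.
Unshelve. all: by end_near. Qed.

End BallLower.

(** * Compactness *)

Section Compactness.
Context {R : realType}.
Notation C01 := (@C01 R).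
Notation openC := (@Defs.openC R).
Notation closedC := (@Defs.closedC R).
Implicit Types (f g : R -> R) (K : set (R -> R)) (d L a x y : R).

Lemma openC_ext (O : set (R -> R)) f g : openC O -> C01 g ->
  (forall t, 0 <= t <= 1 -> f t = g t) -> O f -> O g.
Proof.
move=> [_ OO] cg fg /OO[d d0]; apply; split => // t; rewrite in_I01 => /fg ->.
by rewrite subrr normr0.
Qed.

(** The uniform margin makes openness immediate; strict pointwise inequalities would require that a
    supremum be attained. *)
Definition oball f d : set (R -> R) :=
  [set g | C01 g /\ exists2 eta, 0 < eta & forall t, 0 <= t <= 1 -> `|f t - g t| <= d - eta].

Lemma oball_uball f d : oball f d `<=` uball f d.
Proof.
move=> g [cg [eta eta0 fg]]; split => // t; rewrite in_I01 => /fg h.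
by apply: le_lt_trans h _; rewrite ltrBlDr ltrDl.
Qed.

Lemma openC_oball f d : openC (oball f d).
Proof.
split=> [g []//|g [cg [eta eta0 fg]]]; exists (eta / 2); first by rewrite divr_gt0.
move=> k [ck gk]; split => //; exists (eta / 2) => [|t t01]; first by rewrite divr_gt0.
have := gk t; rewrite in_I01 => /(_ t01) h1; have h2 := fg t t01.
apply: le_trans (ler_distD (g t) _ _) _.
by apply: le_trans (lerD h2 (ltW h1)) _; lra.
Qed.

Lemma oball_center f d : C01 f -> 0 < d -> oball f d f.
Proof.
by move=> cf d0; split => //; exists d => // t _; rewrite !subrr normr0.
Qed.

Definition clamp x : R := Num.min 1 (Num.max 0 x).

Lemma clamp01 x : 0 <= clamp x <= 1.
Proof. by rewrite /clamp le_min ler01 ge_min lexx le_max lexx. Qed.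

Lemma clamp_id x : 0 <= x <= 1 -> clamp x = x.
Proof. by move=> /andP[x0 x1]; rewrite /clamp max_r// min_r. Qed.

Lemma clamp_lipschitz x y : `|clamp x - clamp y| <= `|x - y|.
Proof.
have clE z : [\/ z <= 0 /\ clamp z = 0, 0 <= z <= 1 /\ clamp z = z | 1 <= z /\ clamp z = 1].
  have [z0|z0] := leP z 0.
    by constructor 1; rewrite /clamp max_l// min_r.
  have [z1|z1] := leP z 1; first by constructor 2; rewrite clamp_id ?(ltW z0).
  by constructor 3; rewrite (ltW z1) /clamp max_r ?(ltW z0)// min_l ?(ltW z1).
have := ler_norm (x - y); have := ler_norm (y - x); rewrite -(distrC x y) ler_norml.
move: (`|x - y|) (normr_ge0 (x - y)) => n n0 h1 h2.
by case: (clE x) => -[hx ->]; case: (clE y) => -[hy ->]; apply/andP; split;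
  try case/andP: hx => ? ?; try case/andP: hy => ? ?; lra.
Qed.

(* Pointwise topology on the globally [L]-Lipschitz extensions: Tychonoff
   gives compactness, and on an equi-Lipschitz family finitely many
   evaluations control the uniform distance. *)
Lemma lipset_compact a L : 0 <= L -> compactC (lipset a L).
Proof.
move=> L0; split=> [|I U oU cov]; first exact: lipset_C01.
pose T := prod_topology (fun _ : R => R^o : topologicalType).
pose box : set T := [set f | forall x, `[a - L * `|x|, a + L * `|x|]%classic (f x)].
have cbox : compact box.
  exact: (@tychonoff R (fun _ => R^o) (fun x => `[a - L * `|x|, a + L * `|x|]%classic)
    (fun x => @segment_compact R _ _)).
pose glip (f : T) := f 0 = a /\ forall x y, `|f x - f y| <= L * `|x - y|.
(* Finite index sets directed by inclusion: a property holding along this filter holds for some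
   finite subfamily. *)
pose Fin : set_system (set I) := fun P => exists2 J, finite_set J &
  forall J', finite_set J' -> J `<=` J' -> P J'.
have FF : Filter Fin.
  split.
  - by exists set0.
  - move=> P Q [J fJ PJ] [J' fJ' QJ']; exists (J `|` J'); first by rewrite finite_setU.
    move=> K fK JK; split.
      by apply: PJ => // i Ji; apply: JK; left.
    by apply: QJ' => // i Ji; apply: JK; right.
  - by move=> P Q PQ [J fJ PJ]; exists J => // K fK JK; exact/PQ/PJ.
have evn (f : T) x eta : 0 < eta -> \forall f' \near f, `|f x - f' x| < eta.
  move=> eta0; have := @proj_continuous R (fun _ => R^o) x f.
  move=> /(_ (ball (f x) eta)); apply; exact: nbhsx_ballx.
have evs (f : T) (xs : nat -> R) n eta : 0 < eta ->
    \forall f' \near f, forall k, (k < n)%N -> `|f (xs k) - f' (xs k)| < eta.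
  move=> eta0; have FN : Filter (nbhs f) := nbhs_filter f.
  elim: n => [|n IH]; first by apply: filterS filterT => f' _ k; rewrite ltn0.
  apply: filterS (filterI IH (evn f (xs n) eta eta0)) => f' [h1 h2] k.
  by rewrite ltnS leq_eqVlt => /orP[/eqP->|/h1].
pose P (J : set I) (f : T) := glip f -> exists2 i, J i & U i f.
have key : Fin (fun J => box `<=` P J).
  apply: ((compact_near_coveringP box).1 cbox (set I) Fin P FF) => f bf.
  have f0 : f 0 = a.
    have := bf 0; rewrite normr0 mulr0 subr0 addr0 /= in_itv/= => h.
    by apply/eqP; rewrite eq_le andbC.
  have [gf|ngf] := pselect (forall x y, `|f x - f y| <= L * `|x - y|).
    have lf : lipset a L f by split => // x y _ _; exact: gf.
    have [i _ Uf] := cov f lf; have [_ /(_ f Uf)[d d0 dU]] := oU i.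
    pose n := (Num.truncn (4 * L / d)).+1.
    have n0 : 0 < n%:R :> R by rewrite ltr0n.
    have Ln : L / n%:R <= d / 4.
      have /andP[_] := @truncn_bounds R (4 * L / d) (divr_ge0 (mulr_ge0 (ler0n _ _) L0) (ltW d0)).
      by rewrite natr1 ltr_pdivrMr// ler_pdivrMr// -/n; move: (n%:R) => m h; lra.
    exists ([set f' : T | forall k, (k < n.+1)%N -> `|f (k%:R / n%:R) - f' (k%:R / n%:R)| < d / 4],
            [set J : set I | J i]).
      split; first by apply: (evs f (fun k => k%:R / n%:R)); rewrite divr_gt0.
      by exists [set i] => // J' _; apply.
    move=> [f' J] /= [ff' Ji] [f'0 gf']; exists i => //; apply: dU; split.
      by apply: (@lipschitz_C01 _ _ L) => x y _ _; exact: gf'.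
    move=> t; rewrite in_I01 => /andP[t0 t1].
    pose k := Num.truncn (n%:R * t).
    have /andP[k1 k2] := @truncn_bounds R (n%:R * t) (mulr_ge0 (ltW n0) t0).
    have kn : (k < n.+1)%N.
      by rewrite ltnS -(ler_nat R); apply: le_trans k1 _; rewrite ler_piMr// ltW.
    have tk : `|t - k%:R / n%:R| <= n%:R^-1.
      rewrite ger0_norm; last by rewrite subr_ge0 ler_pdivrMr// mulrC.
      have -> : t - k%:R / n%:R = (n%:R * t - k%:R) / n%:R by field; rewrite gt_eqF.
      by rewrite ler_pdivrMr// mulVf ?gt_eqF// lerBlDr addrC ltW.
    have LL : L * `|t - k%:R / n%:R| <= d / 4.
      by apply: le_trans Ln; exact: ler_wpM2l.
    have h1 := le_trans (gf t (k%:R / n%:R)) LL.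
    have h2 := le_trans (gf' t (k%:R / n%:R)) LL; have h3 := ff' k kn.
    have -> : f t - f' t = (f t - f (k%:R / n%:R)) + (f (k%:R / n%:R) - f' (k%:R / n%:R)) -
      (f' t - f' (k%:R / n%:R)) by ring.
    apply: le_lt_trans (ler_normB _ _) _; apply: le_lt_trans (lerD (ler_normD _ _) (lexx _)) _.
    by move: h1 h2 h3; move: `|_| `|_| `|_| => x y z; lra.
  have [x /existsNP[y /negP]] : exists x, ~ forall y, `|f x - f y| <= L * `|x - y|.
    exact/existsNP.
  rewrite -ltNge -subr_gt0 => gap0; set gap := _ - _ in gap0.
  exists ([set f' : T | `|f x - f' x| < gap / 2 /\ `|f y - f' y| < gap / 2], setT).
    split; last by exists set0.
    by apply: filterI; apply: evn; rewrite divr_gt0.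
  move=> [f' J] /= [[h1 h2] _] [_ /(_ x y) gf']; exfalso.
  have : `|f x - f y| <= `|f x - f' x| + `|f' x - f' y| + `|f y - f' y|.
    have -> : f x - f y = (f x - f' x) + (f' x - f' y) - (f y - f' y) by ring.
    by apply: le_trans (ler_normB _ _) _; rewrite lerD2r ler_normD.
  have gapE : `|f x - f y| = gap + L * `|x - y| by rewrite /gap; ring.
  have ar (u v w l p : R) : u < p / 2 -> v < p / 2 -> w <= l -> p + l <= u + w + v -> False.
    by move=> *; lra.
  by rewrite gapE; exact: ar h1 h2 gf'.
have [J fJ covJ] := key; exists J => // g lg.
have [g0 gL] := lg.
have lgc : glip (fun x => g (clamp x)).
  split; first by rewrite clamp_id ?lexx ?ler01.
  move=> x y; apply: le_trans (gL _ _ (clamp01 x) (clamp01 y)) _.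
  by rewrite ler_wpM2l// clamp_lipschitz.
have bg : box (fun x => g (clamp x)).
  move=> x; have := lgc.2 x 0; rewrite lgc.1 subr0 ler_distl => /andP[h1 h2].
  by rewrite /= in_itv/= h1.
have [i Ji Ui] := covJ _ fJ (fun i => id) _ bg lgc.
exists i => //; apply: (openC_ext (oU i) _ _ Ui); first exact: lipset_C01 lg.
by move=> t t01; rewrite clamp_id.
Unshelve. all: by end_near. Qed.

Lemma closed_sub_compact K K' : compactC K -> closedC K' -> K' `<=` K -> compactC K'.
Proof.
move=> [KC cK] [K'C oK'] K'K; split => // I U oU cov.
pose U' (o : option I) := if o is Some i then U i else C01 `\` K'.
have [] := cK _ U'.
- by case.
- move=> f Kf; have [K'f|nK'] := pselect (K' f).
    by have [i _ Uf] := cov f K'f; exists (Some i).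
  by exists None => //; split => //; exact: KC.
move=> J fJ covJ; exists [set i | J (Some i)].
  by apply: (finite_preimage (f := Some)) => // i j _ _ [].
move=> f K'f; have [[i|] Ji Uf] := covJ f (K'K _ K'f); first by exists i.
by case: Uf.
Qed.

End Compactness.

(** * Limits superior and inferior at exponential scale *)

Section Limits.
Context {R : realType}.
Implicit Types (u : nat -> \bar R) (c p : R).

Lemma limn_esup_le u (c : \bar R) : (\forall N \near \oo, (u N <= c)%E) -> (limn_esup u <= c)%E.
Proof.
move=> uc; apply: (@le_trans _ _ (ereal_sup (u @` [set N | (u N <= c)%E]))).
  by apply: ereal_inf_lbound; exists [set N | (u N <= c)%E].
by apply: ge_ereal_sup => _ [N uN <-].
Qed.

Lemma limn_einf_ge u (c : \bar R) : (\forall N \near \oo, (c <= u N)%E) -> (c <= limn_einf u)%E.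
Proof.
move=> uc; rewrite /limn_einf leeNr; apply: limn_esup_le.
by near=> N; rewrite leeN2; near: N.
Unshelve. all: by end_near. Qed.

Lemma le_lne_expR N c p : (0 < N)%N -> expR (N%:R * c) <= p ->
  (c%:E <= (N%:R^-1)%:E * lne p%:E)%E.
Proof.
move=> N0 cp; have p0 : 0 < p by apply: lt_le_trans cp; exact: expR_gt0.
rewrite lne_EFin// -EFinM lee_fin ler_pdivlMl ?ltr0n//.
by rewrite -[leLHS]expRK ler_ln ?posrE ?expR_gt0.
Qed.

Lemma lne_le_expR N c p : (0 < N)%N -> p <= expR (N%:R * c) ->
  ((N%:R^-1)%:E * lne p%:E <= c%:E)%E.
Proof.
move=> N0 cp; have [p0|p0] := leP p 0.
  rewrite le0_lneNy ?lee_fin// gt0_muleNy ?leNye// lte_fin invr_gt0 ltr0n//.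
rewrite lne_EFin// -EFinM lee_fin ler_pdivrMl ?ltr0n//.
by rewrite -[leRHS]expRK ler_ln ?posrE ?expR_gt0.
Qed.

End Limits.

(** * The large deviation principle *)

Section FreeEnergy.
Context {R : realType}.
Notation half := (2^-1 : R).
Implicit Types (e : {nonneg R}).

Lemma lt_ereal_real (x y : \bar R) : (x < y)%E -> exists2 z : R, (x < z%:E)%E & (z%:E < y)%E.
Proof.
case: x y => [x| |] [y| |] //=.
- rewrite lte_fin => xy; exists ((x + y) / 2); rewrite lte_fin; lra.
- by exists (x + 1); rewrite ?ltry// lte_fin ltrDl.
- by exists (y - 1); rewrite ?ltNyr// lte_fin gtrDl oppr_lt0.
- by exists 0; rewrite ?ltNyr ?ltry.
Qed.

Lemma le_Jm e n (F G : (nat -> R) -> \bar R) w : (forall v, 0 <= F v)%E ->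
  (forall v, F v <= G v)%E -> (Jm e n F w <= Jm e n G w)%E.
Proof.
move=> F0 FG; elim: n w => //= n IH w; rewrite !ImE.
by apply: nonmeasurable_le_integral => x; [exact: Jm_ge0|exact: IH].
Qed.

Lemma Z_r0E e N : (0 < N)%N -> Z_r0 e N = (zp e N.-1)%:E.
Proof.
move=> N0; have -> : Z_r0 e N = wgt 0 0 0 0 false e N setT by [].
rewrite wgtE// /nfree -zpE.
have -> : dens 0 0 N setT = (fun w => (expR (- (half * qR N.+1 (pad w))))%:E).
  apply/funext => w; rewrite /dens indicE mem_set// mulr1 HamE; congr (expR (- (_ * _)))%:E.
  apply: qR_ext => -[|[|i]] _; rewrite /fld_a /pad/= ?mul0r ?subr0//.
have nq : nnq (fun w => half * qR N.+1 (pad w)) by apply: nnq_qRpad; rewrite invr_ge0.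
rewrite (Jm_GS e N.-1 _ (GS_expR nq)) /ZP /eP prednK//.
apply: eq_Jop2 => [v|v|v v' h1 h2]; [by rewrite lee_fin expR_ge0..|].
congr (expR (- (_ * _)))%:E; apply: qR_ext => i iN; rewrite /pad; case: ifP => // i2.
have [k1|k1] := boolP (0 <= i - 2 < 0 + N.-1)%N; first by rewrite h1.
have [-> ->] := h2 _ k1; rewrite /base !mul0r addr0; case: eqP => // hN1; case: eqP => // hN.
by move: k1 iN i2 hN1 hN N0; clear; lia.
Qed.

Lemma tau_excess e : tau e = excess e.
Proof.
rewrite /tau /excess; apply/cvg_lim => //.
have := @free_energy_cvg R e; apply: cvg_trans; apply: near_eq_cvg; near=> N.
have N0 : (0 < N)%N by near: N; exact: nbhs_infty_gt.
by rewrite !Z_r0E.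
Unshelve. all: by end_near. Qed.

End FreeEnergy.

(** * Costs, local bounds and level sets *)

Section LargeDeviations.
Context {R : realType}.
Notation mu := (@lebesgue_measure R).
Notation half := (2^-1 : R).
Notation C01 := (@C01 R).
Notation openC := (@Defs.openC R).
Notation closedC := (@Defs.closedC R).
Implicit Types (f g h : R -> R) (x d eta c : R) (O K E : set (R -> R)) (N : nat).
Variables (a al b be : R) (free : bool) (e : {nonneg R}).
Notation wgt := (wgt a al b be free e).
Notation ubd := (ubd a al b be free e).
Notation r0 := (@rate_inf R 0%:nng).

Definition adm h g := exists h1, [/\ H2rep h h1 g, h 0 = a, h1 0 = al &
  ~~ free -> h 1 = b /\ h1 1 = be].

Definition cost h g : R := half * Int (fun t => g t ^+ 2) - excess e * fine (mu (zeros h)).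

Lemma SigmaE h g : adm h g -> Sigma e h g = (cost h g)%:E.
Proof.
move=> [h1 [H _ _ _]]; rewrite /Sigma tau_excess.
have -> : (cost h g)%:E = (half%:E * (Int (fun t => g t ^+ 2))%:E -
  (excess e)%:E * (fine (mu (zeros h)))%:E)%E by [].
rewrite IntE; last exact: L2_int1_sqr (H2rep_L2 H).
congr (_ - _ * _)%E; rewrite fineK// ge0_fin_numE//.
exact: zeros_lt_pinfty (H2rep_C01 H).
Qed.

Lemma cost_ge h g : adm h g -> - excess e <= cost h g.
Proof.
move=> [h1 [H _ _ _]]; have m1 : fine (mu (zeros h)) <= 1.
  rewrite -[leRHS]/(fine 1%E) fine_le//.
    by rewrite ge0_fin_numE//; exact: zeros_lt_pinfty (H2rep_C01 H).
  rewrite -mu_I01 le_measure ?inE//; [exact: measurable_zeros (H2rep_C01 H)|exact: measurable_I01|].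
  by move=> t [+ _] => /set_mem.
have := ler_wpM2l (excess_ge0 e) m1; rewrite mulr1 /cost.
have : 0 <= half * Int (fun t => g t ^+ 2).
  by rewrite mulr_ge0 ?invr_ge0// Int_ge0// => t _; exact: sqr_ge0.
by move: (excess e * _) (half * _) => x y; lra.
Qed.

Lemma adm_nonempty : exists h g, adm h g.
Proof.
(* The second derivative takes two values with a jump at 1/2; [p] and [q] solve [p + q/2 = be - al]
   and [p/2 + 3q/8 = b - a - al]. *)
pose q : R := 8 * (b - a - al) - 4 * (be - al); pose p : R := be - al - q / 2.
pose g (u : R) := p * 1 + q * step 2^-1 u.
have hh : 0 <= half <= 1 by apply/andP; split; lra.
have bg : bmf g by apply: bmfD; apply: bmfZ; [exact: bmf_cst|exact: bmf_step].
have [H f0 f1] := @kernel_H2rep R a al (taylor a al g) g (bmf_L2 bg) (fun t _ => erefl).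
exists (taylor a al g), g; eexists; split; [exact: H|exact: f0|exact: f1|] => _.
have i1 : int1 (fun=> 1 : R) by apply: bmf_int1; exact: bmf_cst.
have is_ t : int1 (step t : R -> R) by apply: bmf_int1; exact: bmf_step.
have ir t : int1 (ramp t : R -> R) by apply: bmf_int1; exact: bmf_ramp.
have Ig : Int (fun x => step 1 x * g x) = p + q * half.
  transitivity (Int g).
    by apply: eq_Int => u /andP[u0 u1]; rewrite /step u1 mul1r.
  by rewrite (IntD (int1Z p i1) (int1Z q (is_ half))) (IntZ p i1) (IntZ q (is_ half)) Int_cst Int_step// mulr1.
have Irg : Int (fun x => ramp 1 x * g x) = p * half + q * (3 / 8).
  transitivity (Int (fun x => p * ramp 1 x + (q * ramp half x + q * half * step half x))).
    apply: eq_Int => u /andP[u0 u1]; rewrite /g /step /ramp max_l ?subr_ge0//.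
    case: leP => uh; [rewrite max_l ?subr_ge0// mulr1n|rewrite max_r ?subr_le0 ?ltW// mulr0n]; by field.
  have iz t (z : R) : int1 (fun x => z * ramp t x) by apply: int1Z.
  have iz' t (z : R) : int1 (fun x => z * step t x) by apply: int1Z.
  rewrite IntD ?IntD ?IntZ ?Int_ramp ?Int_step ?lexx ?ler01//; last exact: int1D.
  by field.
by rewrite /taylor Irg Ig /p /q; split; field.
Qed.

Definition costs := [set x | exists h g, adm h g /\ x = cost h g].
Definition sigma : R := inf costs.

Lemma costs_inf : has_inf costs.
Proof.
split; first by have [h [g hg]] := adm_nonempty; exists (cost h g), h, g.
by exists (- excess e) => _ [h [g [hg ->]]]; exact: cost_ge.
Qed.

Lemma sigma_le h g : adm h g -> sigma <= cost h g.
Proof. by move=> hg; apply: ge_inf; [exact: costs_inf.2|exists h, g]. Qed.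

Lemma sigma_near eta : 0 < eta -> exists h g, adm h g /\ cost h g < sigma + eta.
Proof.
move=> eta0; have [_ [h [g [hg ->]]] lt] := inf_adherent eta0 costs_inf.
by exists h, g.
Qed.

(** Either some test kernel certifies the bound, or all tilts are bounded and the representation
    yields an admissible [g] of cost at most [x], a contradiction. For [f] outside H^2 this works
    for every [x]. *)
Lemma local_ubd f x : C01 f -> (forall g, adm f g -> x < cost f g) ->
  exists2 d, 0 < d & \forall N \near \oo, ubd N (uball f d) (expR (N%:R * (r0 - x))).
Proof.
move=> cf fx; set Z := excess e * fine (mu (zeros f)).
have [[k [B [ok kB xlt]]]|noK] := pselect (exists k B, [/\ test_ok free k,
    (\forall N \near \oo, ksq k N <= B) & x < Lam a al b be k f - half * B - Z]).
  exact: ball_ubd ok kB xlt.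
have [|h1 [g [H Eg f0 f1 fb]]] := @rate_representation R a al b be free f (x + Z).
  move=> k B ok kB; rewrite leNgt; apply/negP => lt; apply: noK; exists k, B; split => //.
  by rewrite ltrBrDr.
have := fx g; rewrite /cost -/Z => /(_ _)/wrap[]; first by exists h1.
by rewrite ltNge lerBlDr Eg.
Qed.

Lemma ubd_set0 N E X : E `<=` set0 -> 0 <= X -> ubd N E X.
Proof.
move=> E0 X0; exists 0%N, (fun _ => predT), (fun _ _ => 0), (fun _ => (fun w => 0 * (expR (- 0))%:E)%E); split.
- by move=> _; apply: GS1 => //; split => //; exists (fun _ _ => 0) => //; split => // v c u u'; rewrite mulr0 addr0.
- move=> v _; rewrite big_ord0 /dens indicE memNset ?mulr0// => Ev; exact: E0 Ev.
- by rewrite big_ord0 lee_fin.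
Qed.

(** Off a compact Lipschitz set the tightness bound applies; finitely many local balls cover the
    rest of [K], and their number is absorbed by [eta]. *)
Lemma closed_ubd K x eta : openC (C01 `\` K) -> (forall f g, K f -> adm f g -> x < cost f g) ->
  0 < eta -> \forall N \near \oo, ubd N K (expR (N%:R * (r0 - x + eta))).
Proof.
move=> oK Kx eta0.
(* The radius is chosen for all functions at once; off [K] it is 0 and the ball is empty. *)
have /choice[d dP] f : exists d, (K f -> C01 f -> 0 < d) /\
    \forall N \near \oo, ubd N (uball f d) (expR (N%:R * (r0 - x))).
  have [[Kf cf]|nf] := pselect (K f /\ C01 f).
    by have [d d0 dU] := local_ubd cf (fun g => Kx f g Kf); exists d.
  exists 0; split => [Kf cf|]; first by case: nf.
  apply: nearW => N; apply: ubd_set0; last exact: expR_ge0.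
  by move=> g [_ /(_ 0)]; rewrite in_I01 lexx ler01 => /(_ isT); rewrite ltNge normr_ge0.
have [L L0 tight] := tight_ubd a al b be free e x.
pose U (o : option (R -> R)) := if o is Some f then oball f (d f) else C01 `\` K.
have [||J fJ covJ] := (lipset_compact a L0).2 _ U.
- by case => [f|]//; exact: openC_oball.
- move=> f lf; have cf := lipset_C01 lf.
  have [Kf|nKf] := pselect (K f); last by exists None.
  by exists (Some f) => //; apply: oball_center => //; exact: (dP f).1.
have [s sJ] : exists s : seq (option (R -> R)), J = [set` s] by exact/finite_seqP.
have cov (t : seq (option (R -> R))) : \forall N \near \oo,
    ubd N [set g | exists2 f, Some f \in t & uball f (d f) g] ((size t)%:R * expR (N%:R * (r0 - x))).
  elim: t => [|o t IH].
    by apply: nearW => N; apply: ubd_set0; [move=> g []|rewrite mul0r].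
  case: o => [f|]; last first.
    apply: filterS IH => N h; apply: ubdS (ubd_le _ h).
      by move=> g [f]; rewrite inE/= => ft fg; exists f.
    by rewrite ler_wpM2r ?expR_ge0// ler_nat.
  have Hf := (dP f).2; near=> N.
  have h1 : ubd N (uball f (d f)) (expR (N%:R * (r0 - x))) by near: N.
  have h2 : ubd N [set g | exists2 f, Some f \in t & uball f (d f) g]
    ((size t)%:R * expR (N%:R * (r0 - x))) by near: N.
  rewrite /= -natr1 mulrDl mul1r addrC; apply: ubdU h1 h2 => g [f'].
  by rewrite inE => /orP[/eqP[->]|f't] fg; [left|right; exists f'].
have n0 : 0 < 1 + (size s)%:R :> R by rewrite ltr_pwDl.
have pre := eventually_prefactor n0 eta0; have covs := cov s; near=> N.
have h1 : ubd N (~` lipset a L) (expR (N%:R * (r0 - x))) by near: N.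
have h2 : ubd N [set g | exists2 f, Some f \in s & uball f (d f) g]
  ((size s)%:R * expR (N%:R * (r0 - x))) by near: N.
have h3 : 1 + (size s)%:R <= expR (N%:R * eta) by near: N.
apply: ubd_le (ubdU _ h1 h2).
  rewrite [in leRHS]mulrDr expRD [leRHS]mulrC.
  by apply: le_trans (ler_wpM2r (expR_ge0 _) h3); rewrite mulrDl mul1r.
move=> g Kg; have [lg|] := pselect (lipset a L g); last by left.
right; have [[f|] Jo /= Ug] := covJ g lg; last by case: Ug.
by exists f; [move: Jo; rewrite sJ|exact: oball_uball].
Unshelve. all: by end_near. Qed.

Lemma wgt_mono N E E' : (0 < N)%N -> E `<=` E' -> (wgt N E <= wgt N E')%E.
Proof.
move=> N0 EE; rewrite !wgtE//; apply: le_Jm => v; first exact: dens_ge0.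
rewrite lee_fin ler_wpM2l ?expR_ge0// !indicE ler_nat.
by have [/set_mem/EE h|//] := boolP (_ \in ev N E); rewrite (mem_set (h : ev N _ _)).
Qed.

Lemma wgt_ge0 N E : (0 < N)%N -> (0 <= wgt N E)%E.
Proof. by move=> N0; rewrite wgtE//; apply: Jm_ge0 => v; exact: dens_ge0. Qed.

Lemma adm_ball_lower h g d eta : adm h g -> 0 < d -> 0 < eta ->
  \forall N \near \oo, ((expR (N%:R * (r0 - cost h g - eta)))%:E <= wgt N (uball h d))%E.
Proof. by move=> [h1 [H h0 h10 hb]] d0 eta0; exact: ball_lower H h0 h10 hb d0 eta0. Qed.

(** The upper bound on [E] and the lower bound on a ball inside it are compatible for large [N] only
    if [x] is at most the cost. *)
Lemma ubd_cost h g d E x : adm h g -> 0 < d -> uball h d `<=` E ->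
  (\forall N \near \oo, ubd N E (expR (N%:R * (r0 - x)))) -> x <= cost h g.
Proof.
move=> hg d0 hE ub; rewrite leNgt; apply/negP => cx.
pose eta := (x - cost h g) / 2; have eta0 : 0 < eta by rewrite divr_gt0// subr_gt0.
have lo := adm_ball_lower hg d0 eta0.
have [N [N0 []]] : exists N, (0 < N)%N /\ (ubd N E (expR (N%:R * (r0 - x))) /\
    ((expR (N%:R * (r0 - cost h g - eta)))%:E <= wgt N (uball h d))%E).
  have : \forall N \near \oo, (0 < N)%N /\ (ubd N E (expR (N%:R * (r0 - x))) /\
    ((expR (N%:R * (r0 - cost h g - eta)))%:E <= wgt N (uball h d))%E).
    by near=> N; split; [near: N; exact: nbhs_infty_gt|split; near: N].
  by move=> /filter_ex[N]; exists N.
move=> /(ubd_wgt N0) h1 h2; have := le_trans h2 (le_trans (wgt_mono N0 hE) h1).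
rewrite lee_fin ler_expR ler_pM2l ?ltr0n//; rewrite /eta; move: (r0) (cost h g) cx => r z zx; lra.
Unshelve. all: by end_near. Qed.

Lemma wgt_setT_bounds eta : 0 < eta -> \forall N \near \oo,
  [/\ wgt N setT \is a fin_num, expR (N%:R * (r0 - sigma - eta)) <= fine (wgt N setT) &
   fine (wgt N setT) <= expR (N%:R * (r0 - sigma + eta))].
Proof.
move=> eta0; have eta2 : 0 < eta / 2 by rewrite divr_gt0.
have [h [g [hg hs]]] := sigma_near eta2.
have lo := adm_ball_lower hg ltr01 eta2.
(* Taking [sigma - eta / 2] gives the strict inequality that [closed_ubd] asks for. *)
have up : \forall N \near \oo, ubd N setT (expR (N%:R * (r0 - (sigma - eta / 2) + eta / 2))).
  apply: closed_ubd => // [|f g' _ /sigma_le]; last by lra.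
  by rewrite setDT; split.
near=> N; have N0 : (0 < N)%N by near: N; exact: nbhs_infty_gt.
have h1 : (wgt N setT <= (expR (N%:R * (r0 - (sigma - eta / 2) + eta / 2)))%:E)%E.
  by apply: ubd_wgt => //; near: N.
have h2 : ((expR (N%:R * (r0 - cost h g - eta / 2)))%:E <= wgt N (uball h 1))%E by near: N.
have {}h2 := le_trans h2 (wgt_mono N0 (@subsetT _ (uball h 1))).
have fin : wgt N setT \is a fin_num.
  by rewrite ge0_fin_numE ?wgt_ge0//; apply: le_lt_trans h1 (ltry _).
move: h1 h2; rewrite -(fineK fin) !lee_fin => h1 h2; split => //.
  apply: le_trans h2; rewrite ler_expR ler_pM2l ?ltr0n//.
  by move: (r0) (cost h g) sigma hs => r c s; lra.
apply: le_trans h1 _; rewrite ler_expR ler_pM2l ?ltr0n//.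
by move: (r0) sigma => r s; lra.
Unshelve. all: by end_near. Qed.

Definition pr N E : R := fine (wgt N E) / fine (wgt N setT).

Lemma open_lower O h g eta : openC O -> O h -> adm h g -> 0 < eta ->
  \forall N \near \oo, expR (N%:R * (sigma - cost h g - eta)) <= pr N O.
Proof.
move=> [_ oO] Oh hg eta0; have [d d0 dO] := oO h Oh.
have eta2 : 0 < eta / 2 by rewrite divr_gt0.
have lo := adm_ball_lower hg d0 eta2; have Zb := wgt_setT_bounds eta2.
near=> N; have N0 : (0 < N)%N by near: N; exact: nbhs_infty_gt.
have [fin Zl Zu] : [/\ wgt N setT \is a fin_num,
  expR (N%:R * (r0 - sigma - eta / 2)) <= fine (wgt N setT) &
  fine (wgt N setT) <= expR (N%:R * (r0 - sigma + eta / 2))] by near: N.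
have h1 : ((expR (N%:R * (r0 - cost h g - eta / 2)))%:E <= wgt N (uball h d))%E by near: N.
have {}h1 := le_trans h1 (wgt_mono N0 dO).
have finO : wgt N O \is a fin_num.
  rewrite ge0_fin_numE ?wgt_ge0//; apply: le_lt_trans (wgt_mono N0 (@subsetT _ O)) _.
  by rewrite -ge0_fin_numE ?wgt_ge0.
rewrite -(fineK finO) lee_fin in h1.
rewrite /pr ler_pdivlMr; last by apply: lt_le_trans Zl; exact: expR_gt0.
apply: le_trans h1; apply: le_trans (ler_wpM2l (expR_ge0 _) Zu) _.
rewrite -expRD ler_expR -mulrDr ler_pM2l ?ltr0n//.
by move: (r0) (cost h g) sigma => r c s; lra.
Unshelve. all: by end_near. Qed.

Lemma closed_upper K x eta : closedC K ->
  (forall f g, K f -> adm f g -> sigma + x < cost f g) -> 0 < eta ->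
  \forall N \near \oo, pr N K <= expR (N%:R * (- x + eta)).
Proof.
move=> [_ oK] Kx eta0; have eta2 : 0 < eta / 2 by rewrite divr_gt0.
have up := closed_ubd oK Kx eta2; have Zb := wgt_setT_bounds eta2.
near=> N; have N0 : (0 < N)%N by near: N; exact: nbhs_infty_gt.
have [fin Zl Zu] : [/\ wgt N setT \is a fin_num,
  expR (N%:R * (r0 - sigma - eta / 2)) <= fine (wgt N setT) &
  fine (wgt N setT) <= expR (N%:R * (r0 - sigma + eta / 2))] by near: N.
have h1 : (wgt N K <= (expR (N%:R * (r0 - (sigma + x) + eta / 2)))%:E)%E.
  by apply: ubd_wgt => //; near: N.
have finK : wgt N K \is a fin_num.
  by rewrite ge0_fin_numE ?wgt_ge0//; apply: le_lt_trans h1 (ltry _).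
rewrite -(fineK finK) lee_fin in h1.
rewrite /pr ler_pdivrMr; last by apply: lt_le_trans Zl; exact: expR_gt0.
apply: le_trans h1 _; apply: le_trans (ler_wpM2l (expR_ge0 _) Zl).
rewrite -expRD ler_expR -mulrDr ler_pM2l ?ltr0n//.
by move: (r0) sigma => r s; lra.
Unshelve. all: by end_near. Qed.

Notation rt := (rate e adm).

Lemma rateE h : rt h = ereal_inf [set (cost h g - sigma)%:E | g in adm h].
Proof.
have infE : ereal_inf [set x | exists h' g', adm h' g' /\ x = Sigma e h' g'] = sigma%:E.
  rewrite /sigma -ereal_inf_EFin; [|exact: costs_inf.2|exact: costs_inf.1].
  congr ereal_inf; apply/seteqP; split => [_ [h' [g [hg ->]]]|_ [_ [h' [g [hg ->]]] <-]].
    by exists (cost h' g); [exists h', g|rewrite SigmaE].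
  by exists h', g; rewrite SigmaE.
rewrite /rate infE; congr ereal_inf; apply/seteqP; split => _ [g hg <-]; exists g => //;
  by rewrite SigmaE.
Qed.

Lemma rate_ge0 h : (0 <= rt h)%E.
Proof.
by rewrite rateE; apply: le_ereal_inf_tmp => _ [g hg <-]; rewrite lee_fin subr_ge0 sigma_le.
Qed.

Lemma rate_le_adm h c eta : (rt h <= c%:E)%E -> 0 < eta ->
  exists2 g, adm h g & cost h g < sigma + c + eta.
Proof.
move=> hc eta0; apply: contrapT => no.
have : ((c + eta)%:E <= rt h)%E.
  rewrite rateE; apply: le_ereal_inf_tmp => _ [g hg <-]; rewrite lee_fin leNgt.
  by apply/negP => lt; apply: no; exists g => //; lra.
by move=> /le_trans/(_ hc); rewrite lee_fin gerDl leNgt eta0.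
Qed.

Lemma rate_gt_adm h c : ~ (rt h <= c%:E)%E ->
  exists2 eta, 0 < eta & forall g, adm h g -> sigma + c + eta <= cost h g.
Proof.
move=> nc; apply: contrapT => no; apply: nc; apply/lee_addgt0Pr => eta eta0.
have [g /not_implyP[hg /negP]] : exists g, ~ (adm h g -> sigma + c + eta <= cost h g).
  by apply/existsNP => H; apply: no; exists eta.
rewrite -ltNge => lt; rewrite rateE -EFinD; apply: (@le_trans _ _ (cost h g - sigma)%:E).
  by apply: ereal_inf_lbound; exists g.
by rewrite lee_fin; lra.
Qed.

Definition level c := [set f | C01 f /\ (rt f <= c%:E)%E].

(** A function off the level has a ball whose upper bound has an exponent beyond the level. A member
    of the level at distance below [d / 2] would have a small ball inside it, with a larger lower
    bound. *)
Lemma level_closed c : closedC (level c).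
Proof.
split; first by move=> f [].
split=> [f []//|f [cf nf]].
have [eta eta0 He] := @rate_gt_adm f c ltac:(by move=> fc; apply: nf).
have [|d d0 ub] := @local_ubd f (sigma + c + eta / 2) cf.
  by move=> g /He; apply: lt_le_trans; rewrite ltrD2l; lra.
have d2 : 0 < d / 2 by rewrite divr_gt0.
exists (d / 2) => // h [ch fh]; split => // -[_ hc].
have eta2 : 0 < eta / 2 by rewrite divr_gt0.
have [g hg lt] := rate_le_adm hc eta2.
have sub : uball h (d / 2) `<=` uball f d.
  move=> k [ck hk]; split => // t tI; apply: le_lt_trans (ler_distD (h t) _ _) _.
  by apply: lt_le_trans (ltrD (fh t tI) (hk t tI)) _; lra.
by have := ubd_cost hg d2 sub ub; rewrite leNgt lt.
Qed.

Lemma lipset_sep L h : ~ lipset a L h -> exists2 d, 0 < d & uball h d `<=` ~` lipset a L.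
Proof.
move=> nl; have [h0|h0] := eqVneq (h 0) a; last first.
  exists `|h 0 - a|; first by rewrite normr_gt0 subr_eq0.
  by move=> k [_ /(_ 0)]; rewrite in_I01 lexx ler01 => /(_ isT) + [k0 _]; rewrite k0 ltxx.
have [s /existsNP[t /not_implyP[s01 /not_implyP[t01 /negP]]]] : exists s,
    ~ forall t, 0 <= s <= 1 -> 0 <= t <= 1 -> `|h s - h t| <= L * `|s - t|.
  by apply/existsNP => H; apply: nl.
rewrite -ltNge -subr_gt0 => gap0; set gap := _ - _ in gap0.
exists (gap / 2); first by rewrite divr_gt0.
move=> k [_ hk] [_ /(_ s t s01 t01) kL].
have h1 := hk s; have h2 := hk t; rewrite !in_I01 in h1 h2.
have {}h1 := h1 s01; have {}h2 := h2 t01.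
have : `|h s - h t| <= `|h s - k s| + `|k s - k t| + `|h t - k t|.
  have -> : h s - h t = (h s - k s) + (k s - k t) - (h t - k t) by ring.
  by apply: le_trans (ler_normB _ _) _; rewrite lerD2r ler_normD.
have -> : `|h s - h t| = gap + L * `|s - t| by rewrite /gap; ring.
by move: kL h1 h2; lra.
Qed.

(** Tightness at an exponent beyond the level forces the level into a Lipschitz set: a member
    outside would have a ball outside, too heavy for the tightness bound. *)
Lemma level_compact c : compactC (level c).
Proof.
have [L L0 tight] := tight_ubd a al b be free e (sigma + c + 1).
apply: closed_sub_compact (lipset_compact a L0) (level_closed c) _ => h [ch hc].
apply: contrapT => /lipset_sep[d d0 sub].
have [g hg lt] := rate_le_adm hc ltr01.
by have := ubd_cost hg d0 sub tight; rewrite leNgt lt.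
Qed.

Lemma pr_LDP (P : nat -> set (R -> R) -> \bar R) :
  (forall N E, (0 < N)%N -> P N E = (pr N E)%:E) -> LDP P rt.
Proof.
move=> PE; split; [split; [|split]|split].
- by move=> f _; exact: rate_ge0.
- exact: level_closed.
- exact: level_compact.
- move=> O oO; rewrite leeNl; apply: le_ereal_inf_tmp => _ [h Oh <-].
  rewrite rateE; apply: le_ereal_inf_tmp => _ [g hg <-].
  rewrite leeNl -EFinN; apply/lee_subgt0Pr => eta eta0.
  apply: limn_einf_ge; have lo := open_lower oO Oh hg eta0; near=> N.
  have N0 : (0 < N)%N by near: N; exact: nbhs_infty_gt.
  rewrite PE// -EFinB; apply: le_lne_expR => //.
  by rewrite opprB; near: N.
- move=> K cK; set X := limn_esup _.
  (* Working with reals below the infimum also covers the value [+oo], in particular an empty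
     [K]. *)
  have XK x : (x%:E < ereal_inf (rt @` K))%E -> (X <= (- x)%:E)%E.
    move=> xK; apply/lee_addgt0Pr => eta eta0; apply: limn_esup_le.
    have up : \forall N \near \oo, pr N K <= expR (N%:R * (- x + eta)).
      apply: closed_upper => // f g Kf fg; rewrite addrC -ltrBrDr -lte_fin.
      apply: lt_le_trans xK _; apply: (@le_trans _ _ (rt f)).
        by apply: ereal_inf_lbound; exists f.
      by rewrite rateE; apply: ereal_inf_lbound; exists g.
    near=> N; have N0 : (0 < N)%N by near: N; exact: nbhs_infty_gt.
    by rewrite PE// -EFinD; apply: lne_le_expR => //; near: N.
  rewrite leeNr leNgt; apply/negP => /lt_ereal_real[x /[swap] /XK xX].
  by rewrite ltNge leeNr -EFinN xX.
Unshelve. all: by end_near. Qed.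

End LargeDeviations.

(** * Identification of the two function spaces *)

Section Models.
Context {R : realType}.
Variables (a al b be : R) (e : {nonneg R}).

Lemma adm_clamped : adm a al b be false = H2r a al b be.
Proof.
apply/funext => h; apply/funext => g; apply/propext; split => -[h1].
  by move=> [H h0 h10 /(_ isT)[hb hbe]]; exists h1.
by move=> [H h0 hb h10 hbe]; exists h1.
Qed.

Lemma adm_free : adm a al b be true = H2a a al.
Proof.
apply/funext => h; apply/funext => g; apply/propext; split => -[h1].
  by move=> [H h0 h10 _]; exists h1.
by move=> [H h0 h10]; exists h1.
Qed.

End Models.

Unset Implicit Arguments.

Theorem theorem1p4 (R : realType) (eps : {nonneg R}) (a al b be : R) :
  LDP (fun N O => gamma_r a al b be eps N [set fld | O (profile N fld)])
      (rate eps (H2r a al b be)) /\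
  LDP (fun N O => gamma_a a al eps N [set fld | O (profile N fld)])
      (rate eps (H2a a al)).
Proof.
rewrite -adm_clamped -(adm_free a al 0 0).
split; exact: pr_LDP.
Qed.
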